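(* Let $X=(X_t)_{t\in\mathbb{R}}$ be a SIMMA process $$X_t=\int_{\mathbb{R}\times V}\big(f(t-s,v)-f_0(-s,v)\big)\,W(ds,dv),\qquad t\in\mathbb{R},$$ where the random measure $W$ has characteristics $(\theta,\sigma^2,\rho)$ and control measure $\lambda\otimes m$ (as in the context). Then $$\mathbb{P}\big(\|X\|_{BV[a,b]}<\infty\ \text{ for all } a<b\big)=0\ \text{ or }\ 1.$$
   Context: $(\Omega,\mathcal{F},\mathbb{P})$ is a probability space, $(V,\mathcal{V},m)$ a $\sigma$-finite measure space, $\lambda$ is Lebesgue measure on $\mathbb{R}$, $\mathcal{B}_0=\{A\in\mathcal{B}(\mathbb{R}):\lambda(A)<\infty\}$, $\mathcal{V}_0=\{B\in\mathcal{V}:m(B)<\infty\}$. Write $a\vee b=\max\{a,b\}$, $[\![x]\!]=x/(|x|\vee 1)$. Random measure. $W$ is an infinitely divisible independently scattered random measure on the $\delta$-ring generated by $\mathcal{B}_0\times\mathcal{V}_0$ such that for all $A\in\mathcal{B}_0$, $B\in\mathcal{V}_0$, $u\in\mathbb{R}$, $$\mathbb{E}e^{iuW(A\times B)}=\exp\Big[\lambda(A)\int_B\Big(iu\theta(v)-\tfrac12u^2\sigma^2(v)+\int_{\mathbb{R}}(e^{iux}-1-iu[\![x]\!])\,\rho_v(dx)\Big)m(dv)\Big],$$ where $\theta:V\to\mathbb{R}$ and $\sigma^2:V\to[0,\infty)$ are measurable and $\rho=\{\rho_v:v\in V\}$ is a measurable family of Lévy measures on $\mathbb{R}$ (each $\rho_v$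 is a Lévy measure and $v\mapsto\rho_v(A)$ is measurable for each Borel $A$). $W$ is assumed purely stochastic: $m(\{v:\rho_v(\mathbb{R})=0,\ \sigma^2(v)=0\})=0$. Integral. For measurable deterministic $\phi:\mathbb{R}\times V\to\mathbb{R}$, $\int\phi\,dW$ is the Rajput–Rosiński integral: it exists if there are simple functions $\phi_n\to\phi$ $\lambda\otimes m$-a.e. such that $\int_A\phi_n\,dW$ converges in probability for every measurable $A\subseteq\mathbb{R}\times V$, and then $\int\phi\,dW=\lim\int\phi_n\,dW$. Equivalently, $\int_{\mathbb{R}\times V}|B(\phi(s,v),v)|\,ds\,m(dv)<\infty$ and $\int_{\mathbb{R}\times V}K(\phi(s,v),v)\,ds\,m(dv)<\infty$, where $B(x,v)=x\theta(v)+\int_{\mathbb{R}}([\![xy]\!]-x[\![y]\!])\rho_v(dy)$ and $K(x,v)=x^2\sigma^2(v)+\int_{\mathbb{R}}[\![xy]\!]^2\rho_v(dy)$. SIMMA process. $f,f_0:\mathbb{R}\times V\to\mathbb{R}$ are measurable deterministic functions such that the integral defining $X_t$ exists for every $t\in\mathbb{R}$. $X$ has stationary increments and is continuous in probability. Let $\mathbb{D}\subset\mathbb{R}$ be the dyadic numbers. $X$ is always chosen separable with separant $\mathbb{D}$ (a.s., for every $t$, $X_t$ is a limit of $X_{t_n}$ along some dyadic $t_n\to t$), and likewise $f$ is chosen so that $(f(t-\cdot,\cdot))_{t\in\mathbb{R}}$, viewed as a stochastic process under a probability measure equivalent to $\lambda\otimes m$, is separable with separant $\mathbb{D}$. Variation.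 For $h:\mathbb{R}\to\mathbb{R}$ and $a<b$, $\|h\|_{BV[a,b]}=\sup\sum_{k=1}^n|h(t_k)-h(t_{k-1})|$ over all $n$ and partitions $a=t_0<\dots<t_n=b$. *)

(* Defs.v *)
From HB Require Import structures.
From mathcomp Require Export all_boot all_order all_algebra.
From mathcomp Require Export complex.
From mathcomp Require Export all_classical all_reals all_analysis.
From mathcomp Require Export measurable_realfun.

Set Implicit Arguments.
Unset Strict Implicit.
Unset Printing Implicit Defensive.

Export Order.TTheory GRing.Theory Num.Theory numFieldNormedType.Exports.

Open Scope classical_set_scope.
Open Scope ring_scope.

Definition delta_ring (T : Type) (G : set (set T)) : Prop :=
  setring G /\
  forall F : nat -> set T, (forall n, G (F n)) -> G (\bigcap_n F n).

Definition rect_delta_ring (d : measure_display) (V : measurableType d)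
    (R : realType) (m : {measure set V -> \bar R}) :
    set (set (measurableTypeR R * V)) :=
  smallest (@delta_ring _)
    [set C | exists (A : set (measurableTypeR R)) (B : set V),
       [/\ measurable A, (lebesgue_measure A < +oo)%E,
           measurable B, (m B < +oo)%E & C = A `*` B]].

Definition dyadic (R : realType) : set R :=
  [set x | exists (k : int) (n : nat), x = k%:~R / 2 ^+ n].

Definition cexp (R : realType) (z : R[i]) : R[i] :=
  (expR (complex.Re z) * cos (complex.Im z)
   +i* (expR (complex.Re z) * sin (complex.Im z)))%C.

Definition cintegrable (d : measure_display) (T : measurableType d)
    (R : realType) (mu : {measure set T -> \bar R}) (D : set T)
    (g : T -> R[i]) : Prop :=
  mu.-integrable D (fun x => (complex.Re (g x))%:E) /\
  mu.-integrable D (fun x => (complex.Im (g x))%:E).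

Definition cintegral (d : measure_display) (T : measurableType d)
    (R : realType) (mu : {measure set T -> \bar R}) (D : set T)
    (g : T -> R[i]) : R[i] :=
  (Rintegral mu D (fun x => complex.Re (g x))
   +i* Rintegral mu D (fun x => complex.Im (g x)))%C.

Definition char_fun (d : measure_display) (T : measurableType d)
    (R : realType) (P : probability T R) (X : T -> R) (u : R) : R[i] :=
  cintegral P setT (fun w => cexp ('i%C * (u * X w)%:C)%C).

Definition mutually_independent (d : measure_display) (T : measurableType d)
    (R : realType) (P : probability T R) (I : choiceType)
    (X : I -> {RV P >-> R}) : Prop :=
  forall (s : seq I) (B : I -> set R), uniq s ->
    (forall i, measurable (B i)) ->
    P (\bigcap_(i in [set` s]) (X i @^-1` B i)) =
    (\prod_(i <- s) P (X i @^-1` B i))%E.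

Definition infinitely_divisible (d : measure_display) (T : measurableType d)
    (R : realType) (P : probability T R) (X : {RV P >-> R}) : Prop :=
  forall n : nat, (0 < n)%N ->
    exists (d' : measure_display) (T' : measurableType d')
      (P' : probability T' R) (Y : 'I_n -> {RV P' >-> R}),
      [/\ mutually_independent Y,
          (forall (i j : 'I_n) (B : set R), measurable B ->
             distribution P' (Y i) B = distribution P' (Y j) B) &
          (forall B : set R, measurable B ->
             P' [set w | B (\sum_(i < n) Y i w)] = distribution P X B)].

Definition cvg_in_prob (d : measure_display) (T : measurableType d)
    (R : realType) (P : probability T R) (U : nat -> T -> R) (Z : T -> R) :
    Prop :=
  forall eps : R, 0 < eps ->
    P [set w | eps <= `|U n w - Z w|] @[n --> \oo] --> 0%E.

Definition continuous_in_prob (d : measure_display) (T : measurableType d)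
    (R : realType) (P : probability T R) (X : R -> T -> R) : Prop :=
  forall t eps : R, 0 < eps ->
    P [set w | eps <= `|X s w - X t w|] @[s --> t] --> 0%E.

Definition stationary_increments (d : measure_display) (T : measurableType d)
    (R : realType) (P : probability T R) (X : R -> T -> R) : Prop :=
  forall (n : nat) (t : n.-tuple R) (h : R) (B : set (n.-tuple R)),
    measurable B ->
    P [set w | B [tuple X (tnth t i + h) w - X h w | i < n]] =
    P [set w | B [tuple X (tnth t i) w - X 0 w | i < n]].

(* [E] belongs to the completion of the sigma-algebra of [P], and the completed
   probability, which is the restriction of the outer measure of [P], gives it
   the value [p]. *)
Definition completed_prob (d : measure_display) (T : measurableType d)
    (R : realType) (P : probability T R) (E : set T) (p : \bar R) : Prop :=
  completed_algebra_gen P E /\ (P^*)%mu E = p.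

(* Separability with separant the dyadic numbers. It depends on [mu] only
   through its null sets, hence is the same for [mu] and for a probability
   measure equivalent to [mu]. *)
Definition separable_dyadic (d : measure_display) (T : measurableType d)
    (R : realType) (mu : set T -> \bar R) (Y : R -> T -> R) : Prop :=
  {ae mu, forall w, forall t : R, exists tn : nat -> R,
     [/\ forall n, dyadic (tn n), tn n @[n --> \oo] --> t &
         Y (tn n) w @[n --> \oo] --> Y t w]}.

Definition levy_measure (R : realType)
    (nu : {measure set (measurableTypeR R) -> \bar R}) : Prop :=
  nu [set 0] = 0%E /\ (\int[nu]_x (Num.min 1 (x ^+ 2))%:E < +oo)%E.

Definition levy_trunc (R : realType) (x : R) : R := x / Num.max `|x| 1.

Definition levy_exponent (R : realType) (theta sigma2 : R)
    (nu : {measure set (measurableTypeR R) -> \bar R}) (u : R) : R[i] :=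
  ('i%C * (u * theta)%:C - (u ^+ 2 * sigma2 / 2)%:C
   + cintegral nu setT
       (fun x : R => cexp ('i%C * (u * x)%:C) - 1 - 'i%C * (u * levy_trunc x)%:C))%C.

(* Values of [W] outside the delta-ring are unconstrained. *)
Definition id_random_measure (d d' : measure_display) (T : measurableType d)
    (V : measurableType d') (R : realType) (P : probability T R)
    (m : {measure set V -> \bar R})
    (W : set (measurableTypeR R * V) -> {RV P >-> R}) : Prop :=
  [/\ (forall C, rect_delta_ring m C -> infinitely_divisible (W C)),
      (forall C : nat -> set (measurableTypeR R * V),
         (forall n, rect_delta_ring m (C n)) -> trivIset setT C ->
         mutually_independent (fun n => W (C n))) &
      (forall C : nat -> set (measurableTypeR R * V),
         (forall n, rect_delta_ring m (C n)) -> trivIset setT C ->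
         rect_delta_ring m (\bigcup_n C n) ->
         {ae P, forall w,
            (\sum_(k < n) W (C k) w) @[n --> \oo] --> W (\bigcup_n C n) w})].

(* [Rintegral] is total: integrability of the exponent is what gives the
   formula a meaning. *)
Definition has_characteristics (d d' : measure_display) (T : measurableType d)
    (V : measurableType d') (R : realType) (P : probability T R)
    (m : {measure set V -> \bar R})
    (W : set (measurableTypeR R * V) -> {RV P >-> R})
    (theta sigma2 : V -> R) (rho : R.-ker V ~> measurableTypeR R) : Prop :=
  forall (A : set (measurableTypeR R)) (B : set V) (u : R),
    measurable A -> (lebesgue_measure A < +oo)%E ->
    measurable B -> (m B < +oo)%E ->
    cintegrable m B (fun v => levy_exponent (theta v) (sigma2 v) (rho v) u) /\
    char_fun P (W (A `*` B)) u =
      cexp ((fine (lebesgue_measure A))%:C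
            * cintegral m B
                (fun v => levy_exponent (theta v) (sigma2 v) (rho v) u))%C.

Record simple_fun (T : Type) (R : realType) (S : set (set T)) := SimpleFun {
  sf_size : nat;
  sf_coef : 'I_sf_size -> R;
  sf_set : 'I_sf_size -> set T;
  sf_setP : forall i, S (sf_set i);
  sf_disj : trivIset setT sf_set }.

Definition sf_eval (T : Type) (R : realType) (S : set (set T))
    (phi : simple_fun R S) (x : T) : R :=
  \sum_i sf_coef (s := phi) i * \1_(sf_set (s := phi) i) x.

Definition sf_integral (d : measure_display) (E : Type) (T : measurableType d)
    (R : realType) (P : probability T R) (W : set E -> {RV P >-> R})
    (S : set (set E)) (phi : simple_fun R S) (A : set E) (w : T) : R :=
  \sum_i sf_coef (s := phi) i * W (A `&` sf_set (s := phi) i) w.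

(* [phi] is [W]-integrable and [Y] is (a version of) its integral. *)
Definition is_stoch_integral (d d' : measure_display) (T : measurableType d)
    (V : measurableType d') (R : realType) (P : probability T R)
    (m : {sigma_finite_measure set V -> \bar R})
    (W : set (measurableTypeR R * V) -> {RV P >-> R})
    (phi : measurableTypeR R * V -> R) (Y : {RV P >-> R}) : Prop :=
  measurable_fun setT phi /\
  exists phi_ : nat -> simple_fun R (rect_delta_ring m),
    [/\ {ae (lebesgue_measure \x m)%E, forall x,
           sf_eval (phi_ n) x @[n --> \oo] --> phi x},
        (forall A : set (measurableTypeR R * V), measurable A ->
           exists Z : {RV P >-> R},
             cvg_in_prob P (fun n => sf_integral W (phi_ n) A) Z) &
        cvg_in_prob P (fun n => sf_integral W (phi_ n) setT) Y].

(* Main.v *)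
(* The increments of [X] are mixing under integer time shifts, and bounded
   variation on all compact intervals is an event invariant under these shifts
   and determined by the increments, so it is independent of itself.

   For mixing, the increment process shifted by [h] has the kernel of the
   original one translated by [h].  By the modulus formula
     |E exp(i int phi dW)|^2 = exp (- 2 int k(phi(s,v), v) ds m(dv)),
   where [- k(u, v)] is the real part of the exponent at [u], the part of a
   shifted increment coming from a set [D] bounded in time satisfies
   |E exp(i ...)| -> 1 as [h] tends to infinity: it becomes deterministic modulo
   [2 pi], while the part coming from the complement of [D] is independent of
   the noise in [D].  Here [D] is chosen so that the simple functions defining
   all the shifted integrals are under control on it; such sets exhaust the
   space, so nothing has to be known on the convergence of the simple functions
   elsewhere.  Only characteristic functions occur, and one passes from them to
   events by a multiplicative class argument for trigonometric polynomials. *)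

Require Import Defs.
From mathcomp Require Import ring lra.

Set Implicit Arguments.
Unset Strict Implicit.
Unset Printing Implicit Defensive.

(** For a real variable Y, 1 - |E e^(iY)|^2 is the variance of e^(iY), so its square root bounds the
    covariance of cos Y or sin Y with any real variable of modulus at most 1. This is why only
    squared moduli are followed: drifts contribute phases, which a modulus does not see, and k is
    nonnegative, so that Fatou and Tonelli apply to its integrals. Finiteness of the total mass, the
    integral of k(phi), is drawn from the approximation itself. Scaling the integral by 2^-j brings
    the modulus near 1, which bounds the masses of the approximants; Fatou passes to the limit and
    k(2u) <= 4 k(u) undoes the scaling. Since the total mass is finite, the mass that a far
    translate leaves in a bounded time window tends to 0. The limit along the approximants is taken
    first and the limit in h second, with D fixed. One D must therefore serve all shifts at once,
    although the approximants for different shifts are unrelated; hence a Borel-Cantelli choice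
    instead of one Egorov set for each shift. Shifts are by integers because these carry a dyadic
    grid into a dyadic grid of the same mesh. *)

Definition bounded_meas (R : realType) (d : measure_display)
    (T : measurableType d) (g : T -> R) : Prop :=
  measurable_fun setT g /\ exists M : R, forall w, `|g w| <= M.

(** * Expectations of bounded random variables *)

Section expectation.
Context (R : realType) (d : measure_display) (T : measurableType d)
  (P : probability T R).
Implicit Types (f g : T -> R).

Definition Ex (g : T -> R) : R := Rintegral P setT g.

Lemma bounded_meas_cst (c : R) : bounded_meas (fun _ : T => c).
Proof. by split => //; exists `|c|. Qed.

Lemma bounded_measD f g : bounded_meas f -> bounded_meas g ->
  bounded_meas (fun w => f w + g w).
Proof.
move=> [mf [M fM]] [mg [N gN]]; split; first exact: measurable_funD.
by exists (M + N) => w; rewrite (le_trans (ler_normD _ _))// lerD.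
Qed.

Lemma bounded_measM f g : bounded_meas f -> bounded_meas g ->
  bounded_meas (fun w => f w * g w).
Proof.
move=> [mf [M fM]] [mg [N gN]]; split; first exact: measurable_funM.
by exists (M * N) => w; rewrite normrM ler_pM.
Qed.

Lemma bounded_measZ c g : bounded_meas g -> bounded_meas (fun w => c * g w).
Proof. by move=> ?; apply: bounded_measM => //; exact: bounded_meas_cst. Qed.

Lemma bounded_measN g : bounded_meas g -> bounded_meas (fun w => - g w).
Proof.
move=> bg; rewrite (_ : (fun w => - g w) = (fun w => (-1) * g w)).
  exact: bounded_measZ.
by apply/funext => w; rewrite mulN1r.
Qed.

Lemma bounded_measB f g : bounded_meas f -> bounded_meas g ->
  bounded_meas (fun w => f w - g w).
Proof. by move=> bf bg; apply: bounded_measD => //; exact: bounded_measN. Qed.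

Lemma bounded_meas_norm g : bounded_meas g -> bounded_meas (fun w => `|g w|).
Proof.
move=> [mg [M gM]]; split; first exact: measurableT_comp.
by exists M => w; rewrite normr_id.
Qed.

Lemma bounded_meas_indic (A : set T) : measurable A -> bounded_meas (\1_A : T -> R).
Proof.
move=> mA; split; first exact: measurable_indic.
by exists 1 => w; rewrite indicE; case: (_ \in _); rewrite ?normr1 ?normr0.
Qed.

Lemma measurable_cos g : measurable_fun setT g ->
  measurable_fun setT (fun w => cos (g w)).
Proof.
move=> mg; apply: (measurableT_comp _ mg).
by apply: continuous_measurable_fun => x; exact: continuous_cos.
Qed.

Lemma measurable_sin g : measurable_fun setT g ->
  measurable_fun setT (fun w => sin (g w)).
Proof.
move=> mg; apply: (measurableT_comp _ mg).
by apply: continuous_measurable_fun => x; exact: continuous_sin.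
Qed.

Lemma bounded_meas_cos g : measurable_fun setT g ->
  bounded_meas (fun w => cos (g w)).
Proof.
by move=> mg; split; [exact: measurable_cos|exists 1 => w; exact: cos_max].
Qed.

Lemma bounded_meas_sin g : measurable_fun setT g ->
  bounded_meas (fun w => sin (g w)).
Proof.
by move=> mg; split; [exact: measurable_sin|exists 1 => w; exact: sin_max].
Qed.

Lemma bounded_meas_integrable g : bounded_meas g ->
  P.-integrable setT (EFin \o g).
Proof.
move=> [mg [M gM]]; apply: measurable_bounded_integrable => //.
  exact: (le_lt_trans (probability_le1 P measurableT) (ltry 1)).
exists M; split; first exact: num_real.
by move=> x Mx w _ /=; rewrite (le_trans (gM w))// ltW.
Qed.

Lemma ExD f g : bounded_meas f -> bounded_meas g ->
  Ex (fun w => f w + g w) = Ex f + Ex g.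
Proof. by move=> bf bg; rewrite /Ex RintegralD//; exact: bounded_meas_integrable. Qed.

Lemma ExB f g : bounded_meas f -> bounded_meas g ->
  Ex (fun w => f w - g w) = Ex f - Ex g.
Proof. by move=> bf bg; rewrite /Ex RintegralB//; exact: bounded_meas_integrable. Qed.

Lemma ExZ c g : bounded_meas g -> Ex (fun w => c * g w) = c * Ex g.
Proof. by move=> bg; rewrite /Ex RintegralZl//; exact: bounded_meas_integrable. Qed.

Lemma ExZr c g : bounded_meas g -> Ex (fun w => g w * c) = Ex g * c.
Proof. by move=> bg; rewrite /Ex RintegralZr//; exact: bounded_meas_integrable. Qed.

Lemma Ex_cst (c : R) : Ex (fun=> c) = c.
Proof. by rewrite /Ex Rintegral_cst//= probability_setT mulr1.
Qed.

Lemma Ex_ge0 g : (forall w, 0 <= g w) -> 0 <= Ex g.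
Proof. by move=> g0; apply: Rintegral_ge0. Qed.

Lemma le_Ex f g : bounded_meas f -> bounded_meas g ->
  (forall w, f w <= g w) -> Ex f <= Ex g.
Proof.
by move=> bf bg fg; apply: le_Rintegral => //; exact: bounded_meas_integrable.
Qed.

Lemma norm_Ex g : bounded_meas g -> `|Ex g| <= Ex (fun w => `|g w|).
Proof.
by move=> bg; apply: le_normr_Rintegral => //; exact: bounded_meas_integrable.
Qed.

Lemma Ex_indic A : measurable A -> Ex (\1_A) = fine (P A).
Proof. by move=> mA; rewrite /Ex /Rintegral integral_indic// setIT. Qed.

Lemma Ex_ae_eq f g : measurable_fun setT f -> measurable_fun setT g ->
  {ae P, forall w, f w = g w} -> Ex f = Ex g.
Proof.
move=> mf mg fg; rewrite /Ex /Rintegral; congr fine.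
apply: ae_eq_integral => //; [exact/measurable_EFinP|exact/measurable_EFinP|].
by apply: filterS fg => w /= -> .
Qed.

Lemma Ex_cvg (g_ : nat -> T -> R) g (M : R) :
  (forall n, measurable_fun setT (g_ n)) -> measurable_fun setT g ->
  (forall n w, `|g_ n w| <= M) ->
  {ae P, forall w, g_ n w @[n --> \oo] --> g w} ->
  Ex (g_ n) @[n --> \oo] --> Ex g.
Proof.
move=> mg_ mg gM gcvg.
have iM : P.-integrable setT (EFin \o (fun=> M)).
  exact/bounded_meas_integrable/bounded_meas_cst.
have cE : {ae P, forall w, setT w -> (EFin \o g_ n) w @[n --> \oo] --> (EFin \o g) w}.
  by apply: filterS gcvg => w gw _; apply: cvg_EFin; [exact: nearW|exact: gw].
have bM : {ae P, forall w n, setT w -> (`|(EFin \o g_ n) w| <= (EFin \o (fun=> M)) w)%E}.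
  by apply: aeW => w n _; rewrite /= lee_fin.
have [||ig _ cg] := dominated_convergence measurableT _ _ cE iM bM.
- by move=> n; exact/measurable_EFinP.
- exact/measurable_EFinP.
by apply: fine_cvg; rewrite fineK; [exact: cg|exact: integrable_fin_num].
Qed.

End expectation.

Lemma norm_cosB_le (R : realType) (x y : R) : `|cos x - cos y| <= `|x - y|.
Proof.
wlog xy : x y / x <= y => [hw|].
  by case: (leP x y) => [/hw//|/ltW/hw]; rewrite distrC (distrC y).
have [|z _ h] := @MVT_segment R cos (fun z => - sin z) _ _ xy.
  by apply: continuous_subspaceT; exact: continuous_cos.
rewrite distrC h normrM normrN (distrC x) ler_piMl//; exact: sin_max.
Qed.

Lemma norm_sinB_le (R : realType) (x y : R) : `|sin x - sin y| <= `|x - y|.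
Proof.
wlog xy : x y / x <= y => [hw|].
  by case: (leP x y) => [/hw//|/ltW/hw]; rewrite distrC (distrC y).
have [|z _ h] := @MVT_segment R sin cos _ _ xy.
  by apply: continuous_subspaceT; exact: continuous_sin.
rewrite distrC h normrM (distrC x) ler_piMl//; exact: cos_max.
Qed.

(** * Real and imaginary parts of characteristic functions *)

Section trigonometric_moments.
Context (R : realType) (d : measure_display) (T : measurableType d)
  (P : probability T R).
Implicit Types (X Y Z : T -> R).

Definition Ecos X := Ex P (fun w => cos (X w)).
Definition Esin X := Ex P (fun w => sin (X w)).
Definition cmod2 X := Ecos X ^+ 2 + Esin X ^+ 2.

(* [E e^(i(X+Y)) = E e^(iX) E e^(iY)], split into real and imaginary parts. *)
Definition cf_mul X Y :=
  Ecos (fun w => X w + Y w) = Ecos X * Ecos Y - Esin X * Esin Y /\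
  Esin (fun w => X w + Y w) = Esin X * Ecos Y + Ecos X * Esin Y.

(** Where [Xn] and [X] differ by less than e/2 the Lipschitz bound applies; the remaining event has
    probability at most e/4, and there the integrand is at most 2. *)
Lemma cvg_in_prob_L1 (g : R -> R) (Xn : nat -> T -> R) X :
  measurable_fun setT g -> (forall x, `|g x| <= 1) ->
  (forall x y, `|g x - g y| <= `|x - y|) ->
  (forall n, measurable_fun setT (Xn n)) -> measurable_fun setT X ->
  cvg_in_prob P Xn X ->
  Ex P (fun w => `|g (Xn n w) - g (X w)|) @[n --> \oo] --> (0 : R).
Proof.
move=> mg g1 gL mXn mX XnX; apply/cvgrPdist_le => e e0.
have e20 : 0 < e / 2 by rewrite divr_gt0.
have /fine_cvgP[Pfin Pcvg] := XnX _ e20.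
have e40 : 0 < e / 4 by rewrite divr_gt0.
have bd f : measurable_fun setT f -> bounded_meas (fun w : T => g (f w)).
  by move=> mf; split; [exact: measurableT_comp|exists 1].
move/cvgrPdist_le : Pcvg => /(_ _ e40); apply: filterS => n.
rewrite sub0r normrN /= => Pn.
set A := [set w | e / 2 <= `|Xn n w - X w|] in Pn.
have mA : measurable A.
  rewrite -[A]setTI; apply: (measurable_fun_le (f := cst _)) => //.
  by apply: measurableT_comp => //; exact: measurable_funB.
have PA0 : 0 <= fine (P A) by rewrite fine_ge0.
have bA := @bounded_meas_indic R _ _ _ mA.
have : Ex P (fun w => `|g (Xn n w) - g (X w)|) <=
       Ex P (fun w => e / 2 + 2 * \1_A w).
  apply: le_Ex.
  - by apply: bounded_meas_norm; apply: bounded_measB; exact: bd.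
  - apply: bounded_measD; first exact: bounded_meas_cst.
    exact: bounded_measZ.
  move=> w; rewrite indicE; case: (boolP (w \in A)) => [_|].
    rewrite mulr1 (le_trans (ler_normB _ _))//.
    by have := g1 (Xn n w); have := g1 (X w); lra.
  rewrite notin_setE /A /= => /negP; rewrite -ltNge => /ltW h.
  by rewrite mulr0 addr0 (le_trans (gL _ _)).
rewrite ExD ?Ex_cst ?ExZ ?Ex_indic//; last 2 first.
- exact: bounded_meas_cst.
- exact: bounded_measZ.
move=> h; rewrite sub0r normrN ger0_norm ?Ex_ge0//.
move: Pn; rewrite ger0_norm// => Pn; lra.
Qed.

Lemma cvg_in_prob_Ex (g : R -> R) (Xn : nat -> T -> R) X :
  measurable_fun setT g -> (forall x, `|g x| <= 1) ->
  (forall x y, `|g x - g y| <= `|x - y|) ->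
  (forall n, measurable_fun setT (Xn n)) -> measurable_fun setT X ->
  cvg_in_prob P Xn X ->
  Ex P (fun w => g (Xn n w)) @[n --> \oo] --> Ex P (fun w => g (X w)).
Proof.
move=> mg g1 gL mXn mX XnX.
have bd f : measurable_fun setT f -> bounded_meas (fun w : T => g (f w)).
  by move=> mf; split; [exact: measurableT_comp|exists 1].
apply/cvgrPdist_le => e e0.
have /cvgrPdist_le/(_ _ e0) := cvg_in_prob_L1 mg g1 gL mXn mX XnX.
apply: filterS => n; rewrite sub0r normrN => h.
rewrite distrC -ExB; [|exact: bd|exact: bd].
rewrite (le_trans (norm_Ex _ _))//; first by apply: bounded_measB; exact: bd.
exact: le_trans (ler_norm _) h.
Qed.

Lemma cvg_Ecos (Xn : nat -> T -> R) X :
  (forall n, measurable_fun setT (Xn n)) -> measurable_fun setT X ->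
  cvg_in_prob P Xn X -> Ecos (Xn n) @[n --> \oo] --> Ecos X.
Proof.
apply: (@cvg_in_prob_Ex cos).
- by apply: continuous_measurable_fun; exact: continuous_cos.
- exact: cos_max.
- exact: norm_cosB_le.
Qed.

Lemma cvg_Esin (Xn : nat -> T -> R) X :
  (forall n, measurable_fun setT (Xn n)) -> measurable_fun setT X ->
  cvg_in_prob P Xn X -> Esin (Xn n) @[n --> \oo] --> Esin X.
Proof.
apply: (@cvg_in_prob_Ex sin).
- by apply: continuous_measurable_fun; exact: continuous_sin.
- exact: sin_max.
- exact: norm_sinB_le.
Qed.

Lemma cvg_cmod2 (Xn : nat -> T -> R) X :
  (forall n, measurable_fun setT (Xn n)) -> measurable_fun setT X ->
  cvg_in_prob P Xn X -> cmod2 (Xn n) @[n --> \oo] --> cmod2 X.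
Proof.
move=> mXn mX XnX; rewrite /cmod2.
have c := cvg_Ecos mXn mX XnX; have s := cvg_Esin mXn mX XnX.
by apply: cvgD; apply: (@cvgM _ _ _ _ (fun n => _) (fun n => _)).
Qed.

Lemma Ex_sqr_le g : bounded_meas g -> Ex P g ^+ 2 <= Ex P (fun w => g w ^+ 2).
Proof.
move=> bg; set m := Ex P g.
have bg2 : bounded_meas (fun w => g w ^+ 2) by exact: bounded_measM.
have : 0 <= Ex P (fun w => (g w - m) ^+ 2) by apply: Ex_ge0 => w; exact: sqr_ge0.
rewrite (_ : (fun w => (g w - m) ^+ 2) =
  (fun w => g w ^+ 2 - ((2 * m) * g w - m ^+ 2))); last first.
  by apply/funext => w; ring.
have b1 : bounded_meas (fun w => 2 * m * g w) by exact: bounded_measZ.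
have b2 : bounded_meas (fun _ : T => m ^+ 2) by exact: bounded_meas_cst.
rewrite (ExB _ bg2 (bounded_measB b1 b2)) (ExB _ b1 b2) ExZ// Ex_cst -/m.
by move=> h; lra.
Qed.

(** For [g] and [h] the cosine and sine of one variable, the radicand is the variance of its complex
    exponential. The variance of [g] is E g^2 - (E g)^2, and E h^2 >= (E h)^2 bounds it by the
    radicand. *)
Lemma Ex_dev_le (g h : T -> R) : bounded_meas g -> bounded_meas h ->
  Ex P (fun w => g w ^+ 2 + h w ^+ 2) = 1 ->
  Ex P (fun w => `|g w - Ex P g|) <=
  Num.sqrt (1 - (Ex P g ^+ 2 + Ex P h ^+ 2)).
Proof.
move=> bg bh gh1; set m := Ex P g.
have bgm : bounded_meas (fun w => g w - m).
  by apply: bounded_measB => //; exact: bounded_meas_cst.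
have bgm2 : bounded_meas (fun w => (g w - m) ^+ 2) by exact: bounded_measM.
have bg2 : bounded_meas (fun w => g w ^+ 2) by exact: bounded_measM.
have bh2 : bounded_meas (fun w => h w ^+ 2) by exact: bounded_measM.
rewrite -(ler_pXn2r (_ : 0 < 2)%N) ?nnegrE ?sqrtr_ge0 ?Ex_ge0//.
have hh := Ex_sqr_le bh.
have gg : Ex P (fun w => (g w - m) ^+ 2) = Ex P (fun w => g w ^+ 2) - m ^+ 2.
  rewrite (_ : (fun w => (g w - m) ^+ 2) =
    (fun w => g w ^+ 2 - ((2 * m) * g w - m ^+ 2))); last first.
    by apply/funext => w; ring.
  have b1 : bounded_meas (fun w => 2 * m * g w) by exact: bounded_measZ.
  have b2 : bounded_meas (fun _ : T => m ^+ 2) by exact: bounded_meas_cst.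
  rewrite (ExB _ bg2 (bounded_measB b1 b2)) (ExB _ b1 b2) ExZ// Ex_cst -/m.
  by ring.
move: gh1; rewrite ExD// => gh1.
have le1 : Ex P (fun w => `|g w - m|) ^+ 2 <= 1 - (m ^+ 2 + Ex P h ^+ 2).
  rewrite (le_trans (Ex_sqr_le (bounded_meas_norm bgm)))//.
  rewrite (_ : (fun w => `|g w - m| ^+ 2) = (fun w => (g w - m) ^+ 2)).
    by rewrite gg; lra.
  by apply/funext => w; rewrite real_normK// num_real.
by rewrite sqr_sqrtr// (le_trans _ le1)// sqr_ge0.
Qed.

(** The covariance is the expectation of [z] times the centred [g], hence at most the mean deviation
    of [g]. *)
Lemma Ex_cov_le z (g h : T -> R) : bounded_meas z -> (forall w, `|z w| <= 1) ->
  bounded_meas g -> bounded_meas h ->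
  Ex P (fun w => g w ^+ 2 + h w ^+ 2) = 1 ->
  `|Ex P (fun w => z w * g w) - Ex P z * Ex P g| <=
  Num.sqrt (1 - (Ex P g ^+ 2 + Ex P h ^+ 2)).
Proof.
move=> bz z1 bg bh gh1; apply: le_trans (Ex_dev_le bg bh gh1).
set m := Ex P g.
have bgm : bounded_meas (fun w => g w - m).
  by apply: bounded_measB => //; exact: bounded_meas_cst.
have bzg : bounded_meas (fun w => z w * g w) by exact: bounded_measM.
have bzm : bounded_meas (fun w => z w * m).
  by apply: bounded_measM => //; exact: bounded_meas_cst.
rewrite -ExZr// -ExB//.
rewrite (_ : (fun w => _ - _) = (fun w => z w * (g w - m))); last first.
  by apply/funext => w; ring.
have b : bounded_meas (fun w => z w * (g w - m)) by exact: bounded_measM.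
rewrite (le_trans (norm_Ex _ _))//; apply: le_Ex => //.
- exact: bounded_meas_norm.
- exact: bounded_meas_norm.
- by move=> w; rewrite normrM ler_piMl.
Qed.

Lemma cmod2_dev X Y : measurable_fun setT X -> measurable_fun setT Y ->
  let s := Num.sqrt (1 - cmod2 Y) in
  `|Ecos (fun w => X w + Y w) - (Ecos X * Ecos Y - Esin X * Esin Y)|
    <= 2 * s /\
  `|Esin (fun w => X w + Y w) - (Esin X * Ecos Y + Ecos X * Esin Y)|
    <= 2 * s.
Proof.
move=> mX mY s.
have bcX := bounded_meas_cos mX; have bsX := bounded_meas_sin mX.
have bcY := bounded_meas_cos mY; have bsY := bounded_meas_sin mY.
have e1 : Ex P (fun w => cos (Y w) ^+ 2 + sin (Y w) ^+ 2) = 1.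
  rewrite (_ : (fun w => _) = (fun=> 1)) ?Ex_cst//.
  by apply/funext => w; exact: cos2Dsin2.
have e1' : Ex P (fun w => sin (Y w) ^+ 2 + cos (Y w) ^+ 2) = 1.
  by rewrite -[RHS]e1; congr (Ex P _); apply/funext => w; rewrite addrC.
have c1 w : `|cos (X w)| <= 1 by exact: cos_max.
have s1 w : `|sin (X w)| <= 1 by exact: sin_max.
have cc := Ex_cov_le bcX c1 bcY bsY e1.
have sc := Ex_cov_le bsX s1 bcY bsY e1.
have cs := Ex_cov_le bcX c1 bsY bcY e1'.
have ss := Ex_cov_le bsX s1 bsY bcY e1'.
rewrite (addrC (Ex P (fun w => sin (Y w)) ^+ 2)) in cs ss.
rewrite -/(cmod2 Y) -/s in cc sc cs ss.
split.
- rewrite /Ecos; under eq_fun do rewrite cosD.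
  rewrite ExB; [|exact: bounded_measM|exact: bounded_measM].
  rewrite (_ : _ - _ - _ =
   (Ex P (fun w => cos (X w) * cos (Y w)) - Ecos X * Ecos Y) -
   (Ex P (fun w => sin (X w) * sin (Y w)) - Esin X * Esin Y)).
    by rewrite (le_trans (ler_normB _ _))// mulr_natl mulr2n lerD.
  by rewrite /Ecos /Esin; ring.
- rewrite /Esin; under eq_fun do rewrite sinD.
  rewrite ExD; [|exact: bounded_measM|exact: bounded_measM].
  rewrite (_ : _ + _ - _ =
   (Ex P (fun w => sin (X w) * cos (Y w)) - Esin X * Ecos Y) +
   (Ex P (fun w => cos (X w) * sin (Y w)) - Ecos X * Esin Y)).
    by rewrite (le_trans (ler_normD _ _))// mulr_natl mulr2n lerD.
  by rewrite /Ecos /Esin; ring.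
Qed.

Lemma norm_Ecos_le1 X : measurable_fun setT X -> `|Ecos X| <= 1.
Proof.
move=> mX; have bX := bounded_meas_cos mX.
rewrite (le_trans (norm_Ex _ bX))// -[leRHS](Ex_cst P 1); apply: le_Ex.
- exact: bounded_meas_norm.
- exact: bounded_meas_cst.
- by move=> w; exact: cos_max.
Qed.

Lemma norm_Esin_le1 X : measurable_fun setT X -> `|Esin X| <= 1.
Proof.
move=> mX; have bX := bounded_meas_sin mX.
rewrite (le_trans (norm_Ex _ bX))// -[leRHS](Ex_cst P 1); apply: le_Ex.
- exact: bounded_meas_norm.
- exact: bounded_meas_cst.
- by move=> w; exact: sin_max.
Qed.

(* If [J] is independent of [B] and [I], and [I] is nearly deterministic modulo
   [2 pi], then [e^(i B)] and [e^(i (I + J))] are nearly uncorrelated. *)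
Lemma cmod2_decorrelate (B I J : T -> R) :
  measurable_fun setT B -> measurable_fun setT I -> measurable_fun setT J ->
  cf_mul (fun w => B w + I w) J -> cf_mul I J ->
  let s := Num.sqrt (1 - cmod2 I) in
  let Y := fun w => I w + J w in
  `|Ecos (fun w => B w + Y w) - (Ecos B * Ecos Y - Esin B * Esin Y)| <= 4 * s /\
  `|Esin (fun w => B w + Y w) - (Esin B * Ecos Y + Ecos B * Esin Y)| <= 4 * s.
Proof.
move=> mB mI mJ [BIJc BIJs] [IJc IJs] s Y.
have [] := cmod2_dev mB mI; rewrite -/s.
rewrite /Y.
have -> : Ecos (fun w => B w + (I w + J w)) = Ecos (fun w => B w + I w + J w).
  by congr Ecos; apply/funext => w; rewrite addrA.
have -> : Esin (fun w => B w + (I w + J w)) = Esin (fun w => B w + I w + J w).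
  by congr Esin; apply/funext => w; rewrite addrA.
rewrite BIJc BIJs IJc IJs.
have := norm_Ecos_le1 mJ; have := norm_Esin_le1 mJ.
set cJ := Ecos J; set sJ := Esin J; set c := Ecos (fun w => _); set s' := Esin (fun w => B w + I w).
move=> sJ1 cJ1.
(* The characteristic function of [J] factors out of both terms, so what remains is the error dc + i
   ds of the pair [B], [I], multiplied by a number with real and imaginary parts at most 1 in
   modulus. *)
set dc := c - _; set ds := s' - _ => hc hs.
have s0 : 0 <= s by exact: sqrtr_ge0.
have bb (x y a b : R) : `|x| <= 1 -> `|y| <= 1 -> `|a| <= 2 * s -> `|b| <= 2 * s ->
    `|x * a + y * b| <= 4 * s.
  move=> x1 y1 a1 b1; rewrite (le_trans (ler_normD _ _))// !normrM.
  have : `|x| * `|a| <= 2 * s by rewrite (le_trans _ a1)// ler_piMl.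
  have : `|y| * `|b| <= 2 * s by rewrite (le_trans _ b1)// ler_piMl.
  by move=> ? ?; lra.
split.
- rewrite (_ : _ - _ = cJ * dc + (- sJ) * ds); last by rewrite /dc /ds; ring.
  by apply: bb => //; rewrite normrN.
- rewrite (_ : _ - _ = cJ * ds + sJ * dc); last by rewrite /dc /ds; ring.
  exact: bb.
Qed.

Lemma Ecos_ae_eq X Y : measurable_fun setT X -> measurable_fun setT Y ->
  {ae P, forall w, X w = Y w} -> Ecos X = Ecos Y.
Proof.
move=> mX mY XY; apply: Ex_ae_eq; [exact: measurable_cos..|].
by apply: filterS XY => w ->.
Qed.

Lemma Esin_ae_eq X Y : measurable_fun setT X -> measurable_fun setT Y ->
  {ae P, forall w, X w = Y w} -> Esin X = Esin Y.
Proof.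
move=> mX mY XY; apply: Ex_ae_eq; [exact: measurable_sin..|].
by apply: filterS XY => w ->.
Qed.

Lemma cmod2_ae_eq X Y : measurable_fun setT X -> measurable_fun setT Y ->
  {ae P, forall w, X w = Y w} -> cmod2 X = cmod2 Y.
Proof.
by move=> mX mY XY; rewrite /cmod2 (Ecos_ae_eq mX mY)// (Esin_ae_eq mX mY).
Qed.

End trigonometric_moments.

(** * Independence and characteristic functions *)

(** The sum counts the positive integers up to [y], so it is the integer part of [y]; the range 1,
    ..., N suffices because [y] is at most [N]. *)
Lemma step_approx (R : realType) (N : nat) (y : R) : 0 <= y <= N%:R ->
  `|\sum_(j < N) (j.+1%:R <= y)%R%:R - y| <= 1.
Proof.
elim: N y => [|N IH] y /andP[y0 yN].
  by rewrite big_ord0 sub0r normrN ger0_norm// (le_trans yN).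
rewrite big_ord_recr /=; have [yN'|Ny] := leP y N%:R.
  rewrite (_ : (N.+1%:R <= y)%R = false) ?addr0; last first.
    by apply/negbTE; rewrite -ltNge (le_lt_trans yN')// ltr_nat.
  by apply: IH; rewrite y0.
have -> : \sum_(i < N) (i.+1%:R <= y)%R%:R = N%:R :> R.
  rewrite (eq_bigr (fun=> 1)) ?sumr_const ?card_ord//.
  by move=> i _; rewrite (le_trans _ (ltW Ny)) ?ler_nat ?ltn_ord.
move: yN; rewrite -natr1 => yN; case: (leP _ y) => h /=.
  by rewrite ler_norml; apply/andP; split; lra.
by rewrite ler_norml; apply/andP; split; lra.
Qed.

Section independence.
Context (R : realType) (d : measure_display) (T : measurableType d)
  (P : probability T R).

Lemma Ex_sum (I : Type) (s : seq I) (F : I -> T -> R) :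
  (forall i, bounded_meas (F i)) ->
  bounded_meas (fun w => \sum_(i <- s) F i w) /\
  Ex P (fun w => \sum_(i <- s) F i w) = \sum_(i <- s) Ex P (F i).
Proof.
move=> bF; elim: s => [|i s [bs IH]].
  rewrite big_nil; under eq_fun do rewrite big_nil.
  by split; [exact: bounded_meas_cst|rewrite Ex_cst].
rewrite big_cons; under eq_fun do rewrite big_cons.
by split; [exact: bounded_measD|rewrite ExD// IH].
Qed.

(** Layer-cake approximation: [g] is within 1/n of the sum over j of 1/n times the indicator of {n g
    >= j}. The factorization holds for these indicators, and each of the two replacements costs at
    most K/n. *)
Lemma Ex_indep_ge0 (X Z : T -> R) (g : R -> R) (M : R) :
  measurable_fun setT X -> bounded_meas Z ->
  (forall B, measurable B -> Ex P (fun w => \1_B (X w) * Z w) =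
    Ex P (fun w => \1_B (X w)) * Ex P Z) ->
  measurable_fun setT g -> (forall x, 0 <= g x <= M) ->
  Ex P (fun w => g (X w) * Z w) = Ex P (fun w => g (X w)) * Ex P Z.
Proof.
move=> mX bZ XZ mg gM.
have [mZ [K ZK]] := bZ.
have M0 : 0 <= M by have /andP[/le_trans] := gM 0; apply.
have K0 : 0 <= K by exact: le_trans (ZK point).
have bi (B : set R) : measurable B -> bounded_meas (fun w => \1_B (X w) : R).
  move=> mB; split; first by apply: measurableT_comp => //; exact: measurable_indic.
  by exists 1 => w; rewrite indicE; case: (_ \in _); rewrite ?normr1 ?normr0.
have bg : bounded_meas (fun w => g (X w)).
  split; first exact: measurableT_comp.
  by exists M => w; have /andP[g0 ?] := gM (X w); rewrite ger0_norm.
have bgZ : bounded_meas (fun w => g (X w) * Z w) by exact: bounded_measM.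
have bdist (f h : T -> R) (e : R) : bounded_meas f -> bounded_meas h ->
    (forall w, `|f w - h w| <= e) -> `|Ex P f - Ex P h| <= e.
  move=> bf bh fh; rewrite -ExB// (le_trans (norm_Ex _ _))//.
    exact: bounded_measB.
  rewrite -[leRHS](Ex_cst P); apply: le_Ex => //.
    by apply: bounded_meas_norm; exact: bounded_measB.
  exact: bounded_meas_cst.
have key (n : nat) : (0 < n)%N ->
    `|Ex P (fun w => g (X w) * Z w) - Ex P (fun w => g (X w)) * Ex P Z| <=
    2 * K / n%:R.
  move=> n0; have nR0 : 0 < n%:R :> R by rewrite ltr0n.
  pose N := (Num.trunc (n%:R * M)).+1.
  have nMN : n%:R * M <= N%:R by rewrite ltW// truncnS_gt.
  pose B (j : 'I_N) : set R := [set x | j.+1%:R <= n%:R * g x].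
  have mB j : measurable (B j).
    rewrite -[B j]setTI; apply: (measurable_fun_le (f := cst _)) => //.
    exact: measurable_funM.
  pose h x : R := \sum_(j < N) n%:R^-1 * \1_(B j) x.
  have gh x : `|g x - h x| <= n%:R^-1.
    have /andP[g0 gM'] := gM x.
    rewrite -(ler_pM2l nR0) mulfV ?gt_eqF// -{1}(gtr0_norm nR0) -normrM mulrBr.
    rewrite distrC /h mulr_sumr.
    have -> : \sum_(j < N) n%:R * (n%:R^-1 * \1_(B j) x) =
        \sum_(j < N) (j.+1%:R <= n%:R * g x)%R%:R :> R.
      apply: eq_bigr => j _; rewrite mulrA mulfV ?gt_eqF// mul1r indicE; congr (_%:R).
      congr nat_of_bool; apply/idP/idP; first by move/set_mem.
      by move=> ?; apply/mem_set.
    apply: step_approx; rewrite mulr_ge0 ?ler0n//= (le_trans _ nMN)//.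
    by rewrite ler_pM2l.
  have bh1 (j : 'I_N) : bounded_meas (fun w => n%:R^-1 * \1_(B j) (X w) : R).
    by apply: bounded_measZ; exact: bi.
  have [bh Eh] := Ex_sum (index_enum 'I_N) bh1.
  have bh2 (j : 'I_N) : bounded_meas (fun w => n%:R^-1 * \1_(B j) (X w) * Z w : R).
    exact: bounded_measM.
  have [bhZ EhZ] := Ex_sum (index_enum 'I_N) bh2.
  have hE : Ex P (fun w => h (X w) * Z w) = Ex P (fun w => h (X w)) * Ex P Z.
    rewrite /h; under eq_fun do rewrite mulr_suml.
    rewrite EhZ Eh mulr_suml; apply: eq_bigr => j _.
    have bj := bi _ (mB j).
    rewrite (ExZ _ _ bj) -mulrA -(XZ _ (mB j)) -ExZ; last exact: bounded_measM.
    by under eq_fun do rewrite -mulrA.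
  have bhX : bounded_meas (fun w => h (X w)) by exact: bh.
  have bhXZ : bounded_meas (fun w => h (X w) * Z w) by exact: bounded_measM.
  rewrite (_ : _ - _ = (Ex P (fun w => g (X w) * Z w) - Ex P (fun w => h (X w) * Z w))
    - (Ex P (fun w => g (X w)) - Ex P (fun w => h (X w))) * Ex P Z); last first.
    by rewrite hE; ring.
  have le1 : `|Ex P (fun w => g (X w) * Z w) - Ex P (fun w => h (X w) * Z w)| <= K / n%:R.
    apply: bdist => // w; rewrite -mulrBl normrM mulrC ler_pM//.
  have le2 : `|Ex P (fun w => g (X w)) - Ex P (fun w => h (X w))| <= n%:R^-1.
    exact: bdist.
  have le3 : `|Ex P Z| <= K.
    rewrite (le_trans (norm_Ex _ bZ))// -[leRHS](Ex_cst P); apply: le_Ex => //.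
      exact: bounded_meas_norm.
    exact: bounded_meas_cst.
  rewrite (le_trans (ler_normB _ _))// normrM.
  rewrite (_ : 2 * K / n%:R = K / n%:R + n%:R^-1 * K); last by ring.
  by rewrite lerD// ler_pM.
apply/eqP; rewrite -subr_eq0 -normr_le0; apply/ler_addgt0Pr => e e0; rewrite add0r.
pose n := (Num.trunc (2 * K / e)).+1.
apply: le_trans (key n isT) _.
rewrite ler_pdivrMr ?ltr0n// [e * _]mulrC -ler_pdivrMr//.
by rewrite ltW// truncnS_gt.
Qed.

Lemma Ex_indep (X Z : T -> R) (g : R -> R) :
  measurable_fun setT X -> bounded_meas Z ->
  (forall B, measurable B -> Ex P (fun w => \1_B (X w) * Z w) =
    Ex P (fun w => \1_B (X w)) * Ex P Z) ->
  bounded_meas g ->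
  Ex P (fun w => g (X w) * Z w) = Ex P (fun w => g (X w)) * Ex P Z.
Proof.
move=> mX bZ XZ [mg [M gM]].
have bg : bounded_meas (fun w => g (X w)).
  by split; [exact: measurableT_comp|exists M].
have gM0 x : 0 <= g x + M <= 2 * M.
  by have := gM x; rewrite ler_norml => /andP[? ?]; apply/andP; split; lra.
have mgM : measurable_fun setT (fun x => g x + M) by exact: measurable_funD.
have := Ex_indep_ge0 mX bZ XZ mgM gM0.
under eq_fun do rewrite mulrDl.
rewrite (ExD P (bounded_measM bg bZ) (bounded_measZ M bZ)).
rewrite (ExD P bg (bounded_meas_cst _ M)).
by rewrite ExZ// Ex_cst mulrDl => /addIr.
Qed.

Section mutual.
Variables (X : nat -> {RV P >-> R}) (c : nat -> R).
Hypothesis indepX : mutually_independent X.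

Let S n w := \sum_(k < n) c k * X k w.

Let mS n : measurable_fun setT (S n).
Proof. by apply: measurable_sum => k; exact: measurable_funM. Qed.

Let ev (s : seq nat) (B : nat -> set R) := \bigcap_(i in [set` s]) X i @^-1` B i.

Let mev s B : (forall i, measurable (B i)) -> measurable (ev s B).
Proof.
move=> mB; apply: fin_bigcap_measurable => // i _.
exact: measurable_funPTI.
Qed.

Let prodP s B : uniq s -> (forall i, measurable (B i)) ->
  fine (P (ev s B)) = \prod_(i <- s) fine (P (X i @^-1` B i)).
Proof.
move=> us mB; rewrite indepX//.
have mX i : measurable (X i @^-1` B i).
  exact: measurable_funPTI.
elim: s {us} => [|i s IH]; first by rewrite !big_nil.
rewrite !big_cons fineM ?IH//; first exact: fin_num_measure.
by apply: prode_fin_num => j _; exact: fin_num_measure.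
Qed.

(** The indicator of an event of [X n] is absorbed into [ev s B] by adding the index [n] to [s]. The
    assumption then applies both with and without this index, and [Ex_indep] passes from indicators
    to [g]. *)
Let indep_at n s B (f g : R -> R) : uniq s -> (forall i, i \in s -> (n < i)%N) ->
  (forall i, measurable (B i)) -> bounded_meas f -> bounded_meas g ->
  (forall s B, uniq s -> (forall i, i \in s -> (n <= i)%N) ->
     (forall i, measurable (B i)) ->
     Ex P (fun w => f (S n w) * \1_(ev s B) w) =
     Ex P (fun w => f (S n w)) * fine (P (ev s B))) ->
  Ex P (fun w => g (X n w) * (f (S n w) * \1_(ev s B) w)) =
  Ex P (fun w => g (X n w)) * (Ex P (fun w => f (S n w)) * fine (P (ev s B))).
Proof.
move=> us ns mB bf bg IH.
have [mf [M fM]] := bf.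
have bfS : bounded_meas (fun w => f (S n w)).
  by split; [exact: measurableT_comp|exists M => w].
have bZ : bounded_meas (fun w => f (S n w) * \1_(ev s B) w).
  by apply: bounded_measM => //; exact/bounded_meas_indic/mev.
have nns : n \notin s by apply/negP => /ns; rewrite ltnn.
rewrite -IH//; last by move=> i /ns/ltnW.
apply: Ex_indep => // B0 mB0.
pose B' i := if i == n then B0 else B i.
have mB' i : measurable (B' i) by rewrite /B'; case: ifP.
have evE : ev (n :: s) B' = (X n @^-1` B0) `&` ev s B.
  apply/seteqP; split => w.
    move=> h; split; first by have := h n; rewrite /= mem_head /B' eqxx; apply.
    move=> i /= si; have := h i; rewrite /= in_cons si orbT /B'.
    by rewrite (_ : (i == n) = false); [apply|apply: contraNF nns => /eqP <-].
  move=> [h1 h2] i; rewrite /= in_cons => /orP[/eqP ->|si].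
    by rewrite /B' eqxx.
  rewrite /B' (_ : (i == n) = false); first exact: h2.
  by apply: contraNF nns => /eqP <-.
have e1 w : \1_B0 (X n w) * (f (S n w) * \1_(ev s B) w) =
    f (S n w) * \1_(ev (n :: s) B') w.
  rewrite evE indicI mulrCA; congr (_ * (_ * _)).
under eq_fun do rewrite e1.
rewrite IH//; last 2 first.
- by rewrite /= nns.
- by move=> i; rewrite in_cons => /orP[/eqP ->//|/ns/ltnW].
rewrite IH//; last by move=> i /ns/ltnW.
rewrite !prodP//=; last by rewrite nns.
rewrite big_cons {1}/B' eqxx.
have -> : \prod_(j <- s) fine (P (X j @^-1` B' j)) =
          \prod_(j <- s) fine (P (X j @^-1` B j)).
  apply: eq_big_seq => j sj; rewrite /B' (_ : (j == n) = false)//.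
  by apply: contraNF nns => /eqP <-.
have -> : Ex P (fun w => \1_B0 (X n w)) = fine (P (X n @^-1` B0)).
  rewrite -Ex_indic//.
  exact: measurable_funPTI.
by ring.
Qed.

Let bcos a : bounded_meas (fun x : R => cos (a * x)).
Proof. by apply: bounded_meas_cos; exact: measurable_funM. Qed.

Let bsin a : bounded_meas (fun x : R => sin (a * x)).
Proof. by apply: bounded_meas_sin; exact: measurable_funM. Qed.

Let bcos1 : bounded_meas (fun x : R => cos x).
Proof. by apply: bounded_meas_cos. Qed.

Let bsin1 : bounded_meas (fun x : R => sin x).
Proof. by apply: bounded_meas_sin. Qed.

Let ev0 B : ev [::] B = setT.
Proof. by apply/seteqP; split => // w _ i /=; rewrite in_nil. Qed.

(** Independence is given on events only. The induction on the number of summands therefore carries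
    along an arbitrary finite-dimensional event of the variables that have not yet entered the
    sum. *)
Let tail_claim n := forall s B, uniq s -> (forall i, i \in s -> (n <= i)%N) ->
  (forall i, measurable (B i)) ->
  Ex P (fun w => cos (S n w) * \1_(ev s B) w) = Ecos P (S n) * fine (P (ev s B)) /\
  Ex P (fun w => sin (S n w) * \1_(ev s B) w) = Esin P (S n) * fine (P (ev s B)).

Let bm n s B (g f : R -> R) : (forall i, measurable (B i)) ->
  bounded_meas g -> bounded_meas f ->
  bounded_meas (fun w => g (X n w) * (f (S n w) * \1_(ev s B) w)).
Proof.
move=> mB [mg [M gM]] [mf [M' fM]]; apply: bounded_measM.
  by split; [exact: measurableT_comp|exists M].
apply: bounded_measM; last exact/bounded_meas_indic/mev.
by split; [exact: measurableT_comp|exists M'].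
Qed.

Let indep_nil n (f g : R -> R) : bounded_meas f -> bounded_meas g ->
  (forall s B, uniq s -> (forall i, i \in s -> (n <= i)%N) ->
     (forall i, measurable (B i)) ->
     Ex P (fun w => f (S n w) * \1_(ev s B) w) =
     Ex P (fun w => f (S n w)) * fine (P (ev s B))) ->
  Ex P (fun w => g (X n w) * f (S n w)) =
  Ex P (fun w => g (X n w)) * Ex P (fun w => f (S n w)).
Proof.
move=> bf bg h.
have := @indep_at n [::] (fun=> setT) f g isT (fun i => ltac:(by [])) _ bf bg h.
rewrite ev0 probability_setT mulr1 => <- //.
by congr (Ex P _); apply/funext => w; rewrite indicT mulr1.
Qed.

Let tail_cf n : tail_claim n -> cf_mul P (S n) (fun w => c n * X n w).
Proof.
move=> IH.
have ic g (bg : bounded_meas g) :=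
  indep_nil bcos1 bg (fun s B us ns mB => (IH s B us ns mB).1).
have ics g (bg : bounded_meas g) :=
  indep_nil bsin1 bg (fun s B us ns mB => (IH s B us ns mB).2).
have b (g f : R -> R) : bounded_meas g -> bounded_meas f ->
    bounded_meas (fun w => g (X n w) * f (S n w)).
  move=> [mg [M gM]] [mf [M' fM]]; apply: bounded_measM.
    by split; [exact: measurableT_comp|exists M].
  by split; [exact: measurableT_comp|exists M'].
split.
- rewrite {1}/Ecos.
  have -> : (fun w => cos (S n w + c n * X n w)) = fun w =>
    cos (c n * X n w) * cos (S n w) - sin (c n * X n w) * sin (S n w).
    by apply/funext => w; rewrite cosD; ring.
  rewrite ExB; [|exact: (b _ _ (bcos _) bcos1)|exact: (b _ _ (bsin _) bsin1)].
  rewrite (ic _ (bcos _)) (ics _ (bsin _)).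
  by rewrite /Ecos /Esin; ring.
- rewrite {1}/Esin.
  have -> : (fun w => sin (S n w + c n * X n w)) = fun w =>
    cos (c n * X n w) * sin (S n w) + sin (c n * X n w) * cos (S n w).
    by apply/funext => w; rewrite sinD; ring.
  rewrite ExD; [|exact: (b _ _ (bcos _) bsin1)|exact: (b _ _ (bsin _) bcos1)].
  rewrite (ic _ (bsin _)) (ics _ (bcos _)).
  by rewrite /Ecos /Esin; ring.
Qed.

Let tail_indep n : tail_claim n.
Proof.
elim: n => [|n IH] s B us ns mB.
  have S0 : S 0 = fun=> 0 by apply/funext => w; rewrite /S big_ord0.
  have b1 : bounded_meas (\1_(ev s B) : T -> R) by exact/bounded_meas_indic/mev.
  rewrite /Ecos /Esin S0 cos0 sin0.
  by rewrite !ExZ// !Ex_cst !Ex_indic//; exact: mev.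
have ic g (bg : bounded_meas g) :=
  indep_at us ns mB bcos1 bg (fun s B us ns mB => (IH s B us ns mB).1).
have ics g (bg : bounded_meas g) :=
  indep_at us ns mB bsin1 bg (fun s B us ns mB => (IH s B us ns mB).2).
have cfn := tail_cf IH.
have SE : S n.+1 = fun w => S n w + c n * X n w.
  by apply/funext => w; rewrite /S big_ord_recr.
rewrite SE cfn.1 cfn.2; split.
- have -> : (fun w => cos (S n w + c n * X n w) * \1_(ev s B) w) = fun w =>
    cos (c n * X n w) * (cos (S n w) * \1_(ev s B) w) -
    sin (c n * X n w) * (sin (S n w) * \1_(ev s B) w).
    by apply/funext => w; rewrite cosD; ring.
  rewrite (ExB P (bm n s mB (bcos _) bcos1) (bm n s mB (bsin _) bsin1)).
  rewrite (ic _ (bcos _)) (ics _ (bsin _)).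
  by rewrite /Ecos /Esin; ring.
- have -> : (fun w => sin (S n w + c n * X n w) * \1_(ev s B) w) = fun w =>
    cos (c n * X n w) * (sin (S n w) * \1_(ev s B) w) +
    sin (c n * X n w) * (cos (S n w) * \1_(ev s B) w).
    by apply/funext => w; rewrite sinD; ring.
  rewrite (ExD P (bm n s mB (bcos _) bsin1) (bm n s mB (bsin _) bcos1)).
  rewrite (ic _ (bsin _)) (ics _ (bcos _)).
  by rewrite /Ecos /Esin; ring.
Qed.

Lemma mutually_independent_cf_mul n :
  cf_mul P (fun w => \sum_(k < n) c k * X k w) (fun w => c n * X n w).
Proof. exact: tail_cf (@tail_indep n). Qed.

End mutual.
End independence.

(** * The delta-ring of bounded sets and the random measure *)

Section delta_ring_of_boxes.
Context (R : realType) (d : measure_display) (V : measurableType d)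
  (m : {measure set V -> \bar R}).
Local Notation E := (measurableTypeR R * V)%type.
Local Notation S := (rect_delta_ring m).

Lemma delta_ring_smallest (U : Type) (G : set (set U)) :
  delta_ring (smallest (@delta_ring U) G).
Proof.
split; [split|].
- by move=> M [[[? ? ?] _] _].
- by move=> A B SA SB M hM; have [[[_ MU _] _] _] := hM; apply: MU; [exact: SA|exact: SB].
- by move=> A B SA SB M hM; have [[[_ _ MD] _] _] := hM; apply: MD; [exact: SA|exact: SB].
- by move=> F SF M hM; have [[_ MI] _] := hM; apply: MI => n; exact: SF.
Qed.

Let S_delta : delta_ring S. Proof. exact: delta_ring_smallest. Qed.

Definition finite_box (A : set (measurableTypeR R)) (B : set V) :=
  [/\ measurable A, (lebesgue_measure A < +oo)%E, measurable B & (m B < +oo)%E].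

Lemma rect_delta_ring_box A B : finite_box A B -> S (A `*` B).
Proof. by move=> [mA fA mB fB] M [_]; apply; exists A, B. Qed.

Lemma finite_boxU A B A' B' : finite_box A B -> finite_box A' B' ->
  finite_box (A `|` A') (B `|` B').
Proof.
move=> [mA fA mB fB] [mA' fA' mB' fB']; split; [exact: measurableU| |exact: measurableU|].
  by rewrite (le_lt_trans (measureU2 _ _ _))// lte_add_pinfty.
by rewrite (le_lt_trans (measureU2 _ _ _))// lte_add_pinfty.
Qed.

Lemma finite_boxI A B A' B' : finite_box A B -> measurable A' -> measurable B' ->
  finite_box (A' `&` A) (B' `&` B).
Proof.
move=> [mA fA mB fB] mA' mB'; split; [exact: measurableI| |exact: measurableI|].
  by rewrite (le_lt_trans _ fA)// le_measure ?inE//; exact: measurableI.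
by rewrite (le_lt_trans _ fB)// le_measure ?inE//; exact: measurableI.
Qed.

(** The sets on the right form a delta-ring containing the boxes. Conversely, for a fixed box, the
    sets whose trace on it lies in the delta-ring form a sigma-algebra containing all measurable
    rectangles. *)
Lemma rect_delta_ringP C : S C <->
  measurable C /\ exists A B, finite_box A B /\ C `<=` A `*` B.
Proof.
split.
- suff : S `<=` [set C | measurable C /\ exists A B, finite_box A B /\ C `<=` A `*` B].
    by apply.
  apply: smallest_sub; last first.
    move=> _ [A [B [mA fA mB fB ->]]]; split; first exact: measurableX.
    by exists A, B; split => //; split.
  split; [split|].
  + split; first exact: measurable0.
    exists set0, set0; split; last exact: sub0set.
    by split; [exact: measurable0|rewrite measure0 ltry|exact: measurable0|rewrite measure0 ltry].
  + move=> C1 C2 [mC1 [A1 [B1 [f1 s1]]]] [mC2 [A2 [B2 [f2 s2]]]]; split.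
      exact: measurableU.
    exists (A1 `|` A2), (B1 `|` B2); split; first exact: finite_boxU.
    move=> x [/s1 [? ?]|/s2[? ?]]; first by split; left.
    by split; right.
  + move=> C1 C2 [mC1 [A1 [B1 [f1 s1]]]] [mC2 _]; split; first exact: measurableD.
    by exists A1, B1; split => //; apply: subset_trans s1; exact: subDsetl.
  + move=> F SF; split; first by apply: bigcapT_measurable => n; have [] := SF n.
    have [_ [A1 [B1 [f1 s1]]]] := SF 0%N.
    by exists A1, B1; split => // x Fx; apply: s1; exact: Fx.
- move=> [mC [A [B [fAB CAB]]]].
  have [[S0 SU SD] SI] := S_delta.
  have Sbox := rect_delta_ring_box fAB.
  rewrite (_ : C = C `&` (A `*` B)); last by apply/esym/setIidPl.
  move: mC; rewrite measurable_prod_measurableType.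
  suff : <<s [set A `*` B | A in measurable & B in measurable] >> `<=`
      [set D : set E | S (D `&` (A `*` B))] by move=> h; exact: h.
  apply: smallest_sub; last first.
    move=> _ [A' mA'] [B' mB'] <- /=; rewrite -setXI.
    apply: rect_delta_ring_box; exact: (finite_boxI fAB mA' mB').
  split.
  + by rewrite /= set0I.
  + move=> D /= SDD; rewrite (_ : _ `&` _ = (A `*` B) `\` (D `&` (A `*` B))).
      exact: SD.
    apply/seteqP; split => x /=.
      by move=> [[_ nD] AB]; split => // -[].
    by move=> [AB nD]; split => //; split => // Dx; apply: nD.
  (* A delta-ring is closed under countable intersections only, so the union is obtained as a
     complement inside the box. *)
  + move=> F SF /=.
    rewrite (_ : _ `&` _ = (A `*` B) `\`
      (\bigcap_n ((A `*` B) `\` (F n `&` (A `*` B))))).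
      by apply: (SD) => //; apply: SI => n; apply: (SD) => //; exact: SF.
    apply/seteqP; split => x /=.
      by move=> [[n _ Fnx] AB]; split => // /(_ n Logic.I)[_]; apply.
    move=> [AB h]; split => //; apply: contrapT => nF; apply: h => n _; split => //.
    by move=> [Fnx _]; apply: nF; exists n.
Qed.

Lemma rect_delta_ring_measurable C : S C -> measurable C.
Proof. by move=> /rect_delta_ringP[]. Qed.

Lemma rect_delta_ring_sub C D : S C -> measurable D -> D `<=` C -> S D.
Proof.
move=> /rect_delta_ringP[mC [A [B [f s]]]] mD DC; apply/rect_delta_ringP; split => //.
by exists A, B; split => //; exact: subset_trans s.
Qed.

Lemma rect_delta_ringI C D : S C -> measurable D -> S (C `&` D).
Proof.
move=> SC mD; apply: (rect_delta_ring_sub SC); last exact: subIsetl.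
by apply: measurableI => //; exact: rect_delta_ring_measurable.
Qed.

Lemma rect_delta_ring0 : S set0. Proof. by have [[]] := S_delta. Qed.

Lemma rect_delta_ringU C D : S C -> S D -> S (C `|` D).
Proof. by have [[_ h _] _] := S_delta; exact: h. Qed.

Lemma rect_delta_ring_bigsetU (I : Type) (s : seq I) (C : I -> set E) :
  (forall i, S (C i)) -> S (\big[setU/set0]_(i <- s) C i).
Proof.
move=> SC; elim/big_ind : _ => //; first exact: rect_delta_ring0.
exact: rect_delta_ringU.
Qed.

End delta_ring_of_boxes.

(** * Characteristic functions as complex numbers *)

Section characteristic_function.
Context (R : realType) (d : measure_display) (T : measurableType d)
  (P : probability T R).

Definition cf (X : T -> R) : R[i] := (Ecos P X +i* Esin P X)%C.

Lemma cf_mulP (X Y : T -> R) :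
  cf_mul P X Y <-> cf (fun w => X w + Y w) = cf X * cf Y.
Proof.
rewrite /cf_mul /cf; split=> [[-> ->]|[-> ->]]; last by split => //; ring.
by apply/eqP; rewrite eq_complex /=; apply/andP; split; apply/eqP; ring.
Qed.

Lemma cf0 : cf (fun=> 0) = 1.
Proof. by rewrite /cf /Ecos /Esin cos0 sin0 !Ex_cst. Qed.

Lemma cf_ae_eq (X Y : T -> R) : measurable_fun setT X -> measurable_fun setT Y ->
  {ae P, forall w, X w = Y w} -> cf X = cf Y.
Proof. by move=> mX mY XY; rewrite /cf (Ecos_ae_eq mX mY)// (Esin_ae_eq mX mY). Qed.

Lemma cf_sum_independent (X : nat -> {RV P >-> R}) (c : nat -> R) n :
  mutually_independent X ->
  cf (fun w => \sum_(k < n) c k * X k w) =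
  \prod_(k < n) cf (fun w => c k * X k w).
Proof.
move=> indX; elim: n => [|n IH].
  by under eq_fun do rewrite big_ord0; rewrite big_ord0 cf0.
rewrite big_ord_recr /= -IH -(cf_mulP _ _).1; last first.
  exact: mutually_independent_cf_mul.
by congr cf; apply/funext => w; rewrite big_ord_recr.
Qed.

Definition cnorm2 (z : R[i]) : R := complex.Re z ^+ 2 + complex.Im z ^+ 2.

Lemma cnorm2M (z w : R[i]) : cnorm2 (z * w) = cnorm2 z * cnorm2 w.
Proof. by case: z => a b; case: w => a' b'; rewrite /cnorm2 /=; ring. Qed.

Lemma cnorm2_prod (I : Type) (s : seq I) (F : I -> R[i]) :
  cnorm2 (\prod_(i <- s) F i) = \prod_(i <- s) cnorm2 (F i).
Proof.
by apply: (big_morph _ cnorm2M); rewrite /cnorm2 /=; ring.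
Qed.

Lemma cmod2E X : cmod2 P X = cnorm2 (cf X). Proof. by []. Qed.

End characteristic_function.

Section finite_family.
Context (U : Type) (I : finType) (A : I -> set U).

(** The axioms on the random measure speak of sequences of sets; a finite family is turned into one
    by padding with empty sets. *)
Definition family_seq (n : nat) : set U :=
  if insub n is Some k then A (enum_val (A := I) k) else set0.

Lemma family_seq_ord (k : 'I_#|I|) : family_seq k = A (enum_val k).
Proof. by rewrite /family_seq valK. Qed.

Lemma family_seq_ge n : (#|I| <= n)%N -> family_seq n = set0.
Proof. by move=> h; rewrite /family_seq insubF// ltnNge h. Qed.

Lemma family_seq_trivIset : trivIset setT A -> trivIset setT family_seq.
Proof.
move=> tA i j _ _; rewrite /family_seq.
case: insubP => [k _ <-|_]; last by rewrite set0I => -[].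
case: insubP => [l _ <-|_]; last by rewrite setI0 => -[].
by move=> /tA => /(_ Logic.I Logic.I)/enum_val_inj ->.
Qed.

Lemma bigcup_family_seq : \bigcup_n family_seq n = \big[setU/set0]_i A i.
Proof.
apply/seteqP; split => x.
  move=> [n _]; rewrite /family_seq; case: insubP => //= k _ _ Ax.
  by rewrite -bigcup_seq; exists (enum_val k) => //=; rewrite mem_index_enum.
rewrite -bigcup_seq => -[i _ Ax]; exists (enum_rank i) => //.
by rewrite family_seq_ord enum_rankK.
Qed.

End finite_family.

(** * Additivity and independence of the random measure *)

Section random_measure.
Context (R : realType) (d d' : measure_display) (T : measurableType d)
  (P : probability T R) (V : measurableType d')
  (m : {sigma_finite_measure set V -> \bar R})
  (W : set (measurableTypeR R * V) -> {RV P >-> R}).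
Hypothesis W_id : id_random_measure m W.
Local Notation E := (measurableTypeR R * V)%type.
Local Notation S := (rect_delta_ring m).

Let W_indep C : (forall n, S (C n)) -> trivIset setT C ->
  mutually_independent (fun n : nat => W (C n)).
Proof. by case: W_id => _ h _; exact: h. Qed.

Lemma W_sigma_additive (C : nat -> set E) : (forall n, S (C n)) ->
  trivIset setT C -> S (\bigcup_n C n) ->
  {ae P, forall w, (\sum_(k < n) W (C k) w) @[n --> \oo] --> W (\bigcup_n C n) w}.
Proof. by case: W_id => _ _; exact. Qed.

(** By countable additivity for the sequence of empty sets, the multiples n W(set0) converge; their
    consecutive differences are W(set0) and tend to 0. *)
Lemma W_set0 : {ae P, forall w, W set0 w = 0}.
Proof.
have S0 : S set0 by exact: rect_delta_ring0.
have h : S (\bigcup_(n : nat) set0) by rewrite bigcup0.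
have t0 : trivIset setT (fun _ : nat => set0 : set E).
  by move=> i j _ _; rewrite set0I => -[].
have := W_sigma_additive (fun=> S0) t0 h.
apply: filterS => w; rewrite bigcup0//.
under eq_fun do rewrite sumr_const card_ord.
move=> Wcvg.
have Wcvg1 : W set0 w *+ n.+1 @[n --> \oo] --> W set0 w.
  by have := Wcvg; rewrite -(cvg_shiftS (fun n => W set0 w *+ n)).
have : W set0 w *+ n.+1 - W set0 w *+ n @[n --> \oo] --> (W set0 w - W set0 w).
  exact: cvgB.
under eq_fun do rewrite mulrSr addrAC subrr add0r.
by rewrite subrr => /cvg_lim <- //; rewrite lim_cst.
Qed.

Lemma W_finite_additive (I : finType) (A : I -> set E) :
  (forall i, S (A i)) -> trivIset setT A ->
  {ae P, forall w, W (\big[setU/set0]_i A i) w = \sum_i W (A i) w}.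
Proof.
move=> SA tA.
have SC n : S (family_seq A n).
  by rewrite /family_seq; case: insubP => //= _; exact: rect_delta_ring0.
have SU : S (\bigcup_n family_seq A n).
  by rewrite bigcup_family_seq; exact: rect_delta_ring_bigsetU.
have := W_sigma_additive SC (family_seq_trivIset tA) SU.
rewrite bigcup_family_seq; apply: filterS2 W_set0 => w W0 /cvg_lim <- //.
apply: lim_near_cst => //; near=> n.
have In : (#|I| <= n)%N by near: n; exact: nbhs_infty_ge.
rewrite -(subnKC In) big_split_ord /= [X in _ + X]big1 ?addr0; last first.
  by move=> k _; rewrite family_seq_ge ?leq_addr// W0.
rewrite (reindex (enum_val (A := I))) /=; last first.
  by exists enum_rank => i _; rewrite ?enum_valK ?enum_rankK.
by apply: eq_bigr => k _; rewrite family_seq_ord.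
Unshelve. all: by end_near.
Qed.

Lemma W_additive2 A B : S A -> S B -> A `&` B = set0 ->
  {ae P, forall w, W (A `|` B) w = W A w + W B w}.
Proof.
move=> SA SB AB.
pose F (b : bool) := if b then A else B.
have SF b : S (F b) by case: b.
have tF : trivIset setT F.
  move=> [] [] _ _ //=; rewrite ?AB; first by case.
  by rewrite setIC AB => -[].
have := W_finite_additive SF tF; apply: filterS => w.
by rewrite !big_bool.
Qed.

Lemma W_additiveD A C : S C -> S A -> A `<=` C ->
  {ae P, forall w, W C w = W A w + W (C `\` A) w}.
Proof.
move=> SC SA AC.
have SD : S (C `\` A).
  apply: (rect_delta_ring_sub SC); last exact: subDsetl.
  by apply: measurableD; [move: SC|move: SA]; exact: rect_delta_ring_measurable.
have := W_additive2 SA SD; rewrite setDIK => /(_ erefl).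
by rewrite setDUK.
Qed.

Lemma cf_W_finite (I : finType) (A : I -> set E) (c : I -> R) :
  (forall i, S (A i)) -> trivIset setT A ->
  cf P (fun w => \sum_i c i * W (A i) w) =
  \prod_i cf P (fun w => c i * W (A i) w).
Proof.
move=> SA tA.
have SC n : S (family_seq A n).
  by rewrite /family_seq; case: insubP => //= _; exact: rect_delta_ring0.
have indC := W_indep SC (family_seq_trivIset tA).
pose c' (n : nat) : R := if insub n is Some k then c (enum_val (A := I) k) else 0.
have c'E (k : 'I_#|I|) : c' k = c (enum_val k) by rewrite /c' valK.
have := cf_sum_independent c' #|I| indC.
under eq_fun do under eq_bigr do rewrite c'E family_seq_ord.
have bij : {on [pred i | true], bijective (enum_val (A := I))}.
  by exists enum_rank => i _; rewrite ?enum_valK ?enum_rankK.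
move=> h; rewrite [RHS](reindex (enum_val (A := I)))//=.
transitivity (cf P (fun w => \sum_(k < #|I|) c (enum_val k) * W (A (enum_val k)) w)).
  by congr cf; apply/funext => w; rewrite (reindex (enum_val (A := I))).
rewrite h; apply: eq_bigr => k _.
by congr cf; apply/funext => w; rewrite c'E family_seq_ord.
Qed.

(** Both families together form one disjoint family indexed by [I + J], whose product of
    characteristic functions splits along the two summands. *)
Lemma cf_W_split (I J : finType) (A : I -> set E) (B : J -> set E)
    (a : I -> R) (b : J -> R) :
  (forall i, S (A i)) -> (forall j, S (B j)) ->
  trivIset setT A -> trivIset setT B -> (forall i j, A i `&` B j = set0) ->
  cf P (fun w => \sum_i a i * W (A i) w + \sum_j b j * W (B j) w) =
  cf P (fun w => \sum_i a i * W (A i) w) * cf P (fun w => \sum_j b j * W (B j) w).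
Proof.
move=> SA SB tA tB AB.
pose C (k : I + J) := match k with inl i => A i | inr j => B j end.
pose c (k : I + J) := match k with inl i => a i | inr j => b j end.
have SC k : S (C k) by case: k.
have tC : trivIset setT C.
  move=> [i|j] [i'|j'] _ _ //=.
  - by move/tA => /(_ Logic.I Logic.I) ->.
  - by rewrite AB => -[].
  - by rewrite setIC AB => -[].
  - by move/tB => /(_ Logic.I Logic.I) ->.
rewrite !cf_W_finite//.
have := cf_W_finite c SC tC; rewrite big_sumType /= => <-.
by congr cf; apply/funext => w; rewrite big_sumType.
Qed.

End random_measure.

(** * The real part of the Levy-Khintchine exponent *)

Lemma one_sub_cos_ge0 (R : realType) (y : R) : 0 <= 1 - cos y.
Proof. by rewrite subr_ge0 cos_le1. Qed.

Lemma one_sub_cos_le (R : realType) (y : R) : 1 - cos y <= y ^+ 2 / 2.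
Proof.
have -> : 1 - cos y = 2 * sin (y / 2) ^+ 2.
  rewrite {1}(_ : y = y / 2 + y / 2) ?cosD; last by field.
  by have := cos2Dsin2 (y / 2); rewrite !expr2; lra.
have : sin (y / 2) ^+ 2 <= (y / 2) ^+ 2.
  rewrite -real_normK ?num_real// -[leRHS]real_normK ?num_real//.
  rewrite ler_pXn2r ?nnegrE//.
  by have := norm_sinB_le (y / 2) 0; rewrite sin0 !subr0.
by move=> h; lra.
Qed.

(** The difference of the two sides is 2 (1 - cos y)^2. This is the source of the doubling
    inequality for the exponent. *)
Lemma one_sub_cos_double_le (R : realType) (y : R) :
  1 - cos (2 * y) <= 4 * (1 - cos y).
Proof.
rewrite mulr_natl mulr2n cosD.
have := cos2Dsin2 y; have := cos_le1 y; have := sqr_ge0 (1 - cos y).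
rewrite sqrrB; nra.
Qed.

Section real_exponent.
Context (R : realType) (s2 : R)
  (nu : {measure set (measurableTypeR R) -> \bar R}).
Hypothesis s2_ge0 : 0 <= s2.
Hypothesis nu_levy : levy_measure nu.

(* Minus the real part of the Levy-Khintchine exponent. *)
Definition gexp (u : R) : R :=
  u ^+ 2 * s2 / 2 + Rintegral nu setT (fun x : R => 1 - cos (u * x)).

Let mcos (u : R) : measurable_fun setT (fun x : measurableTypeR R => 1 - cos (u * x)).
Proof. by apply: measurable_funB => //; apply: measurable_cos; exact: measurable_funM. Qed.

Let mmin : measurable_fun setT (fun x : measurableTypeR R => Num.min 1 (x ^+ 2)).
Proof. by apply: measurable_minr => //; exact: measurable_funX. Qed.

Let min_ge0 (x : R) : 0 <= Num.min 1 (x ^+ 2).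
Proof. by rewrite le_min ler01 sqr_ge0. Qed.

Let imin : nu.-integrable setT (EFin \o (fun x : R => Num.min 1 (x ^+ 2))).
Proof.
apply/integrableP; split; first exact/measurable_EFinP.
rewrite (_ : (fun x => _) = (fun x : R => (Num.min 1 (x ^+ 2))%:E)).
  by case: nu_levy.
by apply/funext => x /=; rewrite ger0_norm.
Qed.

(** The 2 serves the large jumps, where 1 - cos is at most 2, and K^2 the small ones, where the
    quadratic bound holds. The majorant is uniform for [u] in [-K, K], as the continuity of [gexp]
    requires. *)
Let bound (K u x : R) : `|u| <= K ->
  `|1 - cos (u * x)| <= (2 + K ^+ 2) * Num.min 1 (x ^+ 2).
Proof.
move=> uK; rewrite ger0_norm ?one_sub_cos_ge0//.
have K0 : 0 <= K by exact: le_trans uK.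
have u2 : u ^+ 2 <= K ^+ 2.
  by rewrite -[leLHS]real_normK ?num_real// ler_pXn2r ?nnegrE.
rewrite minEle; case: ifPn => x1.
  by have := cos_geN1 (u * x); have := sqr_ge0 K; lra.
have := one_sub_cos_le (u * x); rewrite exprMn.
have : u ^+ 2 * x ^+ 2 <= K ^+ 2 * x ^+ 2 by rewrite ler_wpM2r// sqr_ge0.
have : 0 <= K ^+ 2 * x ^+ 2 by rewrite mulr_ge0 ?sqr_ge0.
have := sqr_ge0 x; rewrite mulrDl.
by lra.
Qed.

Let ibound K : nu.-integrable setT
  (EFin \o (fun x : R => (2 + K ^+ 2) * Num.min 1 (x ^+ 2))).
Proof. exact: (integrableZl measurableT (2 + K ^+ 2) imin). Qed.

Lemma integrable_one_sub_cos (u : R) :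
  nu.-integrable setT (EFin \o (fun x : R => 1 - cos (u * x))).
Proof.
apply: (le_integrable measurableT _ _ (ibound `|u|)).
  exact/measurable_EFinP.
move=> x _ /=; rewrite lee_fin (le_trans (bound x (lexx _)))//.
exact: ler_norm.
Qed.

Lemma gexp_ge0 u : 0 <= gexp u.
Proof.
rewrite addr_ge0//; first by rewrite divr_ge0// mulr_ge0// sqr_ge0.
by apply: Rintegral_ge0 => x _; exact: one_sub_cos_ge0.
Qed.

Lemma gexp0 : gexp 0 = 0.
Proof.
rewrite /gexp expr0n/= !mul0r add0r.
under eq_Rintegral do rewrite mul0r cos0 subrr.
by rewrite /Rintegral integral0.
Qed.

Lemma gexp_double u : gexp (2 * u) <= 4 * gexp u.
Proof.
rewrite /gexp mulrDr lerD//; first by rewrite exprMn; lra.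
rewrite -RintegralZl//; last exact: integrable_one_sub_cos.
apply: le_Rintegral => //.
- exact: integrable_one_sub_cos.
- exact: (integrableZl measurableT 4 (integrable_one_sub_cos u)).
- by move=> x _; rewrite -mulrA; exact: one_sub_cos_double_le.
Qed.

Lemma gexp_cvg (u_ : nat -> R) (u : R) :
  u_ n @[n --> \oo] --> u -> gexp (u_ n) @[n --> \oo] --> gexp u.
Proof.
move=> uu; apply: cvgD.
  apply: cvgMr_tmp; apply: cvgMr_tmp; apply: (@cvgM _ _ _ _ u_ u_) => //.
have [K [_ uK]] := cvg_seq_bounded (cvgP _ uu).
have uKn n : `|u_ n| <= K + 1 by apply: uK; rewrite // ltrDl.
have cE : {ae nu, forall x : measurableTypeR R, setT x ->
    (EFin \o (fun y : R => 1 - cos (u_ n * y))) x @[n --> \oo] -->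
    (EFin \o (fun y : R => 1 - cos (u * y))) x}.
  apply: aeW => x _; apply: cvg_EFin; first exact: nearW.
  apply: cvgB; first exact: cvg_cst.
  apply: (@cvg_comp _ _ _ (fun n => u_ n * x) cos _ (nbhs (u * x))).
    exact: cvgMr_tmp.
  exact: continuous_cos.
have bM : {ae nu, forall (x : measurableTypeR R) n, setT x ->
    (`|(EFin \o (fun y : R => 1 - cos (u_ n * y))%R) x| <=
     (EFin \o (fun x : R => (2 + (K + 1) ^+ 2) * Num.min 1 (x ^+ 2))%R) x)%E}.
  by apply: aeW => x n _; rewrite /= lee_fin bound.
have [||ig _ cg] := dominated_convergence measurableT _ _ cE (ibound _) bM.
- by move=> n; exact/measurable_EFinP.
- exact/measurable_EFinP.
by apply: fine_cvg; rewrite fineK; [exact: cg|exact: integrable_fin_num].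
Qed.

(** The drift and the compensator are purely imaginary, so only the Gaussian part and 1 - cos
    survive. *)
Lemma Re_levy_exponent (theta u : R) :
  complex.Re (levy_exponent theta s2 nu u) = - gexp u.
Proof.
rewrite /levy_exponent /gexp /cintegral /= !(mul0r, mul1r, mulr0, add0r, subr0, oppr0).
rewrite opprD; congr (_ + _).
rewrite -[RHS]mulN1r -RintegralZl//; last exact: integrable_one_sub_cos.
apply: eq_Rintegral => x _; rewrite !(mul0r, mul1r, mulr0, add0r, subr0, oppr0, addr0).
by rewrite expR0 mul1r mulN1r opprB.
Qed.

End real_exponent.

Section almost_sure_limits.
Context (R : realType) (d : measure_display) (T : measurableType d)
  (P : probability T R).
Variables (Xn : nat -> T -> R) (X : T -> R).
Hypothesis mXn : forall n, measurable_fun setT (Xn n).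
Hypothesis mX : measurable_fun setT X.
Hypothesis XnX : {ae P, forall w, Xn n w @[n --> \oo] --> X w}.

Lemma cvg_Ecos_ae : Ecos P (Xn n) @[n --> \oo] --> Ecos P X.
Proof.
apply: (@Ex_cvg _ _ _ P (fun n w => cos (Xn n w)) _ 1).
- by move=> n; exact: measurable_cos.
- exact: measurable_cos.
- by move=> n w; exact: cos_max.
- by apply: filterS XnX => w h; apply: (cvg_comp _ _ h); exact: continuous_cos.
Qed.

Lemma cvg_Esin_ae : Esin P (Xn n) @[n --> \oo] --> Esin P X.
Proof.
apply: (@Ex_cvg _ _ _ P (fun n w => sin (Xn n w)) _ 1).
- by move=> n; exact: measurable_sin.
- exact: measurable_sin.
- by move=> n w; exact: sin_max.
- by apply: filterS XnX => w h; apply: (cvg_comp _ _ h); exact: continuous_sin.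
Qed.

Lemma cvg_cmod2_ae : cmod2 P (Xn n) @[n --> \oo] --> cmod2 P X.
Proof.
have c := cvg_Ecos_ae; have s := cvg_Esin_ae.
by apply: cvgD; apply: (@cvgM _ _ _ _ (fun n => _) (fun n => _)).
Qed.

End almost_sure_limits.

Lemma cnorm2_cexp (R : realType) (z : R[i]) :
  cnorm2 (cexp z) = expR (2 * complex.Re z).
Proof.
rewrite /cnorm2 /cexp /= !exprMn -mulrDr cos2Dsin2 mulr1 mulr_natl mulr2n expRD.
by rewrite expr2.
Qed.

(** * The modulus formula for sets of the delta-ring *)

Section levy_random_measure.
Context (R : realType) (d d' : measure_display) (T : measurableType d)
  (P : probability T R) (V : measurableType d')
  (m : {sigma_finite_measure set V -> \bar R})
  (W : set (measurableTypeR R * V) -> {RV P >-> R})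
  (theta sigma2 : V -> R) (rho : R.-ker V ~> measurableTypeR R).
Hypothesis msigma2 : measurable_fun setT sigma2.
Hypothesis sigma2_ge0 : forall v, 0 <= sigma2 v.
Hypothesis rho_levy : forall v, levy_measure (rho v).
Hypothesis W_id : id_random_measure m W.
Hypothesis W_char : has_characteristics m W theta sigma2 rho.
Local Notation E := (measurableTypeR R * V)%type.
Local Notation S := (rect_delta_ring m).
Local Notation mu := (lebesgue_measure \x m)%E.

Definition vexp (u : R) (v : V) : R := gexp (sigma2 v) (rho v) u.

Lemma vexp_ge0 u v : 0 <= vexp u v.
Proof. exact: gexp_ge0. Qed.

Lemma vexp0 v : vexp 0 v = 0.
Proof. exact: gexp0. Qed.

Lemma vexp_norm u v : vexp `|u| v = vexp u v.
Proof.
rewrite /vexp /gexp real_normK ?num_real//; congr (_ + _).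
apply: eq_Rintegral => x _; case: (ger0P u) => // _.
by rewrite mulNr cosN.
Qed.

Lemma measurable_vexp u : measurable_fun setT (vexp u).
Proof.
apply: measurable_funD.
  by apply: measurable_funM => //; exact: measurable_funM.
apply: (measurableT_comp (fine_measurable measurableT)).
apply: (@measurable_fun_integral_kernel _ _ V (measurableTypeR R) R rho).
- by move=> U mU; exact: measurable_kernel.
- by move=> x; rewrite lee_fin; exact: one_sub_cos_ge0.
- apply/measurable_EFinP; apply: measurable_funB => //; apply: measurable_cos.
  exact: measurable_funM.
Qed.

Lemma measurable_vexp2 u : measurable_fun setT (fun x : E => vexp u x.2).
Proof. by apply: measurableT_comp => //; exact: measurable_vexp. Qed.

(** For [C] in the delta-ring, this is minus one half of the logarithm of the squared modulus of the
    characteristic function of [W C] at [u]. *)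
Definition Kmass (u : R) (C : set E) : \bar R := (\int[mu]_(x in C) (vexp u x.2)%:E)%E.

Lemma Kmass_ge0 u C : (0 <= Kmass u C)%E.
Proof. by apply: integral_ge0 => x _; rewrite lee_fin vexp_ge0. Qed.

Lemma Kmass_box u A B : finite_box m A B ->
  (Kmass u (A `*` B) = lebesgue_measure A * \int[m]_(v in B) (vexp u v)%:E)%E.
Proof.
move=> [mA fA mB fB]; rewrite /Kmass integral_mkcond.
rewrite fubini_tonelli1; last 2 first.
- apply/(measurable_restrictT _ (measurableX mA mB)).
  by apply: measurable_funTS; apply/measurable_EFinP; exact: measurable_vexp2.
- by move=> x; apply: erestrict_ge0 => y _; rewrite lee_fin vexp_ge0.
rewrite /fubini_F /=.
transitivity (\int[lebesgue_measure]_x ((\1_A x)%:E * \int[m]_(v in B) (vexp u v)%:E))%E.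
  apply: eq_integral => x _; rewrite indicE; case: (boolP (x \in A)) => xA.
    rewrite mul1e [RHS]integral_mkcond; apply: eq_integral => v _.
    rewrite /patch; congr (if _ then _ else _).
    by apply/idP/idP; rewrite !inE /=; [case|split => //; exact/set_mem].
  rewrite mul0e; apply: integral0_eq => v _; rewrite /patch ifF//.
  by apply/negP; rewrite inE => -[/= /mem_set]; rewrite (negbTE xA).
rewrite ge0_integralZr//.
- by rewrite integral_indic// setIT.
- by apply/measurable_EFinP; exact: measurable_indic.
- by apply: integral_ge0 => v _; rewrite lee_fin vexp_ge0.
Qed.

(** The squared modulus of exp z is exp(2 Re z), whence the factor 2. Finiteness of the mass comes
    from the integrability of the exponent that [has_characteristics] includes. *)
Let rect_char u A B : finite_box m A B ->
  (Kmass u (A `*` B) < +oo)%E /\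
  cmod2 P (fun w => u * W (A `*` B) w) = expR (- 2 * fine (Kmass u (A `*` B))).
Proof.
move=> fAB; have [mA fA mB fB] := fAB.
have [[iRe _] ch] := W_char u mA fA mB fB.
have ReE v : complex.Re (levy_exponent (theta v) (sigma2 v) (rho v) u) = - vexp u v.
  exact: Re_levy_exponent.
have ik : m.-integrable B (EFin \o vexp u).
  apply: eq_integrable (integrableN iRe) => //.
  by move=> v _; rewrite /comp ReE -EFinN opprK.
have Kfin := integrable_fin_num mB ik.
split.
  rewrite Kmass_box// lte_mul_pinfty//.
  - by rewrite ge0_fin_numE.
  - by rewrite -ge0_fin_numE// integral_ge0// => v _; rewrite lee_fin vexp_ge0.
rewrite Kmass_box// fineM//; last by rewrite ge0_fin_numE.
have -> : cmod2 P (fun w => u * W (A `*` B) w) =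
    cnorm2 (char_fun P (W (A `*` B)) u).
  rewrite /cmod2 /cnorm2 /char_fun /cintegral /= /Ecos /Esin /Ex.
  congr (_ ^+ 2 + _ ^+ 2); apply: eq_Rintegral => w _.
  - by rewrite !(mul0r, mul1r, mulr0, add0r, subr0, oppr0, addr0) expR0 mul1r.
  - by rewrite !(mul0r, mul1r, mulr0, add0r, subr0, oppr0, addr0) expR0 mul1r.
have ReC (x : R) (z : R[i]) : complex.Re (x%:C%C * z) = x * complex.Re z.
  by case: z => a b /=; rewrite mul0r subr0.
rewrite ch cnorm2_cexp ReC mulNr -mulrN.
congr expR; congr (_ * _); rewrite -mulrN; congr (_ * _).
transitivity (Rintegral m B (fun v => - vexp u v)).
  by congr Rintegral; apply/funext => v; exact: ReE.
transitivity (Rintegral m B (fun v => -1 * vexp u v)).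
  by congr Rintegral; apply/funext => v; rewrite mulN1r.
by rewrite RintegralZl// mulN1r.
Qed.

Lemma Kmass_lty u C : S C -> (Kmass u C < +oo)%E.
Proof.
move=> /rect_delta_ringP[mC [A [B [fAB CAB]]]].
have [Kfin _] := rect_char u fAB; apply: le_lt_trans Kfin.
have [mA _ mB _] := fAB.
apply: ge0_subset_integral => //; first exact: measurableX.
  by apply: measurable_funTS; apply/measurable_EFinP; exact: measurable_vexp2.
by move=> x _; rewrite lee_fin vexp_ge0.
Qed.

Lemma Kmass_fin_num u C : S C -> Kmass u C \is a fin_num.
Proof. by move=> SC; rewrite ge0_fin_numE ?Kmass_ge0// Kmass_lty. Qed.

Lemma KmassU u A B : S A -> S B -> A `&` B = set0 ->
  fine (Kmass u (A `|` B)) = fine (Kmass u A) + fine (Kmass u B).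
Proof.
move=> SA SB AB; rewrite -fineD ?Kmass_fin_num//; congr fine.
apply: ge0_integral_setU; [move: SA|move: SB| | |].
- exact: rect_delta_ring_measurable.
- exact: rect_delta_ring_measurable.
- by apply: measurable_funTS; apply/measurable_EFinP; exact: measurable_vexp2.
- by move=> x _; rewrite lee_fin vexp_ge0.
- exact/disj_set2P.
Qed.

(** The characteristics are prescribed on boxes only. Inside one fixed box, the measurable sets
    whose trace satisfies the formula form a Dynkin class containing the rectangles. *)
Lemma cmod2_W u C : S C ->
  cmod2 P (fun w => u * W C w) = expR (- 2 * fine (Kmass u C)).
Proof.
move=> SC; have [mC [A [B [fAB CAB]]]] := (rect_delta_ringP m C).1 SC.
have [mA _ mB _] := fAB.
have mbox : measurable (A `*` B) by exact: measurableX.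
have Sbox : S (A `*` B) by exact: rect_delta_ring_box.
have SI D : measurable D -> S (D `&` (A `*` B)).
  by move=> mD; rewrite setIC; exact: rect_delta_ringI.
have mW C' : measurable_fun setT (fun w => u * W C' w) by exact: measurable_funM.
pose Q (D : set E) := cmod2 P (fun w => u * W (D `&` (A `*` B)) w) =
  expR (- 2 * fine (Kmass u (D `&` (A `*` B)))).
suff : Q C by rewrite /Q (_ : C `&` (A `*` B) = C)//; exact/setIidPl.
have := mC; rewrite measurable_prod_measurableType; move: C {SC mC CAB}.
apply: dynkin_induction.
- exact: measurable_prod_measurableType.
- move=> _ _ [A1 mA1 [B1 mB1 <-]] [A2 mA2 [B2 mB2 <-]].
  exists (A1 `&` A2); first exact: measurableI.
  by exists (B1 `&` B2); [exact: measurableI|rewrite setXI].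
- by rewrite /Q setTI; exact: (rect_char u fAB).2.
- move=> _ [A1 mA1 [B1 mB1 <-]]; rewrite /Q -setXI.
  exact: (rect_char u (finite_boxI fAB mA1 mB1)).2.
- move=> D mD QD.
  have DCE : ~` D `&` (A `*` B) = (A `*` B) `\` (D `&` (A `*` B)).
    apply/seteqP; split => x /=; first by move=> [nD AB]; split => // -[].
    by move=> [AB nD]; split => // Dx; apply: nD.
  have SDC : S (~` D `&` (A `*` B)) by apply: SI; exact: measurableC.
  have dsj : (D `&` (A `*` B)) `&` (~` D `&` (A `*` B)) = set0.
    by rewrite setIACA setICr set0I.
  have DU : (D `&` (A `*` B)) `|` (~` D `&` (A `*` B)) = A `*` B.
    by rewrite -setIUl setUv setTI.
  pose F (b : bool) := if b then D `&` (A `*` B) else ~` D `&` (A `*` B).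
  have SF b : S (F b) by case: b; [exact: SI|].
  have tF : trivIset setT F.
    move=> [] [] _ _ //=; rewrite ?dsj; first by case.
    by rewrite setIC dsj => -[].
  (* The two parts of the box are independent, so the squared moduli multiply while the masses add;
     the factor already known is positive and cancels. *)
  have mul := cf_W_finite W_id (fun=> u) SF tF.
  have := (rect_char u fAB).2.
  rewrite -{2}DU KmassU//; last exact: SI.
  have -> : cmod2 P (fun w => u * W (A `*` B) w) =
      cmod2 P (fun w => \sum_b u * W (F b) w).
    apply: cmod2_ae_eq => //; first by apply: measurable_sum.
    have := W_additive2 W_id (SI _ mD) SDC dsj; apply: filterS => w.
    by rewrite DU big_bool /= -mulrDr => ->.
  rewrite cmod2E mul big_bool /= cnorm2M -!cmod2E.
  rewrite /Q in QD *; rewrite QD (mulrDr (- 2)) expRD.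
  by move/mulfI; apply; rewrite gt_eqF// expR_gt0.
- move=> F mF tF QF.
  pose G n := F n `&` (A `*` B).
  have SG n : S (G n) by exact: SI.
  have tG : trivIset setT G.
    by move=> i j _ _ [x [[Fi _] [Fj _]]]; apply: tF => //; exists x.
  have UG : \bigcup_n F n `&` (A `*` B) = \bigcup_n G n by rewrite setI_bigcupl.
  have SU : S (\bigcup_n G n) by rewrite -UG; apply: SI; exact: bigcup_measurable.
  have indG : mutually_independent (fun n => W (G n)) by case: W_id => _ h _; exact: h.
  rewrite /Q UG.
  (* Countable additivity gives almost sure convergence of the partial sums, which is enough for
     characteristic functions; on the other side the masses add up as a series. *)
  have c1 : cmod2 P (fun w => \sum_(k < n) u * W (G k) w) @[n --> \oo] -->
      cmod2 P (fun w => u * W (\bigcup_n G n) w).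
    apply: cvg_cmod2_ae => //; first by move=> n; exact: measurable_sum.
    have := W_sigma_additive W_id SG tG SU; apply: filterS => w h.
    by under eq_fun do rewrite -mulr_sumr; exact: cvgMl_tmp.
  have c3 : \sum_(k < n) fine (Kmass u (G k)) @[n --> \oo] -->
      fine (Kmass u (\bigcup_n G n)).
    have fE n : \sum_(k < n) fine (Kmass u (G k)) =
        fine (\sum_(0 <= k < n) Kmass u (G k))%E.
      by rewrite big_mkord sum_fine// => k _; exact: Kmass_fin_num.
    under eq_fun do rewrite fE.
    apply: fine_cvg; rewrite fineK ?Kmass_fin_num//.
    rewrite [X in _ --> X](_ : _ = \sum_(i <oo) Kmass u (G i))%E; last first.
      rewrite /Kmass ge0_integral_bigcup//.
      - by move=> n; move: (SG n); exact: rect_delta_ring_measurable.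
      - by apply: measurable_funTS; apply/measurable_EFinP; exact: measurable_vexp2.
      - by move=> x _; rewrite lee_fin vexp_ge0.
    by apply: is_cvg_nneseries => n _ _; exact: Kmass_ge0.
  have c2 : expR (- 2 * \sum_(k < n) fine (Kmass u (G k))) @[n --> \oo] -->
      expR (- 2 * fine (Kmass u (\bigcup_n G n))).
    apply: (@cvg_comp _ _ _ (fun n => - 2 * \sum_(k < n) fine (Kmass u (G k))) expR);
      last exact: continuous_expR.
    exact: cvgMl_tmp.
  have e n : cmod2 P (fun w => \sum_(k < n) u * W (G k) w) =
      expR (- 2 * \sum_(k < n) fine (Kmass u (G k))).
    rewrite cmod2E (cf_sum_independent (fun=> u) n indG) cnorm2_prod mulr_sumr expR_sum.
    by apply: eq_bigr => k _; rewrite -cmod2E; exact: QF.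
  rewrite (eq_cvg _ _ e) in c1.
  exact: cvg_unique c1 c2.
Qed.

End levy_random_measure.

(** * Elementary integrands and their limits *)

Section elementary_integrands.
Context (R : realType) (d d' : measure_display) (T : measurableType d)
  (P : probability T R) (V : measurableType d')
  (m : {sigma_finite_measure set V -> \bar R})
  (W : set (measurableTypeR R * V) -> {RV P >-> R}).
Local Notation E := (measurableTypeR R * V)%type.
Local Notation S := (rect_delta_ring m).
Local Notation mu := (lebesgue_measure \x m)%E.

(* Unlike [simple_fun], the sets need not be disjoint: linear combinations are
   then concatenations. *)
Record elem := Elem {
  el_idx : finType;
  el_coef : el_idx -> R;
  el_set : el_idx -> set E;
  el_setP : forall i, S (el_set i) }.

Definition el_fun (e : elem) (x : E) : R :=
  \sum_i el_coef (e := e) i * \1_(el_set (e := e) i) x.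

Definition el_int (e : elem) (w : T) : R :=
  \sum_i el_coef (e := e) i * W (el_set (e := e) i) w.

Lemma measurable_el_int e : measurable_fun setT (el_int e).
Proof. by apply: measurable_sum => i; exact: measurable_funM. Qed.

Definition el_zero : elem :=
  @Elem void (fun=> 0) (fun=> set0) (fun i => match i with end).

Definition el_scale (a : R) (e : elem) : elem :=
  @Elem (el_idx e) (fun i => a * el_coef (e := e) i) (el_set (e := e))
    (@el_setP e).

Definition el_add (e f : elem) : elem :=
  @Elem (el_idx e + el_idx f)%type
    (fun k => match k with inl i => el_coef i | inr j => el_coef j end)
    (fun k => match k with inl i => el_set i | inr j => el_set j end)
    (fun k => match k with inl i => el_setP i | inr j => el_setP j end).

Definition el_restrict (D : set E) (mD : measurable D) (e : elem) : elem :=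
  @Elem (el_idx e) (el_coef (e := e)) (fun i => el_set (e := e) i `&` D)
    (fun i => rect_delta_ringI (el_setP i) mD).

Lemma el_fun_zero x : el_fun el_zero x = 0.
Proof. by rewrite /el_fun big_pred0. Qed.

Lemma el_int_zero w : el_int el_zero w = 0.
Proof. by rewrite /el_int big_pred0. Qed.

Lemma el_fun_scale a e x : el_fun (el_scale a e) x = a * el_fun e x.
Proof. by rewrite /el_fun mulr_sumr; apply: eq_bigr => i _; rewrite mulrA. Qed.

Lemma el_int_scale a e w : el_int (el_scale a e) w = a * el_int e w.
Proof. by rewrite /el_int mulr_sumr; apply: eq_bigr => i _; rewrite mulrA. Qed.

Lemma el_fun_add e f x : el_fun (el_add e f) x = el_fun e x + el_fun f x.
Proof. by rewrite /el_fun big_sumType. Qed.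

Lemma el_int_add e f w : el_int (el_add e f) w = el_int e w + el_int f w.
Proof. by rewrite /el_int big_sumType. Qed.

Lemma el_fun_restrict D (mD : measurable D) e x :
  el_fun (el_restrict mD e) x = el_fun e x * \1_D x.
Proof.
rewrite /el_fun mulr_suml; apply: eq_bigr => i _.
by rewrite /= indicI mulrA.
Qed.

Hypothesis W_id : id_random_measure m W.

Lemma el_int_restrict D (mD : measurable D) (mDC : measurable (~` D)) e :
  {ae P, forall w, el_int e w =
    el_int (el_restrict mD e) w + el_int (el_restrict mDC e) w}.
Proof.
have h i : {ae P, forall w, W (el_set (e := e) i) w =
    W (el_set (e := e) i `&` D) w + W (el_set (e := e) i `&` ~` D) w}.
  have := @W_additiveD _ _ _ _ _ _ _ _ W_id (el_set i `&` D) (el_set i)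
    (el_setP i) (rect_delta_ringI (el_setP i) mD) (@subIsetl _ _ _).
  by rewrite setDE setCI setIUr setICr set0U.
have : {ae P, forall w, forall i, W (el_set (e := e) i) w =
    W (el_set (e := e) i `&` D) w + W (el_set (e := e) i `&` ~` D) w}.
  exact: filter_forall.
apply: filterS => w hw; rewrite /el_int -big_split /=.
by apply: eq_bigr => i _; rewrite hw mulrDr.
Qed.

Section atoms.
Variable e : elem.
Local Notation I := (el_idx e).
Local Notation C := (el_set (e := e)).
Local Notation c := (el_coef (e := e)).

Definition el_support : set E := \big[setU/set0]_i C i.

Lemma el_supportP x : el_support x <-> exists i, C i x.
Proof.
rewrite /el_support -bigcup_seq; split=> [[i _ Cx]|[i Cx]]; first by exists i.
by exists i => //=; rewrite mem_index_enum.
Qed.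

(** The atoms of the algebra generated by the sets of [e]: the points that lie in [C i] exactly for
    [i] in [J]. The intersection with the support matters for empty [J], whose atom would otherwise
    be the complement of the support, which need not lie in the delta-ring. *)
Definition el_atom (J : {set I}) : set E :=
  el_support `&` \bigcap_(i in [set: I]) (if i \in J then C i else ~` C i).

Lemma el_atomP J x : el_atom J x <->
  el_support x /\ forall i, i \in J <-> C i x.
Proof.
split=> [[sx h]|[sx h]]; split => // i.
  have := h i Logic.I; case: ifP => iJ; first by split.
  by move=> nC; split.
by move=> _; case: ifPn => iJ; [exact/h|move=> /h iJ'; rewrite iJ' in iJ].
Qed.

Lemma el_atom_S J : S (el_atom J).
Proof.
have SS : S el_support by apply: rect_delta_ring_bigsetU => i; exact: el_setP.
apply: (rect_delta_ringI SS); apply: fin_bigcap_measurable => // i _.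
case: ifP => _; first exact: rect_delta_ring_measurable (el_setP i).
by apply: measurableC; exact: rect_delta_ring_measurable (el_setP i).
Qed.

Lemma el_atom_trivIset : trivIset setT el_atom.
Proof.
move=> J K _ _ [x [/el_atomP[_ hJ] /el_atomP[_ hK]]]; apply/setP => i.
by apply/idP/idP => [/hJ/hK|/hK/hJ].
Qed.

Lemma el_set_atoms i : C i = \big[setU/set0]_(J : {set I})
  (if i \in J then el_atom J else set0).
Proof.
apply/seteqP; split => x.
  move=> Cx; rewrite -bigcup_seq.
  exists [set j | `[< C j x >]]%SET; first by rewrite /= mem_index_enum.
  have iJ : i \in [set j | `[< C j x >]]%SET by rewrite inE; exact/asboolP.
  rewrite /= iJ; apply/el_atomP; split; first by apply/el_supportP; exists i.
  by move=> j; rewrite inE; split => /asboolP.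
rewrite -bigcup_seq => -[J _ /=]; case: ifP => // iJ /el_atomP[_ h].
exact/h.
Qed.

Definition el_atoms : elem :=
  @Elem {set I} (fun J => \sum_(i in J) c i) el_atom el_atom_S.

Lemma el_fun_atom J x : el_atom J x -> el_fun e x = \sum_(i in J) c i.
Proof.
move=> /el_atomP[_ h]; rewrite /el_fun [RHS]big_mkcond; apply: eq_bigr => i _.
rewrite indicE; case: ifPn => iJ; first by rewrite mem_set ?mulr1//; exact/h.
by rewrite memNset ?mulr0// => /h; exact/negP.
Qed.

Lemma el_fun_notin x : ~ el_support x -> el_fun e x = 0.
Proof.
move=> nx; rewrite /el_fun big1// => i _; rewrite indicE memNset ?mulr0//.
by move=> Cx; apply: nx; apply/el_supportP; exists i.
Qed.

Lemma el_support_atom x : el_support x -> exists J, el_atom J x.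
Proof.
move=> sx; exists [set j | `[< C j x >]]%SET; apply/el_atomP; split => // i.
by rewrite inE; split => /asboolP.
Qed.

Lemma el_int_atoms : {ae P, forall w, el_int e w = el_int el_atoms w}.
Proof.
have h i : {ae P, forall w, W (C i) w = \sum_(J : {set I} | i \in J) W (el_atom J) w}.
  pose A (J : {set I}) := if i \in J then el_atom J else set0.
  have SA J : S (A J).
    by rewrite /A; case: ifP => _; [exact: el_atom_S|exact: rect_delta_ring0].
  have tA : trivIset setT A.
    move=> J K _ _; rewrite /A; case: ifP => _; last by rewrite set0I => -[].
    by case: ifP => _; [exact: el_atom_trivIset|rewrite setI0 => -[]].
  have := W_finite_additive W_id SA tA; rewrite -el_set_atoms.
  apply: filterS2 (W_set0 W_id) => w W0 ->; rewrite [RHS]big_mkcond.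
  by apply: eq_bigr => J _; rewrite /A; case: ifP.
have : {ae P, forall w, forall i,
    W (C i) w = \sum_(J : {set I} | i \in J) W (el_atom J) w}.
  exact: filter_forall.
apply: filterS => w hw; rewrite /el_int /=.
under eq_bigr do rewrite hw mulr_sumr.
rewrite (exchange_big_dep predT) //=; apply: eq_bigr => J _.
by rewrite mulr_suml.
Qed.

End atoms.

(** Passing to atoms makes the sets of each integrand disjoint, and atoms stay on the same side of
    [D] because each lies in the support. *)
Lemma cf_el_split (D : set E) (e f : elem) :
  (forall i, el_set (e := e) i `<=` D) ->
  (forall j, el_set (e := f) j `<=` ~` D) ->
  cf P (fun w => el_int e w + el_int f w) = cf P (el_int e) * cf P (el_int f).
Proof.
move=> eD fD.
have sub (g : elem) (B : set E) : (forall i, el_set (e := g) i `<=` B) ->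
    forall J, el_atom (e := g) J `<=` B.
  by move=> gB J x /el_atomP[/el_supportP[i Cx] _]; exact: gB Cx.
have mi := measurable_el_int.
rewrite (cf_ae_eq (mi e) (mi (el_atoms e)) (el_int_atoms e)).
rewrite (cf_ae_eq (mi f) (mi (el_atoms f)) (el_int_atoms f)).
transitivity (cf P (fun w => el_int (el_atoms e) w + el_int (el_atoms f) w)).
  apply: cf_ae_eq; [exact: measurable_funD|exact: measurable_funD|].
  by apply: filterS2 (el_int_atoms e) (el_int_atoms f) => w -> ->.
apply: (cf_W_split W_id).
- exact: el_atom_S.
- exact: el_atom_S.
- exact: el_atom_trivIset.
- exact: el_atom_trivIset.
- move=> J K; apply/seteqP; split => // x [Jx Kx].
  exact: (sub _ _ fD K x Kx) (sub _ _ eD J x Jx).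
Qed.

Context (theta sigma2 : V -> R) (rho : R.-ker V ~> measurableTypeR R).
Hypothesis msigma2 : measurable_fun setT sigma2.
Hypothesis sigma2_ge0 : forall v, 0 <= sigma2 v.
Hypothesis rho_levy : forall v, levy_measure (rho v).
Hypothesis W_char : has_characteristics m W theta sigma2 rho.
Local Notation vexp := (vexp sigma2 rho).

(** The exponent is not linear, but the atoms are disjoint and the exponent vanishes at 0, so at
    each point at most one term remains. *)
Lemma vexp_el_fun e x : vexp (el_fun e x) x.2 =
  \sum_(J : {set el_idx e})
    vexp (\sum_(i in J) el_coef (e := e) i) x.2 * \1_(el_atom J) x.
Proof.
have [sx|nsx] := pselect (el_support e x).
  have [J Jx] := el_support_atom sx.
  rewrite (bigD1 J)//= indicE mem_set// mulr1 -(el_fun_atom Jx).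
  rewrite big1 ?addr0// => K KJ; rewrite indicE memNset ?mulr0// => Kx.
  move/eqP: KJ; apply; apply: (@el_atom_trivIset e) => //.
  by exists x; split.
rewrite el_fun_notin// vexp0// big1// => J _.
by rewrite indicE memNset ?mulr0// => -[].
Qed.

Lemma integral_vexp_el_fun e :
  (\int[mu]_x (vexp (el_fun e x) x.2)%:E =
   \sum_(J : {set el_idx e})
     Kmass m sigma2 rho (\sum_(i in J) el_coef (e := e) i) (el_atom J))%E.
Proof.
under eq_integral do rewrite vexp_el_fun -sumEFin.
rewrite ge0_integral_sum//.
- apply: eq_bigr => J _; rewrite /Kmass [RHS]integral_mkcond.
  apply: eq_integral => x _; rewrite /patch indicE; case: ifP => _.
    by rewrite mulr1.
  by rewrite mulr0.
- move=> J; apply/measurable_EFinP; apply: measurable_funM.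
    exact: measurable_vexp2.
  by apply: measurable_indic; exact: rect_delta_ring_measurable (el_atom_S J).
- by move=> J x _; rewrite lee_fin mulr_ge0 ?vexp_ge0// indicE.
Qed.

Lemma measurable_vexp_el_fun e :
  measurable_fun setT (fun x : E => vexp (el_fun e x) x.2).
Proof.
under eq_fun do rewrite vexp_el_fun.
apply: measurable_sum => J; apply: measurable_funM; first exact: measurable_vexp2.
by apply: measurable_indic; exact: rect_delta_ring_measurable (el_atom_S J).
Qed.

Lemma integral_vexp_el_fun_fin_num e :
  (\int[mu]_x (vexp (el_fun e x) x.2)%:E)%E \is a fin_num.
Proof.
rewrite integral_vexp_el_fun; apply/sum_fin_numP => J _ _.
by apply: (Kmass_fin_num _ _ _ W_char) => //; exact: el_atom_S.
Qed.

(** The atoms carry independent noise, so the moduli multiply over them and the exponents add up to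
    the integral. *)
Lemma cmod2_el_int e : cmod2 P (el_int e) =
  expR (- 2 * fine (\int[mu]_x (vexp (el_fun e x) x.2)%:E)%E).
Proof.
have mi := measurable_el_int.
rewrite (cmod2_ae_eq (mi e) (mi (el_atoms e)) (el_int_atoms e)) cmod2E.
rewrite (cf_W_finite W_id _ (@el_atom_S e) (@el_atom_trivIset e)) cnorm2_prod.
rewrite integral_vexp_el_fun -sum_fine; last first.
  by move=> J _; apply: (Kmass_fin_num _ _ _ W_char) => //; exact: el_atom_S.
rewrite mulr_sumr expR_sum; apply: eq_bigr => J _.
by rewrite -cmod2E (cmod2_W _ _ _ _ W_char) //; exact: el_atom_S.
Qed.

End elementary_integrands.

Lemma fatou_bound (d : measure_display) (U : measurableType d) (R : realType)
    (mu : {measure set U -> \bar R}) (f_ : nat -> U -> R) (f : U -> R) (M : R) :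
  (forall n, measurable_fun setT (f_ n)) -> measurable_fun setT f ->
  (forall n x, 0 <= f_ n x) -> (forall x, 0 <= f x) ->
  {ae mu, forall x, f_ n x @[n --> \oo] --> f x} ->
  (forall n, (\int[mu]_x (f_ n x)%:E <= M%:E)%E) ->
  (\int[mu]_x (f x)%:E <= M%:E)%E.
Proof.
move=> mf_ mf f_0 f0 [N [mN N0 fN]] bM.
have mNC : measurable (~` N) by exact: measurableC.
rewrite -(setTD N) in mNC.
have -> : (\int[mu]_x (f x)%:E = \int[mu]_(x in setT `\` N) (f x)%:E)%E.
  apply: ge0_negligible_integral => //; first exact/measurable_EFinP.
  by move=> x _; rewrite lee_fin.
have -> : (\int[mu]_(x in setT `\` N) (f x)%:E =
    \int[mu]_(x in setT `\` N) limn_einf (fun n => (f_ n x)%:E))%E.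
  apply: eq_integral => x; rewrite inE => -[_ Nx].
  have h : f_ n x @[n --> \oo] --> f x by apply: contrapT => h; apply: Nx; exact: fN.
  have /cvg_limn_einf_sup[-> _] // : (f_ n x)%:E @[n --> \oo] --> (f x)%:E.
  by apply: cvg_EFin => //; exact: nearW.
apply: le_trans (@fatou _ _ _ mu _ mNC (fun n x => (f_ n x)%:E) _ _) _.
- by move=> n; apply/measurable_EFinP; exact: measurable_funTS.
- by move=> n x _; rewrite lee_fin.
rewrite limn_einf_lim; apply: lime_le; first exact: is_cvg_einfs.
apply: nearW => n; apply: le_trans (bM n).
apply: le_trans (ereal_inf_lbound _) _; first by exists n => //=.
apply: ge0_subset_integral => //; first exact/measurable_EFinP.
by move=> x _; rewrite lee_fin.
Qed.

Lemma cvg_trunc (R : realType) (y : R) : 0 <= y ->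
  ((Num.trunc (n.+1%:R * y))%:R / n.+1%:R : R) @[n --> \oo] --> y.
Proof.
move=> y0; apply/cvgrPdist_le => e e0.
have := near_infty_natSinv_lt (PosNum e0); apply: filterS => n /= ne.
have n0 : 0 < n.+1%:R :> R by [].
have y0' : 0 <= n.+1%:R * y by rewrite mulr_ge0.
have /andP[h1 h2] := truncn_itv y0'.
apply: le_trans (ltW ne).
have -> : y - (Num.trunc (n.+1%:R * y))%:R / n.+1%:R =
    (n.+1%:R * y - (Num.trunc (n.+1%:R * y))%:R) / n.+1%:R.
  by rewrite mulrBl mulrAC mulfV ?mul1r// gt_eqF.
rewrite normrM [X in _ * X]gtr0_norm ?invr_gt0// ler_piMl ?invr_ge0//.
rewrite ger0_norm ?subr_ge0// lerBlDr addrC natr1; exact: ltW.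
Qed.

(** * Integrals as limits of elementary integrals *)

Section approximable_integrals.
Context (R : realType) (d d' : measure_display) (T : measurableType d)
  (P : probability T R) (V : measurableType d')
  (m : {sigma_finite_measure set V -> \bar R})
  (W : set (measurableTypeR R * V) -> {RV P >-> R}).
Local Notation E := (measurableTypeR R * V)%type.
Local Notation S := (rect_delta_ring m).
Local Notation mu := (lebesgue_measure \x m)%E.

(* Weaker than [is_stoch_integral]: only the integrals over the whole space are
   required to converge. *)
Definition approx_integral (phi : E -> R) (Y : T -> R) (e : nat -> elem m) : Prop :=
  [/\ measurable_fun setT phi, measurable_fun setT Y,
      {ae mu, forall x, el_fun (e n) x @[n --> \oo] --> phi x} &
      cvg_in_prob P (fun n => el_int W (e n)) Y].

Lemma cvg_in_prob_scale (a : R) (U : nat -> T -> R) (Z : T -> R) :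
  cvg_in_prob P U Z -> cvg_in_prob P (fun n w => a * U n w) (fun w => a * Z w).
Proof.
move=> UZ e e0; have [->|a0] := eqVneq a 0.
  rewrite (_ : (fun n => _) = fun=> 0%E); first exact: cvg_cst.
  apply/funext => n; rewrite (_ : [set w | _] = set0) ?measure0//.
  by apply/seteqP; split => // w /=; rewrite !mul0r subrr normr0 leNgt e0.
have ea0 : 0 < e / `|a| by rewrite divr_gt0// normr_gt0.
have := UZ _ ea0; rewrite (_ : (fun n => _) = (fun n => P [set w | e <= `|a * U n w - a * Z w|]))//.
apply/funext => n; congr (P _); apply/seteqP; split => w /=.
  by rewrite ler_pdivrMr ?normr_gt0// mulrC -normrM mulrBr.
by rewrite ler_pdivrMr ?normr_gt0// [_ * `|a|]mulrC -normrM mulrBr.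
Qed.

Lemma cvg_in_prob_add (U U' : nat -> T -> R) (Z Z' : T -> R) :
  (forall n, measurable_fun setT (U n)) -> measurable_fun setT Z ->
  (forall n, measurable_fun setT (U' n)) -> measurable_fun setT Z' ->
  cvg_in_prob P U Z -> cvg_in_prob P U' Z' ->
  cvg_in_prob P (fun n w => U n w + U' n w) (fun w => Z w + Z' w).
Proof.
move=> mU mZ mU' mZ' UZ UZ' e e0.
have e20 : 0 < e / 2 by rewrite divr_gt0.
have mm (f g : T -> R) (a : R) : measurable_fun setT f -> measurable_fun setT g ->
    measurable [set w | a <= `|f w - g w|].
  move=> mf mg; rewrite -[X in measurable X]setTI.
  apply: (measurable_fun_le (f := cst _)) => //.
  by apply: measurableT_comp => //; exact: measurable_funB.
pose A n := [set w | e / 2 <= `|U n w - Z w|].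
pose A' n := [set w | e / 2 <= `|U' n w - Z' w|].
refine (squeeze_cvge (f := fun=> 0%E) (h := fun n => (P (A n) + P (A' n))%E) _ _ _).
- apply: nearW => n; rewrite measure_ge0/=.
  apply: le_trans (measureU2 P _ _); [|exact: mm|exact: mm].
  apply: le_measure; rewrite ?inE.
  + apply: (mm (fun w => U n w + U' n w) (fun w => Z w + Z' w)).
      exact: measurable_funD.
    exact: measurable_funD.
  + by apply: measurableU; exact: mm.
  + move=> w /= h; apply/orP; rewrite -[X in X || _]negbK -[X in _ || X]negbK -negb_and.
    apply/negP => /andP[]; rewrite -!ltNge => h1 h2.
    move: h; rewrite (_ : _ - _ = (U n w - Z w) + (U' n w - Z' w)); last by ring.
    rewrite leNgt => /negP; apply.
    rewrite (le_lt_trans (ler_normD _ _))//; lra.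
- exact: cvg_cst.
- rewrite -[X in _ --> X](adde0 0%E); apply: cvgeD => //; [exact: UZ|exact: UZ'].
Qed.

Lemma approx_integral_zero : approx_integral (fun=> 0) (fun=> 0) (fun=> el_zero m).
Proof.
split => //.
  by apply: aeW => x; rewrite el_fun_zero; exact: cvg_cst.
move=> e e0; rewrite (_ : (fun n => _) = fun=> 0%E); first exact: cvg_cst.
apply/funext => n; rewrite (_ : [set w | _] = set0) ?measure0//.
by apply/seteqP; split => // w /=; rewrite el_int_zero subrr normr0 leNgt e0.
Qed.

Lemma approx_integral_scale (a : R) phi Y e : approx_integral phi Y e ->
  approx_integral (fun x => a * phi x) (fun w => a * Y w) (fun n => el_scale a (e n)).
Proof.
move=> [mphi mY ephi eY]; split.
- exact: measurable_funM.
- exact: measurable_funM.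
- apply: filterS ephi => x h; under eq_fun do rewrite el_fun_scale.
  exact: cvgMl_tmp.
- have := cvg_in_prob_scale a eY.
  by congr cvg_in_prob; apply/funext => n; apply/funext => w; rewrite el_int_scale.
Qed.

Lemma approx_integral_add phi Y e phi' Y' e' :
  approx_integral phi Y e -> approx_integral phi' Y' e' ->
  approx_integral (fun x => phi x + phi' x) (fun w => Y w + Y' w)
    (fun n => el_add (e n) (e' n)).
Proof.
move=> [mphi mY ephi eY] [mphi' mY' ephi' eY']; split.
- exact: measurable_funD.
- exact: measurable_funD.
- apply: filterS2 ephi ephi' => x h h'; under eq_fun do rewrite el_fun_add.
  exact: cvgD.
- have mi (e0 : elem m) : measurable_fun setT (el_int W e0) by exact: measurable_el_int.
  have := cvg_in_prob_add (fun n => mi (e n)) mY (fun n => mi (e' n)) mY' eY eY'.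
  by congr cvg_in_prob; apply/funext => n; apply/funext => w; rewrite el_int_add.
Qed.

Lemma stoch_integral_approx phi (Y : {RV P >-> R}) :
  is_stoch_integral m W phi Y -> exists e, approx_integral phi Y e.
Proof.
move=> [mphi [phi_ [aephi _ Ycvg]]].
exists (fun n => Elem (sf_coef (s := phi_ n)) (sf_setP (s := phi_ n))).
split => //.
move: Ycvg; congr cvg_in_prob; apply/funext => n; apply/funext => w.
by apply: eq_bigr => i _; rewrite setTI.
Qed.

Hypothesis W_id : id_random_measure m W.
Context (theta sigma2 : V -> R) (rho : R.-ker V ~> measurableTypeR R).
Hypothesis msigma2 : measurable_fun setT sigma2.
Hypothesis sigma2_ge0 : forall v, 0 <= sigma2 v.
Hypothesis rho_levy : forall v, levy_measure (rho v).
Hypothesis W_char : has_characteristics m W theta sigma2 rho.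
Local Notation vexp := (vexp sigma2 rho).

(** The exponent is measurable in [v] and continuous in [u]. Rounding [phi] to multiples of 1/(n+1)
    leaves countably many values, hence a measurable function, and continuity gives the limit. As
    the exponent is even, |phi| can be rounded instead, by truncation to natural numbers. *)
Lemma measurable_vexp_comp (phi : E -> R) : measurable_fun setT phi ->
  measurable_fun setT (fun x : E => vexp (phi x) x.2).
Proof.
move=> mphi.
have mn : measurable_fun setT (fun x => `|phi x|) by exact: measurableT_comp.
pose g n x := vexp ((Num.trunc (n.+1%:R * `|phi x|))%:R / n.+1%:R) x.2.
apply: (@measurable_fun_cvg _ E R setT g); last first.
  move=> x _; rewrite -vexp_norm; apply: gexp_cvg => //.
  by apply: cvg_trunc.
move=> n _ B mB; rewrite setTI.
have -> : g n @^-1` B = \bigcup_k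
    ([set x | (k%:R <= n.+1%:R * `|phi x|)%R] `&`
     [set x | (n.+1%:R * `|phi x| < k.+1%:R)%R] `&`
     (fun x : E => vexp (k%:R / n.+1%:R) x.2) @^-1` B).
  apply/seteqP; split => x /=.
    move=> gB; exists (Num.trunc (n.+1%:R * `|phi x|)) => //.
    by have /truncn_itv/andP[] : 0 <= n.+1%:R * `|phi x| by rewrite mulr_ge0.
  move=> [k _ [[k1 k2]]]; rewrite /g /=.
  by have /truncn_def -> : k%:R <= n.+1%:R * `|phi x| < k.+1%:R by rewrite k1.
apply: bigcupT_measurable => k; apply: measurableI; first apply: measurableI.
- rewrite -[X in measurable X]setTI; apply: (measurable_fun_le (f := cst _)) => //.
  exact: measurable_funM.
- rewrite (_ : [set x | _] = ~` [set x | (k.+1%:R <= n.+1%:R * `|phi x|)%R]).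
    apply: measurableC; rewrite -[X in measurable X]setTI.
    apply: (measurable_fun_le (f := cst _)) => //; exact: measurable_funM.
  by apply/seteqP; split => x /=; rewrite ltNge => /negP.
- by rewrite -[X in measurable X]setTI; apply: measurable_vexp2.
Qed.

Lemma vexp_double_iter (n : nat) u v : vexp (2 ^+ n * u) v <= 4 ^+ n * vexp u v.
Proof.
elim: n => [|n IH]; first by rewrite !expr0 !mul1r.
rewrite !exprS -!mulrA; have h := gexp_double (sigma2 v) (rho_levy v) (2 ^+ n * u).
by apply: (le_trans h); rewrite ler_pM2l.
Qed.

(** As 2^-j Y tends to 0, some j makes its squared modulus exceed 1/2, and the same then holds for
    late approximants. The modulus formula bounds their masses by 1, Fatou transfers the bound to
    2^-j phi, and j doublings cost a factor 4^j. *)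
Lemma approx_integral_vexp_lty phi Y e : approx_integral phi Y e ->
  (\int[mu]_x (vexp (phi x) x.2)%:E < +oo)%E.
Proof.
move=> he; have [mphi mY _ _] := he.
have [j qj] : exists j : nat, 1 / 2 < cmod2 P (fun w => 2 ^- j * Y w).
  have : cmod2 P (fun w => 2 ^- n * Y w) @[n --> \oo] --> cmod2 P (fun=> 0).
    apply: cvg_cmod2_ae => //; first by move=> n; exact: measurable_funM.
    apply: aeW => w; rewrite -[X in _ --> X](mul0r (Y w)); apply: cvgMr_tmp.
    under eq_fun do rewrite -exprVn.
    by apply: cvg_expr; rewrite ger0_norm ?invr_ge0// invf_lt1 ?ltr1n.
  have -> : cmod2 P (fun=> 0) = 1.
    by rewrite /cmod2 /Ecos /Esin cos0 sin0 !Ex_cst expr1n expr0n addr0.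
  have h2 : 0 < 1 / 2 :> R by rewrite divr_gt0.
  move/cvgrPdist_lt/(_ _ h2) => -[j _ /(_ j (leqnn j))] h.
  by exists j; move: h => /=; rewrite ltr_norml => /andP[? ?]; lra.
have [mphi' mY' ephi' eY'] := approx_integral_scale (2 ^- j) he.
have c := cvg_cmod2 (fun n => @measurable_el_int _ _ _ _ _ _ _ W
  (el_scale (2 ^- j) (e n))) mY' eY'.
have [N _ hN] : \forall n \near \oo, 1 / 2 < cmod2 P (el_int W (el_scale (2 ^- j) (e n))).
  exact: (cvgr_gt _ c).
pose I n := (\int[mu]_x (vexp (el_fun (el_scale (2 ^- j) (e (n + N)%N)) x) x.2)%:E)%E.
have bI n : (I n <= 1%:E)%E.
  have fI : I n \is a fin_num by exact: (integral_vexp_el_fun_fin_num msigma2 sigma2_ge0 rho_levy W_char).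
  rewrite -(fineK fI) lee_fin.
  have := hN (n + N)%N (leq_addl _ _) => /=.
  rewrite (cmod2_el_int W_id msigma2 sigma2_ge0 rho_levy W_char) -/(I n) => h.
  (* A mass above 1 would make the squared modulus at most 1/e, and 1/e <= 1/2 since e >= 1 + 1. *)
  rewrite leNgt; apply/negP => I1.
  have : expR (- 2 * fine (I n)) <= expR (- 1 * 1).
    rewrite ler_expR; lra.
  rewrite mulN1r expRN => h'; have := lt_le_trans h h'.
  rewrite div1r ltf_pV2 ?posrE ?expR_gt0//.
  by rewrite ltNge => /negP; apply; have := @expR_ge1Dx R 1; rewrite -mulr2n.
have le1 : (\int[mu]_x (vexp (2 ^- j * phi x) x.2)%:E <= 1%:E)%E.
  apply: (@fatou_bound _ _ _ mu (fun n x =>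
     vexp (el_fun (el_scale (2 ^- j) (e (n + N)%N)) x) x.2)) => //.
  - by move=> n; exact: measurable_vexp_el_fun.
  - exact: measurable_vexp_comp.
  - by move=> n x; exact: vexp_ge0.
  - by move=> x; exact: vexp_ge0.
  - apply: filterS ephi' => x h; apply: gexp_cvg => //.
    by rewrite (cvg_shiftn N (fun n => el_fun (el_scale (2 ^- j) (e n)) x)).
have : (\int[mu]_x (vexp (phi x) x.2)%:E <=
    \int[mu]_x ((4 ^+ j)%:E * (vexp (2 ^- j * phi x) x.2)%:E))%E.
  apply: ge0_le_integral => //.
  - by move=> x _; rewrite lee_fin vexp_ge0.
  - by apply/measurable_EFinP; exact: measurable_vexp_comp.
  - apply/measurable_EFinP; apply: measurable_funM => //.
    exact: measurable_vexp_comp.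
  - move=> x _; rewrite -EFinM lee_fin.
    apply: le_trans (vexp_double_iter j _ _); by rewrite mulrA mulfV ?mul1r// expf_neq0.
move/le_lt_trans; apply; rewrite ge0_integralZl//; last 2 first.
- by apply/measurable_EFinP; exact: measurable_vexp_comp.
- by move=> x _; rewrite lee_fin vexp_ge0.
- by rewrite lte_mul_pinfty// (le_lt_trans le1)// ltry.
Qed.

End approximable_integrals.

(** * Mixing *)

Lemma lebesgue_measure_shift (R : realType) (h : R) (A : set (measurableTypeR R)) :
  measurable A ->
  pushforward (@lebesgue_measure R)
    (fun x : measurableTypeR R => (x - h : measurableTypeR R)) A =
  lebesgue_measure A.
Proof.
move=> mA; pose sh (x : measurableTypeR R) : measurableTypeR R := x - h.
have msh : measurable_fun setT sh by exact: measurable_funB.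
pose nu : {measure set (measurableTypeR R) -> \bar R} :=
  ltac:(refine (pushforward (@lebesgue_measure R) sh); exact: msh).
rewrite -[LHS]/(nu A); apply/esym/lebesgue_measure_unique => // _ [[a b]] _ <-.
rewrite /nu /= /pushforward (_ : _ @^-1` _ = `](a + h), (b + h)]%classic).
  rewrite /= !lebesgue_measure_itv/= !lte_fin ltrD2r; case: ifP => // _.
  by rewrite -!EFinB; congr (_%:E); ring.
by apply/seteqP; split => x /=; rewrite !in_itv /= ltrBrDr lerBlDr.
Qed.

Lemma ge0_integral_shift (R : realType) (h : R) (f : R -> \bar R) :
  measurable_fun setT f -> (forall x, (0 <= f x)%E) ->
  (\int[lebesgue_measure]_(x in setT) f (x - h)%R =
   \int[lebesgue_measure]_(x in setT) f x)%E.
Proof.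
move=> mf f0.
have ms : measurable_fun setT (fun x : measurableTypeR R => x - h : measurableTypeR R).
  exact: measurable_funB.
have := @ge0_integral_pushforward _ _ (measurableTypeR R) (measurableTypeR R) R
  _ ms lebesgue_measure setT f.
rewrite preimage_setT => <- //.
by apply: eq_measure_integral => A mA _; exact: lebesgue_measure_shift.
Qed.

(** * Mass of a translated kernel in a bounded time window *)

Section shifted_mass.
Context (R : realType) (d' : measure_display) (V : measurableType d')
  (m : {sigma_finite_measure set V -> \bar R}).
Local Notation E := (measurableTypeR R * V)%type.
Local Notation mu := (lebesgue_measure \x m)%E.

(** Integrating out [v] leaves an integrable function [H] of time. Undoing the translation moves the
    window [-a, a] to [-a - h, a - h], which eventually leaves every point, and [H] dominates. *)
Lemma cvg_shifted_mass (q : E -> R) (a : R) :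
  measurable_fun setT q -> (forall x, 0 <= q x) ->
  (\int[mu]_x (q x)%:E < +oo)%E ->
  (\int[mu]_(x in [set x | (`|x.1| <= a)%R]) (q ((x.1 - h%:R)%R, x.2))%:E)%E
    @[h --> \oo] --> 0%E.
Proof.
move=> mq q0 qfin.
have mqE : measurable_fun setT (EFin \o q) by exact/measurable_EFinP.
have q0E x : (0 <= (EFin \o q) x)%E by rewrite lee_fin.
pose H := fubini_F m (EFin \o q).
have mH : measurable_fun setT H by exact: measurable_fun_fubini_tonelli_F.
have H0 x : (0 <= H x)%E by apply: integral_ge0 => v _; rewrite lee_fin.
have iH : (\int[lebesgue_measure]_x H x < +oo)%E by rewrite -fubini_tonelli1.
pose A (h : nat) := [set y : measurableTypeR R | `|y + h%:R| <= a].
have mA h : measurable (A h).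
  rewrite -[A h]setTI; apply: (measurable_fun_le (g := cst a)) => //.
  by apply: measurableT_comp => //; exact: measurable_funD.
have mB : measurable [set x : E | `|x.1| <= a].
  rewrite -[X in measurable X]setTI; apply: (measurable_fun_le (g := cst a)) => //.
  by apply: measurableT_comp => //; exact: measurable_fst.
have mqh h : measurable_fun setT (fun x : E => q (x.1 - h%:R, x.2)).
  apply: (measurableT_comp mq); apply/measurable_fun_pairP; split => /=.
    by apply: measurable_funB => //; exact: measurable_fst.
  exact: measurable_snd.
have mAH h : measurable_fun setT (fun y => (\1_(A h) y)%:E * H y)%E.
  by apply: emeasurable_funM => //; apply/measurable_EFinP; exact: measurable_indic.
have key h : (\int[mu]_(x in [set x | (`|x.1| <= a)%R]) (q ((x.1 - h%:R)%R, x.2))%:E =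
    \int[lebesgue_measure]_y ((\1_(A h) y)%:E * H y))%E.
  rewrite integral_mkcond fubini_tonelli1; last 2 first.
  - by apply/(measurable_restrictT _ mB); apply: measurable_funTS; exact/measurable_EFinP.
  - by move=> x; apply: erestrict_ge0 => y _; rewrite lee_fin.
  rewrite -(ge0_integral_shift h%:R (mAH h)); last first.
    by move=> x; rewrite mule_ge0// lee_fin.
  apply: eq_integral => x _; rewrite /fubini_F /H /fubini_F indicE /=.
  case: (boolP (x - h%:R \in A h)) => xA.
    rewrite mul1e; apply: eq_integral => v _; rewrite /patch ifT//.
    by rewrite inE /=; move: xA; rewrite inE /A /= subrK.
  rewrite mul0e; apply: integral0_eq => v _; rewrite /patch ifF//.
  by apply: contraNF xA; rewrite !inE /A /= subrK.
under eq_fun do rewrite key.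
have ae0 : {ae lebesgue_measure, forall y : measurableTypeR R, setT y ->
    ((\1_(A h) y)%:E * H y)%E @[h --> \oo] --> (cst 0%E y : \bar R)}.
  apply: aeW => y _; apply: cvg_near_cst.
  near=> h; rewrite indicE memNset ?mul0e//= /A /= => /(le_trans (ler_norm _)).
  apply/negP; rewrite -ltNge -ltrBlDl.
  by near: h; exact: nbhs_infty_gtr.
have iH' : lebesgue_measure.-integrable setT H.
  apply/integrableP; split => //.
  by under eq_integral do rewrite gee0_abs//.
have dom : {ae lebesgue_measure, forall (y : measurableTypeR R) (h : nat), setT y ->
    (`|(\1_(A h) y)%:E * H y| <= H y)%E}.
  apply: aeW => y h _; rewrite gee0_abs ?mule_ge0 ?lee_fin//.
  by rewrite indicE; case: (_ \in _); rewrite ?mul1e ?mul0e.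
have [|_ _ c] := dominated_convergence measurableT mAH _ ae0 iH' dom.
  exact: measurable_cst.
by move: c; rewrite integral_cst// mul0e.
Unshelve. all: by end_near.
Qed.

End shifted_mass.

(** * Sets on which countably many sequences are bounded *)

Section good_sets.
Context (d : measure_display) (U : measurableType d) (R : realType)
  (mu : {measure set U -> \bar R}).
Variable box : nat -> set U.
Hypothesis mbox : forall n, measurable (box n).
Hypothesis box_fin : forall n, (mu (box n) < +oo)%E.
Hypothesis box_nd : forall x k n, (k <= n)%N -> box k x -> box n x.
Hypothesis box_cover : forall x, exists n, box n x.
Variable b : nat -> nat -> U -> R.
Hypothesis mb : forall h n, measurable_fun setT (b h n).
Hypothesis b_bounded :
  forall h, {ae mu, forall x, exists M : R, forall n, b h n x <= M}.

Let exceed h (M : R) := [set x | exists n, M < b h n x].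

Let mexceed h M : measurable (exceed h M).
Proof.
rewrite (_ : exceed h M = \bigcup_n [set x | M < b h n x]).
  apply: bigcupT_measurable => n.
  rewrite (_ : [set x | _] = ~` [set x | b h n x <= M]).
    apply: measurableC; rewrite -[X in measurable X]setTI.
    exact: (measurable_fun_le (g := cst M)).
  by apply/seteqP; split => x /=; rewrite ltNge => /negP.
by apply/seteqP; split => x; [move=> [n]; exists n|move=> [n _]; exists n].
Qed.

(** Almost every point is bounded along [n], so the exceeding sets decrease to a null set; inside a
    box of finite measure their measures tend to 0. The bound 1/2^(h+1) is chosen to be summable. *)
Let threshold h : exists M : nat,
  (mu (box h `&` exceed h M%:R) <= (1 / 2 ^+ h.+1)%:E)%E.
Proof.
pose F k := box h `&` exceed h k%:R.
have mF k : measurable (F k) by exact: measurableI.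
have ndF : nonincreasing_seq F.
  move=> i j ij; apply/subsetPset => x [bx [n jn]]; split => //; exists n.
  by apply: le_lt_trans jn; rewrite ler_nat.
have F0 : (mu (F 0%N) < +oo)%E.
  by apply: le_lt_trans (box_fin h); rewrite le_measure ?inE//; exact: subIsetl.
have null : mu (\bigcap_n F n) = 0%E.
  have [N [mN N0 hN]] := b_bounded h.
  apply: (subset_measure0 _ mN _ N0); first exact: bigcapT_measurable.
  move=> x Fx; apply: hN => -[M bM].
  have [_ [n]] := Fx (Num.trunc `|M|).+1 Logic.I.
  apply/negP; rewrite -leNgt (le_trans (bM n))// (le_trans (ler_norm _))//.
  by rewrite ltW// truncnS_gt.
have := nonincreasing_cvg_mu F0 mF (bigcapT_measurable mF) ndF.
rewrite null => /fine_cvgP[Ffin /cvgrPdist_le].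
have e0 : 0 < 1 / 2 ^+ h.+1 :> R by rewrite divr_gt0// exprn_gt0.
move=> /(_ _ e0) Fc; near \oo => k.
exists k.
have Fk : mu (F k) \is a fin_num by near: k.
have : `|0 - fine (mu (F k))| <= 1 / 2 ^+ h.+1 by near: k.
by rewrite sub0r normrN ger0_norm ?fine_ge0// => h1; rewrite -(fineK Fk) lee_fin.
Unshelve. all: by end_near.
Qed.

(** By Borel-Cantelli almost every point lies in finitely many of the sets where [b h] exceeds its
    threshold [M h]. At such a point [M h] is a bound for all large [h], and a large factor N takes
    care of the finitely many remaining [h]. *)
Lemma good_sets : exists (D : nat -> set U) (M : nat -> nat -> R),
  [/\ forall N, measurable (D N) /\ D N `<=` box N,
      forall x k N, (k <= N)%N -> D k x -> D N x,
      forall x, exists N, D N x &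
      forall N h, {ae mu, forall x, D N x -> forall n, b h n x <= M N h}].
Proof.
have /choice[M hM] := threshold.
pose A h := box h `&` exceed h (M h)%:R.
have mA h : measurable (A h) by exact: measurableI.
have A0 : mu (lim_sup_set A) = 0%E.
  apply: lim_sup_set_cvg0 => //.
  apply: (@le_lt_trans _ _ (\sum_(h <oo) (1 / (2 ^ h.+1)%:R)%:E)%E).
    apply: lee_nneseries => [*|h *]; [exact: measure_ge0|rewrite natrX; exact: hM].
  by apply: le_lt_trans (epsilon_trick0 _ _) _; rewrite ?ltry.
(* The added 1 keeps the factor [M h + 1] at least 1, so that the bound is at least N even where the
   threshold is 0. *)
pose Q N := [set x | forall h n, b h n x <= N%:R * ((M h)%:R + 1)].
have mQ N : measurable (Q N).
  rewrite (_ : Q N = \bigcap_h \bigcap_n [set x | b h n x <= N%:R * ((M h)%:R + 1)]).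
    apply: bigcapT_measurable => h; apply: bigcapT_measurable => n.
    rewrite -[X in measurable X]setTI.
    exact: (measurable_fun_le (g := cst _)).
  by apply/seteqP; split => x; [move=> Qx h _ n _; exact: Qx|move=> Qx h n; exact: Qx].
have Q_nd x k N : (k <= N)%N -> Q k x -> Q N x.
  move=> kN Qx h n; apply: (le_trans (Qx h n)).
  by rewrite ler_wpM2r ?addr_ge0// ler_nat.
(* The null set left over is adjoined to every [Q N]: the sets then cover every point, and their
   bounds still hold almost everywhere. *)
pose Z := ~` \bigcup_N Q N.
have mZ : measurable Z by apply: measurableC; exact: bigcupT_measurable.
have Z0 : mu Z = 0%E.
  have hall : {ae mu, forall x, forall h, exists K : R, forall n, b h n x <= K}.
    by apply/ae_foralln.
  have [N [mN N0 hN]] := hall.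
  have mls : measurable (lim_sup_set A).
    by apply: bigcapT_measurable => n; apply: bigcup_measurable => k _; exact: mA.
  apply: (@subset_measure0 _ _ _ mu _ (N `|` lim_sup_set A)) => //.
  - exact: measurableU.
  - move=> x Zx; have [Nx|nNx] := pselect (N x); [by left|right].
    apply: contrapT => nls; apply: Zx.
    have bx h : exists K : R, forall n, b h n x <= K.
      by move: h; apply: contrapT => hx; apply: nNx; exact: hN.
    have [k0 hk0] := box_cover x.
    have [h0 hh0] : exists h0, forall h, (h0 <= h)%N -> ~ A h x.
      apply: contrapT => hh; apply: nls => h0 _; apply: contrapT => hA; apply: hh.
      by exists h0 => h h0h Ah; apply: hA; exists h.
    have /choice[K hK] := bx.
    pose h1 := maxn k0 h0.
    pose N0' := \max_(h < h1) (Num.trunc `|K h|).+1.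
    exists N0'.+1 => // h n.
    have [hh1|h1h] := ltnP h h1.
      apply: (le_trans (hK h n)); apply: (le_trans (ler_norm _)).
      apply: (@le_trans _ _ N0'.+1%:R); last by rewrite ler_peMr// lerDr.
      apply: (@le_trans _ _ (Num.trunc `|K h|).+1%:R); first by rewrite ltW// truncnS_gt.
      by rewrite ler_nat; apply: leqW; exact: (leq_bigmax (Ordinal hh1)).
    have nA := hh0 h (leq_trans (leq_maxr _ _) h1h).
    have bxh : box h x by apply: box_nd hk0; exact: leq_trans (leq_maxl _ _) h1h.
    have le1 : b h n x <= (M h)%:R.
      rewrite leNgt; apply/negP => lt; apply: nA; split => //; by exists n.
    apply: (le_trans le1); apply: (@le_trans _ _ ((M h)%:R + 1)); first by rewrite lerDl.
    by rewrite ler_peMl ?addr_ge0// ler1n.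
  - by apply: null_set_setU.
exists (fun N => box N `&` (Q N `|` Z)), (fun N h => N%:R * ((M h)%:R + 1)); split.
- move=> N; split; last exact: subIsetl.
  by apply: measurableI => //; exact: measurableU.
- move=> x k N kN [bx [Qx|Zx]]; split; [exact: box_nd bx|by left; exact: Q_nd Qx|
    exact: box_nd bx|by right].
- move=> x; have [k bx] := box_cover x.
  have [Zx|nZx] := pselect (Z x); first by exists k; split => //; right.
  have [N _ QN] : (\bigcup_N Q N) x by apply: contrapT.
  exists (maxn k N); split; first by apply: box_nd bx; exact: leq_maxl.
  by left; apply: Q_nd QN; exact: leq_maxr.
- move=> N h; exists Z; split => // x /=.
  move=> hx; apply: contrapT => nZx; apply: hx => -[bx [Qx|//]] n; exact: Qx.
Qed.

End good_sets.

(** * Covariances with trigonometric functions *)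

Section covariance.
Context (R : realType) (d : measure_display) (T : measurableType d)
  (P : probability T R).

Definition cov (g z : T -> R) : R := Ex P (fun w => g w * z w) - Ex P g * Ex P z.

(** The errors in the product formula for e^(i(B+Y)) mix two covariances each; replacing [B] by its
    opposite changes the sign of one of them, so half sums and half differences isolate all four. *)
Lemma covE (B Y : T -> R) : measurable_fun setT B -> measurable_fun setT Y ->
  let dc B := Ecos P (fun w => B w + Y w) - (Ecos P B * Ecos P Y - Esin P B * Esin P Y) in
  let ds B := Esin P (fun w => B w + Y w) - (Esin P B * Ecos P Y + Ecos P B * Esin P Y) in
  let NB := fun w => - 1 * B w in
  [/\ cov (fun w => cos (Y w)) (fun w => cos (B w)) = (dc B + dc NB) / 2,
      cov (fun w => sin (Y w)) (fun w => sin (B w)) = (dc NB - dc B) / 2,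
      cov (fun w => cos (Y w)) (fun w => sin (B w)) = (ds B - ds NB) / 2 &
      cov (fun w => sin (Y w)) (fun w => cos (B w)) = (ds B + ds NB) / 2].
Proof.
move=> mB mY.
have bcB := bounded_meas_cos mB; have bsB := bounded_meas_sin mB.
have bcY := bounded_meas_cos mY; have bsY := bounded_meas_sin mY.
have bcc := bounded_measM bcY bcB; have bss := bounded_measM bsY bsB.
have bcs := bounded_measM bcY bsB; have bsc := bounded_measM bsY bcB.
have e1 : Ecos P (fun w => B w + Y w) =
    Ex P (fun w => cos (Y w) * cos (B w)) - Ex P (fun w => sin (Y w) * sin (B w)).
  by rewrite -ExB//; congr Ex; apply/funext => w; rewrite cosD; ring.
have e2 : Esin P (fun w => B w + Y w) =
    Ex P (fun w => cos (Y w) * sin (B w)) + Ex P (fun w => sin (Y w) * cos (B w)).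
  by rewrite -ExD//; congr Ex; apply/funext => w; rewrite sinD; ring.
have e3 : Ecos P (fun w => - 1 * B w + Y w) =
    Ex P (fun w => cos (Y w) * cos (B w)) + Ex P (fun w => sin (Y w) * sin (B w)).
  by rewrite -ExD//; congr Ex; apply/funext => w; rewrite mulN1r cosD cosN sinN; ring.
have e4 : Esin P (fun w => - 1 * B w + Y w) =
    Ex P (fun w => sin (Y w) * cos (B w)) - Ex P (fun w => cos (Y w) * sin (B w)).
  by rewrite -ExB//; congr Ex; apply/funext => w; rewrite mulN1r sinD cosN sinN; ring.
have e5 : Ecos P (fun w => - 1 * B w) = Ecos P B.
  by congr Ex; apply/funext => w; rewrite mulN1r cosN.
have e6 : Esin P (fun w => - 1 * B w) = - Esin P B.
  rewrite -[RHS]mulN1r -ExZ//; congr Ex; apply/funext => w.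
  by rewrite mulN1r sinN mulN1r.
move=> dc ds NB; rewrite /dc /ds /NB e1 e2 e3 e4 e5 e6 /cov -!/(Ecos P _) -!/(Esin P _).
by split; field.
Qed.

Lemma norm_cov_diff (g z z' : T -> R) : bounded_meas g -> (forall w, `|g w| <= 1) ->
  bounded_meas z -> bounded_meas z' ->
  `|cov g z - cov g z'| <= 2 * Ex P (fun w => `|z w - z' w|).
Proof.
move=> bg g1 bz bz'.
have bzz := bounded_measB bz bz'.
have -> : cov g z - cov g z' =
    Ex P (fun w => g w * (z w - z' w)) - Ex P g * Ex P (fun w => z w - z' w).
  rewrite (ExB P bz bz') (_ : (fun w => g w * (z w - z' w)) =
    fun w => g w * z w - g w * z' w); last by apply/funext => w; ring.
  rewrite (ExB P (bounded_measM bg bz) (bounded_measM bg bz')) /cov; ring.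
have le1 : `|Ex P (fun w => g w * (z w - z' w))| <= Ex P (fun w => `|z w - z' w|).
  rewrite (le_trans (norm_Ex _ (bounded_measM bg bzz)))//; apply: le_Ex.
  - by apply: bounded_meas_norm; exact: bounded_measM.
  - exact: bounded_meas_norm.
  - by move=> w; rewrite normrM ler_piMl.
have le2 : `|Ex P g| <= 1.
  rewrite (le_trans (norm_Ex _ bg))// -[leRHS](Ex_cst P); apply: le_Ex => //.
    exact: bounded_meas_norm.
  exact: bounded_meas_cst.
have le3 := norm_Ex P bzz.
rewrite (le_trans (ler_normB _ _))// normrM mulr_natl mulr2n lerD//.
by rewrite (le_trans _ le3)// ler_piMl.
Qed.

Definition mixes (Y : nat -> T -> R) (z : T -> R) :=
  (cov (fun w => cos (Y n w)) z @[n --> \oo] --> (0 : R)) /\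
  (cov (fun w => sin (Y n w)) z @[n --> \oo] --> (0 : R)).

(** Replacing [z] by [zn k] changes the covariance by at most twice an L1 distance, uniformly in
    [n]; so [k] can be chosen before [n]. *)
Lemma mixes_L1 (Y : nat -> T -> R) (zn : nat -> T -> R) z :
  (forall n, measurable_fun setT (Y n)) -> (forall n, bounded_meas (zn n)) ->
  bounded_meas z ->
  Ex P (fun w => `|zn n w - z w|) @[n --> \oo] --> (0 : R) ->
  (forall n, mixes Y (zn n)) -> mixes Y z.
Proof.
move=> mY bzn bz L1 mixn.
have gen (g : R -> R) : (forall n, bounded_meas (fun w => g (Y n w))) ->
    (forall x, `|g x| <= 1) ->
    (forall k, cov (fun w => g (Y n w)) (zn k) @[n --> \oo] --> (0 : R)) ->
    cov (fun w => g (Y n w)) z @[n --> \oo] --> (0 : R).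
  move=> bg g1 gk; apply/cvgrPdist_le => e e0.
  have e40 : 0 < e / 4 by rewrite divr_gt0.
  have e20 : 0 < e / 2 by rewrite divr_gt0.
  move/cvgrPdist_le : L1 => /(_ _ e40) [k _ /(_ k (leqnn k))] /=.
  rewrite sub0r normrN ger0_norm ?Ex_ge0// => hk.
  move/cvgrPdist_le : (gk k) => /(_ _ e20); apply: filterS => n.
  rewrite !sub0r !normrN => hn.
  have := norm_cov_diff (bg n) (fun w => g1 (Y n w)) (bzn k) bz.
  move=> h; rewrite -[cov _ z](subrK (cov (fun w => g (Y n w)) (zn k))).
  rewrite (le_trans (ler_normD _ _))// distrC.
  lra.
split.
- apply: gen => [n|x|k]; [exact: bounded_meas_cos|exact: cos_max|exact: (mixn k).1].
- apply: gen => [n|x|k]; [exact: bounded_meas_sin|exact: sin_max|exact: (mixn k).2].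
Qed.

Lemma cvg_L1_ae (zn : nat -> T -> R) (z : T -> R) (M : R) :
  (forall n, measurable_fun setT (zn n)) -> measurable_fun setT z ->
  (forall n w, `|zn n w| <= M) -> (forall w, `|z w| <= M) ->
  {ae P, forall w, zn n w @[n --> \oo] --> z w} ->
  Ex P (fun w => `|zn n w - z w|) @[n --> \oo] --> (0 : R).
Proof.
move=> mzn mz znM zM h; rewrite -[X in _ --> X](Ex_cst P 0).
apply: (@Ex_cvg _ _ _ P (fun n w => `|zn n w - z w|) _ (M + M)).
- by move=> n; apply: measurableT_comp => //; exact: measurable_funB.
- exact: measurable_cst.
- by move=> n w; rewrite normr_id (le_trans (ler_normB _ _))// lerD.
- apply: filterS h => w hw; rewrite -[X in _ --> X](normr0 R) -[X in `|X|](subrr (z w)).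
  by apply: cvg_norm; apply: cvgB => //; exact: cvg_cst.
Qed.

End covariance.

(** * Decorrelation of the translated integrals *)

Section mixing.
Context (R : realType) (d d' : measure_display) (T : measurableType d)
  (P : probability T R) (V : measurableType d')
  (m : {sigma_finite_measure set V -> \bar R})
  (W : set (measurableTypeR R * V) -> {RV P >-> R})
  (theta sigma2 : V -> R) (rho : R.-ker V ~> measurableTypeR R).
Hypothesis msigma2 : measurable_fun setT sigma2.
Hypothesis sigma2_ge0 : forall v, 0 <= sigma2 v.
Hypothesis rho_levy : forall v, levy_measure (rho v).
Hypothesis W_id : id_random_measure m W.
Hypothesis W_char : has_characteristics m W theta sigma2 rho.
Local Notation E := (measurableTypeR R * V)%type.
Local Notation S := (rect_delta_ring m).
Local Notation mu := (lebesgue_measure \x m)%E.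
Local Notation vexp := (vexp sigma2 rho).

(** Countable additivity is applied to the successive differences; their partial sums are the
    [W (C n)] by finite additivity. *)
Lemma W_cvg_nondecreasing (C : nat -> set E) : (forall n, measurable (C n)) ->
  (forall x k n, (k <= n)%N -> C k x -> C n x) -> S (\bigcup_n C n) ->
  {ae P, forall w, W (C n) w @[n --> \oo] --> W (\bigcup_n C n) w}.
Proof.
move=> mC ndC SU.
have SC n : S (C n).
  by apply: (rect_delta_ring_sub SU) => //; exact: bigcup_sup.
have nd : nondecreasing_seq C.
  by move=> i j ij; apply/subsetPset => x; exact: ndC.
have SD n : S (seqD C n).
  apply: (rect_delta_ring_sub (SC n)); last first.
    by rewrite -seqDU_seqD//; exact: subset_seqDU.
  by rewrite -seqDU_seqD//; exact: seqDU_measurable.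
have tD := trivIset_seqD nd.
have UD : \bigcup_n seqD C n = \bigcup_n C n.
  by rewrite -seqDU_seqD// -seqDU_bigcup_eq.
have := W_sigma_additive W_id SD tD; rewrite UD => /(_ SU) h1.
have h2 : {ae P, forall w, forall n, W (C n) w = \sum_(k < n.+1) W (seqD C k) w}.
  apply/ae_foralln => n.
  have SF (k : 'I_n.+1) : S (seqD C k) by [].
  have tF : trivIset setT (fun k : 'I_n.+1 => seqD C k).
    by move=> i j _ _ /tD => /(_ Logic.I Logic.I)/val_inj.
  have := W_finite_additive W_id SF tF.
  by rewrite nondecreasing_bigsetU_seqD.
apply: filterS2 h1 h2 => w h1 h2; under eq_fun do rewrite h2.
by move: h1; rewrite -(cvg_shiftS (fun n => \sum_(k < n) W (seqD C k) w)).
Qed.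

Variables (Phi : E -> R) (Y : nat -> T -> R) (e : nat -> nat -> elem m).
Hypothesis hY : forall h,
  approx_integral W (fun x => Phi (x.1 - h%:R, x.2)) (Y h) (e h).

Let mY h : measurable_fun setT (Y h). Proof. by case: (hY h). Qed.

Let mPhi h : measurable_fun setT (fun x : E => Phi (x.1 - h%:R, x.2)).
Proof. by case: (hY h). Qed.

Let mi (f : elem m) : measurable_fun setT (el_int W f).
Proof. exact: measurable_el_int. Qed.

Let Phi_mass : (\int[mu]_x (vexp (Phi x) x.2)%:E < +oo)%E.
Proof.
have /(approx_integral_vexp_lty W_id msigma2 sigma2_ge0 rho_levy W_char) := hY 0.
by under eq_integral do rewrite subr0 -surjective_pairing.
Qed.

Let mPhi0 : measurable_fun setT Phi.
Proof.
have := mPhi 0; congr measurable_fun; apply/funext => x.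
by rewrite subr0 -surjective_pairing.
Qed.

Section good_set.
Variables (D : set E) (a : R) (M : nat -> R).
Hypothesis mD : measurable D.
Hypothesis D_fin : (mu D < +oo)%E.
Hypothesis D_sub : D `<=` [set x | `|x.1| <= a].
Hypothesis D_good : forall h, {ae mu, forall x, D x -> forall n,
  vexp (el_fun (e h n) x) x.2 <= M h}.

Let massD h := fine (\int[mu]_(x in D) (vexp (Phi (x.1 - h%:R, x.2)) x.2)%:E)%E.

Let mDC : measurable (~` D). Proof. exact: measurableC. Qed.

(** Convergence of the simple functions holds only almost everywhere; on [D] it is dominated by the
    constant [M h], integrable because [D] has finite measure. *)
Let cvg_mass h :
  fine (\int[mu]_x (vexp (el_fun (el_restrict mD (e h n)) x) x.2)%:E)%E
    @[n --> \oo] --> massD h.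
Proof.
have eqI n : (\int[mu]_x (vexp (el_fun (el_restrict mD (e h n)) x) x.2)%:E =
    \int[mu]_(x in D) (vexp (el_fun (e h n) x) x.2)%:E)%E.
  rewrite [RHS]integral_mkcond; apply: eq_integral => x _.
  rewrite el_fun_restrict /patch indicE; case: ifP => _; first by rewrite mulr1.
  by rewrite mulr0 vexp0.
under eq_fun do rewrite eqI.
have aeC : {ae mu, forall x, D x ->
    (vexp (el_fun (e h n) x) x.2)%:E @[n --> \oo] -->
    (vexp (Phi (x.1 - h%:R, x.2)) x.2)%:E}.
  have [_ _ ec _] := hY h.
  apply: filterS ec => x hx _; apply: cvg_EFin; first exact: nearW.
  exact: gexp_cvg.
have iM : mu.-integrable D (EFin \o cst (M h)).
  apply: measurable_bounded_integrable => //; exists `|M h|; split => // K MK x _ /=.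
  exact: ltW.
have dom : {ae mu, forall x n, D x ->
    (`|(vexp (el_fun (e h n) x) x.2)%:E| <= (EFin \o cst (M h)) x)%E}.
  apply: filterS (D_good h) => x hx n Dx.
  by rewrite gee0_abs ?lee_fin ?vexp_ge0//=; exact: hx.
have [||ig _ c] := dominated_convergence mD _ _ aeC iM dom.
- move=> n; apply: measurable_funTS; apply/measurable_EFinP.
  exact: measurable_vexp_el_fun.
- by apply: measurable_funTS; apply/measurable_EFinP; exact: measurable_vexp_comp.
by apply: fine_cvg; rewrite fineK; [exact: c|exact: integrable_fin_num].
Qed.

(** Each approximant of [Y h] is cut along [D]. The outer part is independent of [B] and of the
    inner part, and the error depends on the inner part alone, whose modulus converges by
    [cvg_mass]; the inequality then passes to the limit in n. *)
Let decorrelate (B : elem m) h : (forall i, el_set (e := B) i `<=` D) ->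
  `|Ecos P (fun w => el_int W B w + Y h w) -
     (Ecos P (el_int W B) * Ecos P (Y h) - Esin P (el_int W B) * Esin P (Y h))|
    <= 4 * Num.sqrt (1 - expR (- 2 * massD h)) /\
  `|Esin P (fun w => el_int W B w + Y h w) -
     (Esin P (el_int W B) * Ecos P (Y h) + Ecos P (el_int W B) * Esin P (Y h))|
    <= 4 * Num.sqrt (1 - expR (- 2 * massD h)).
Proof.
move=> BD; have [_ _ _ eY] := hY h.
pose s n := Num.sqrt (1 - cmod2 P (el_int W (el_restrict mD (e h n)))).
have cs : 4 * s n @[n --> \oo] --> 4 * Num.sqrt (1 - expR (- 2 * massD h)).
  apply: cvgMl_tmp; apply: (@cvg_comp _ _ _ _ Num.sqrt); last exact: sqrt_continuous.
  apply: cvgB; first exact: cvg_cst.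
  under eq_fun do rewrite (cmod2_el_int W_id msigma2 sigma2_ge0 rho_levy W_char).
  apply: (@cvg_comp _ _ _ _ expR); last exact: continuous_expR.
  by apply: cvgMl_tmp; exact: cvg_mass.
have mBn n : measurable_fun setT (fun w => el_int W B w + el_int W (e h n) w).
  exact: measurable_funD.
have mBY : measurable_fun setT (fun w => el_int W B w + Y h w).
  exact: measurable_funD.
have BeY : cvg_in_prob P (fun n w => el_int W B w + el_int W (e h n) w)
    (fun w => el_int W B w + Y h w).
  move=> eps eps0; have := eY _ eps0.
  rewrite [X in X @ _ --> _ -> _](_ : _ = (fun n => P [set w | eps <=
    `|el_int W B w + el_int W (e h n) w - (el_int W B w + Y h w)|]))//.
  apply/funext => n; congr (P _); apply/funext => w /=.
  by rewrite opprD addrACA subrr add0r.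
have c1 := cvg_Ecos mBn mBY BeY; have c2 := cvg_Esin mBn mBY BeY.
have c3 := cvg_Ecos (fun n => mi (e h n)) (mY h) eY.
have c4 := cvg_Esin (fun n => mi (e h n)) (mY h) eY.
have key n :
  `|Ecos P (fun w => el_int W B w + el_int W (e h n) w) -
     (Ecos P (el_int W B) * Ecos P (el_int W (e h n)) -
      Esin P (el_int W B) * Esin P (el_int W (e h n)))| <= 4 * s n /\
  `|Esin P (fun w => el_int W B w + el_int W (e h n) w) -
     (Esin P (el_int W B) * Ecos P (el_int W (e h n)) +
      Ecos P (el_int W B) * Esin P (el_int W (e h n)))| <= 4 * s n.
  set I := el_int W (el_restrict mD (e h n)).
  set J := el_int W (el_restrict mDC (e h n)).
  have sI i : el_set (e := el_restrict mD (e h n)) i `<=` D by exact: subIsetr.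
  have sJ i : el_set (e := el_restrict mDC (e h n)) i `<=` ~` D by exact: subIsetr.
  have mI : measurable_fun setT I by exact: mi.
  have mJ : measurable_fun setT J by exact: mi.
  have IJ : cf_mul P I J by apply/cf_mulP; exact: (cf_el_split W_id sI sJ).
  have BIJ : cf_mul P (fun w => el_int W B w + I w) J.
    have BIE : (fun w => el_int W B w + I w) =
        el_int W (el_add B (el_restrict mD (e h n))).
      by apply/funext => w; rewrite el_int_add.
    rewrite BIE; apply/cf_mulP; apply: (cf_el_split W_id _ sJ).
    by move=> [i|i]; [exact: BD|exact: sI].
  have aeIJ := el_int_restrict W_id mD mDC (e h n).
  have [] := cmod2_decorrelate (mi B) mI mJ BIJ IJ.
  have mIJ : measurable_fun setT (fun w => I w + J w) by exact: measurable_funD.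
  have mBIJ : measurable_fun setT (fun w => el_int W B w + (I w + J w)).
    exact: measurable_funD.
  have aeB : {ae P, forall w, el_int W B w + (I w + J w) =
      el_int W B w + el_int W (e h n) w}.
    by apply: filterS aeIJ => w ->.
  have aeIJ' : {ae P, forall w, I w + J w = el_int W (e h n) w}.
    by apply: filterS aeIJ => w ->.
  by rewrite (Ecos_ae_eq mBIJ (mBn n) aeB) (Esin_ae_eq mBIJ (mBn n) aeB)
    (Ecos_ae_eq mIJ (mi _) aeIJ') (Esin_ae_eq mIJ (mi _) aeIJ').
split.
- apply: (ler_cvg_to _ cs); last by apply: nearW => n; exact: (key n).1.
  apply: cvg_norm; apply: cvgB => //; apply: cvgB; exact: cvgMl_tmp.
- apply: (ler_cvg_to _ cs); last by apply: nearW => n; exact: (key n).2.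
  apply: cvg_norm; apply: cvgB => //; apply: cvgD; exact: cvgMl_tmp.
Qed.

(** [D] lies in a strip bounded in time, so its mass is squeezed by that of the translated kernel in
    the strip. *)
Let cvg_massD : massD h @[h --> \oo] --> (0 : R).
Proof.
have mq : measurable_fun setT (fun x : E => vexp (Phi x) x.2).
  exact: measurable_vexp_comp.
have q0 x : 0 <= vexp (Phi x) x.2 by exact: vexp_ge0.
have := cvg_shifted_mass a mq q0 Phi_mass => /= c.
apply: fine_cvg; apply: (squeeze_cvge (f := fun=> 0%E) _ _ c); last exact: cvg_cst.
apply: nearW => h; apply/andP; split.
  by apply: integral_ge0 => x _; rewrite lee_fin vexp_ge0.
apply: ge0_subset_integral => //.
- rewrite -[X in measurable X]setTI; apply: (measurable_fun_le (g := cst a)) => //.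
  by apply: measurableT_comp => //; exact: measurable_fst.
- by apply: measurable_funTS; apply/measurable_EFinP; exact: measurable_vexp_comp.
- by move=> x _; rewrite lee_fin vexp_ge0.
Qed.

Lemma mixes_elem_sub (B : elem m) : (forall i, el_set (e := B) i `<=` D) ->
  mixes P Y (fun w => cos (el_int W B w)) /\ mixes P Y (fun w => sin (el_int W B w)).
Proof.
move=> BD.
have cb : 4 * Num.sqrt (1 - expR (- 2 * massD h)) @[h --> \oo] --> (0 : R).
  have c0 : 4 * Num.sqrt (1 - expR (- 2 * massD h)) @[h --> \oo] -->
      4 * Num.sqrt (1 - expR (- 2 * 0)).
    apply: cvgMl_tmp; apply: (@cvg_comp _ _ _ _ Num.sqrt); last exact: sqrt_continuous.
    apply: cvgB; first exact: cvg_cst.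
    apply: (@cvg_comp _ _ _ _ expR); last exact: continuous_expR.
    exact: cvgMl_tmp.
  by move: c0; rewrite mulr0 expR0 subrr sqrtr0 mulr0.
have to0 (u : nat -> R) : (forall h, `|u h| <= 4 * Num.sqrt (1 - expR (- 2 * massD h))) ->
    u h @[h --> \oo] --> (0 : R).
  move=> hu; apply/norm_cvg0P.
  apply: (squeeze_cvgr (f := fun=> 0) _ _ cb); last exact: cvg_cst.
  by apply: nearW => h; rewrite normr_ge0 hu.
have BD' i : el_set (e := el_scale (- 1) B) i `<=` D by exact: BD.
have NB : el_int W (el_scale (- 1) B) = fun w => - 1 * el_int W B w.
  by apply/funext => w; rewrite el_int_scale.
have dc := to0 _ (fun h => (decorrelate h BD).1).
have ds := to0 _ (fun h => (decorrelate h BD).2).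
have dcN := to0 _ (fun h => (decorrelate h BD').1).
have dsN := to0 _ (fun h => (decorrelate h BD').2).
rewrite NB in dcN dsN.
have half0 (u v : nat -> R) : u h @[h --> \oo] --> (0 : R) ->
    v h @[h --> \oo] --> (0 : R) -> (u h + v h) / 2 @[h --> \oo] --> (0 : R) /\
    (u h - v h) / 2 @[h --> \oo] --> (0 : R).
  move=> hu hv; split.
    rewrite -[X in _ --> X](mul0r 2^-1) -[X in X * _](addr0 0).
    by apply: cvgMr_tmp; exact: cvgD.
  rewrite -[X in _ --> X](mul0r 2^-1) -[X in X * _](subr0 0).
  by apply: cvgMr_tmp; exact: cvgB.
have C h := covE P (mi B) (mY h).
split; split.
- under eq_fun do rewrite (let: And4 h1 _ _ _ := C _ in h1).
  exact: (half0 _ _ dc dcN).1.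
- under eq_fun do rewrite (let: And4 _ _ _ h1 := C _ in h1).
  exact: (half0 _ _ ds dsN).1.
- under eq_fun do rewrite (let: And4 _ _ h1 _ := C _ in h1).
  exact: (half0 _ _ ds dsN).2.
- under eq_fun do rewrite (let: And4 _ h1 _ _ := C _ in h1).
  exact: (half0 _ _ dcN dc).2.
Qed.

End good_set.

Lemma exhausting_boxes : exists F : nat -> set V,
  [/\ forall N, measurable (F N) /\ (m (F N) < +oo)%E,
      forall v k N, (k <= N)%N -> F k v -> F N v & forall v, exists N, F N v].
Proof.
have [F0 F0T F0fin] := sigma_finiteT m.
have mF N : measurable (\big[setU/set0]_(i < N.+1) F0 i).
  by apply: bigsetU_measurable => i _; exact: (F0fin i).1.
exists (fun N => \big[setU/set0]_(i < N.+1) F0 i); split.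
- move=> N; split => //.
  elim: N {mF} => [|N IH]; first by rewrite big_ord_recr big_ord0 /= set0U; exact: (F0fin 0%N).2.
  rewrite big_ord_recr /=; apply: le_lt_trans (measureU2 _ _ _) _.
  + by apply: bigsetU_measurable => i _; exact: (F0fin i).1.
  + exact: (F0fin _).1.
  + by rewrite lte_add_pinfty// (F0fin _).2.
- move=> v k N kN; rewrite -!bigcup_mkord => -[i /= ik Fv]; exists i => //=.
  exact: leq_trans ik _.
- move=> v; have : setT v by []; rewrite F0T => -[i _ Fv]; exists i.
  by rewrite -bigcup_mkord; exists i => /=.
Qed.

Lemma good_exhaustion : exists (D : nat -> set E) (M : nat -> nat -> R),
  [/\ forall N, [/\ measurable (D N), (mu (D N) < +oo)%E &
        D N `<=` [set x | `|x.1| <= N%:R]],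
      forall x k N, (k <= N)%N -> D k x -> D N x,
      forall x, exists N, D N x &
      forall N h, {ae mu, forall x, D N x -> forall n,
        vexp (el_fun (e h n) x) x.2 <= M N h}].
Proof.
have [F [F1 F2 F3]] := exhausting_boxes.
pose box N : set E := `[- N%:R, N%:R]%classic `*` F N.
have mI N : measurable (`[- N%:R, N%:R]%classic : set (measurableTypeR R)).
  exact: measurable_itv.
have mbox N : measurable (box N) by apply: measurableX => //; exact: (F1 N).1.
have box_fin N : (mu (box N) < +oo)%E.
  rewrite product_measure1E//; last exact: (F1 N).1.
  have lI : lebesgue_measure (`[- N%:R, N%:R]%classic : set (measurableTypeR R))
      \is a fin_num.
    by rewrite lebesgue_measure_itv/=; case: ifP => // _; rewrite -EFinB.
  by rewrite lte_mul_pinfty//; exact: (F1 N).2.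
have box_nd x k N : (k <= N)%N -> box k x -> box N x.
  move=> kN [/=]; rewrite !in_itv/= => /andP[h1 h2] h3; split => /=; last exact: F2 h3.
  rewrite in_itv/=; have kN' : k%:R <= N%:R :> R by rewrite ler_nat.
  by rewrite (le_trans _ h1) ?(le_trans h2)// lerN2.
have box_cover x : exists N, box N x.
  have [N FN] := F3 x.2; pose K := (Num.trunc `|x.1|).+1.
  have xK : `|x.1| <= K%:R by rewrite ltW// truncnS_gt.
  exists (maxn K N); split => /=; last by apply: F2 FN; exact: leq_maxr.
  have KN : K%:R <= (maxn K N)%:R :> R by rewrite ler_nat leq_maxl.
  by rewrite in_itv/= -ler_norml (le_trans xK).
pose b h n x := vexp (el_fun (e h n) x) x.2.
have mb h n : measurable_fun setT (b h n) by exact: measurable_vexp_el_fun.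
have b_bounded h : {ae mu, forall x, exists K : R, forall n, b h n x <= K}.
  have [_ _ ec _] := hY h; apply: filterS ec => x hx.
  have /cvgP/cvg_seq_bounded[K [_ hK]] : b h n x @[n --> \oo] -->
      vexp (Phi (x.1 - h%:R, x.2)) x.2 by exact: gexp_cvg.
  exists (K + 1) => n; apply: le_trans (ler_norm _) _; apply: (hK (K + 1)) => //.
  by rewrite ltrDl.
have [D [M [D1 D2 D3 D4]]] := good_sets mbox box_fin box_nd box_cover mb b_bounded.
exists D, M; split => // N; split; first exact: (D1 N).1.
  apply: le_lt_trans (box_fin N); rewrite le_measure ?inE//; first exact: (D1 N).1.
  exact: (D1 N).2.
move=> x /(D1 N).2[/=]; rewrite in_itv/= => h _.
by rewrite ler_norml.
Qed.

(** Cutting [B] down to [D N] gives integrands already treated, and their integrals converge almost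
    surely as the [D N] increase. *)
Lemma mixes_elem (B : elem m) :
  mixes P Y (fun w => cos (el_int W B w)) /\ mixes P Y (fun w => sin (el_int W B w)).
Proof.
have [D [M [D1 D2 D3 D4]]] := good_exhaustion.
have mD N : measurable (D N) by case: (D1 N).
pose BN N := el_restrict (mD N) B.
have mixN N : mixes P Y (fun w => cos (el_int W (BN N) w)) /\
              mixes P Y (fun w => sin (el_int W (BN N) w)).
  have [_ D_fin D_sub] := D1 N.
  by apply: (mixes_elem_sub (mD N) D_fin D_sub (D4 N)) => i; exact: subIsetr.
have cvgB : {ae P, forall w, el_int W (BN N) w @[N --> \oo] --> el_int W B w}.
  have h i : {ae P, forall w, W (el_set (e := B) i `&` D N) w @[N --> \oo] -->
      W (el_set (e := B) i) w}.
    (* The [D N] cover every point, not merely almost every one, so the union is the set itself and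
       no comparison of [W] on sets differing by a null set is called for. *)
    have U : \bigcup_N (el_set (e := B) i `&` D N) = el_set (e := B) i.
      rewrite -setI_bigcupr; apply/setIidPl => x _.
      by have [N DN] := D3 x; exists N.
    rewrite -[X in W X](U); apply: W_cvg_nondecreasing.
    + move=> N; apply: measurableI => //; exact: rect_delta_ring_measurable (el_setP i).
    + by move=> x k n kn [Cx Dx]; split => //; exact: D2 Dx.
    + by rewrite U; exact: el_setP.
  have : {ae P, forall w, forall i, W (el_set (e := B) i `&` D N) w @[N --> \oo] -->
      W (el_set (e := B) i) w} by exact: filter_forall.
  apply: filterS => w hw; rewrite /el_int.
  apply: cvg_big => [||i _]; [exact: add_continuous|exact: _|].
  by apply: cvgMl_tmp; exact: hw.
split.
- apply: (mixes_L1 (zn := fun N w => cos (el_int W (BN N) w)) mY).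
  + by move=> N; exact: bounded_meas_cos.
  + exact: bounded_meas_cos.
  + apply: (cvg_L1_ae (M := 1)).
    * by move=> N; exact: measurable_cos.
    * exact: measurable_cos.
    * by move=> N w; exact: cos_max.
    * by move=> w; exact: cos_max.
    * by apply: filterS cvgB => w h; apply: (cvg_comp _ _ h); exact: continuous_cos.
  + by move=> N; exact: (mixN N).1.
- apply: (mixes_L1 (zn := fun N w => sin (el_int W (BN N) w)) mY).
  + by move=> N; exact: bounded_meas_sin.
  + exact: bounded_meas_sin.
  + apply: (cvg_L1_ae (M := 1)).
    * by move=> N; exact: measurable_sin.
    * exact: measurable_sin.
    * by move=> N w; exact: sin_max.
    * by move=> w; exact: sin_max.
    * by apply: filterS cvgB => w h; apply: (cvg_comp _ _ h); exact: continuous_sin.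
  + by move=> N; exact: (mixN N).2.
Qed.

Lemma mixes_approx_integral (psi : E -> R) (Z : T -> R) (f : nat -> elem m) :
  approx_integral W psi Z f ->
  mixes P Y (fun w => cos (Z w)) /\ mixes P Y (fun w => sin (Z w)).
Proof.
move=> [_ mZ _ fZ]; split.
- apply: (mixes_L1 (zn := fun n w => cos (el_int W (f n) w)) mY).
  + by move=> n; exact: bounded_meas_cos.
  + exact: bounded_meas_cos.
  + apply: cvg_in_prob_L1 => //.
    * by apply: continuous_measurable_fun; exact: continuous_cos.
    * exact: cos_max.
    * exact: norm_cosB_le.
  + by move=> n; exact: (mixes_elem (f n)).1.
- apply: (mixes_L1 (zn := fun n w => sin (el_int W (f n) w)) mY).
  + by move=> n; exact: bounded_meas_sin.
  + exact: bounded_meas_sin.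
  + apply: cvg_in_prob_L1 => //.
    * by apply: continuous_measurable_fun; exact: continuous_sin.
    * exact: sin_max.
    * exact: norm_sinB_le.
  + by move=> n; exact: (mixes_elem (f n)).2.
Qed.

End mixing.

(** * From trigonometric polynomials to events *)

Lemma bernoulli_le (R : realType) (x : R) (N : nat) : -1 <= x -> 1 + N%:R * x <= (1 + x) ^+ N.
Proof.
move=> x1; elim: N => [|N IH]; first by rewrite mul0r addr0 expr0.
have x0 : 0 <= 1 + x by lra.
rewrite exprS; apply: le_trans (ler_wpM2l x0 IH).
rewrite -natr1 mulrDl mul1r !mulrDl !mul1r mulrDr mulr1.
have : 0 <= x * (N%:R * x) by rewrite mulrCA mulr_ge0// -expr2 sqr_ge0.
by move=> h; lra.
Qed.

Lemma cvg_natM_geometric (R : realType) (r : R) : 0 <= r < 1 ->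
  (n%:R * r ^+ n : R) @[n --> \oo] --> (0 : R).
Proof.
move=> /andP[r0 r1].
have [->|rn0] := eqVneq r 0.
  apply: cvg_near_cst; near=> n.
  have n0 : (0 < n)%N by near: n; exact: nbhs_infty_gt.
  by rewrite expr0n gtn_eqF// mulr0.
have rp : 0 < r by rewrite lt_neqAle eq_sym rn0.
(* Half of the decay pays for the factor n: writing 1/s = 1 + a, Bernoulli gives n s^n <= 1/a, and
   the other s^n tends to 0. *)
pose s := Num.sqrt r.
have s0 : 0 < s by rewrite sqrtr_gt0.
have s1 : s < 1 by rewrite -(sqrtr1 R) ltr_sqrt.
have ss : s ^+ 2 = r by rewrite sqr_sqrtr.
pose a := s^-1 - 1.
have a0 : 0 < a by rewrite subr_gt0 invf_gt1.
apply: (squeeze_cvgr (f := fun=> 0) (h := fun n => a^-1 * s ^+ n)).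
- apply: nearW => n; rewrite mulr_ge0//=; last by rewrite exprn_ge0.
  rewrite -ss -exprM mulnC exprM expr2 mulrA ler_wpM2r ?exprn_ge0 ?(ltW s0)//.
  rewrite -(ler_pM2r a0) mulVf ?gt_eqF// mulrAC.
  rewrite -ler_pdivlMr ?exprn_gt0// div1r -exprVn.
  have a1 : -1 <= a by rewrite (le_trans _ (ltW a0))// oppr_le0.
  have := bernoulli_le n a1; rewrite (_ : 1 + a = s^-1); last by rewrite /a; ring.
  by apply: le_trans; rewrite addrC lerDl.
- exact: cvg_cst.
- rewrite -[X in _ --> X](mulr0 a^-1); apply: cvgMl_tmp.
  by apply: cvg_expr; rewrite gtr0_norm.
Unshelve. all: by end_near.
Qed.

(* The Brosowski-Deutsch polynomials, which separate the two sides of [1/2]. *)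
Lemma cvg_half_threshold (R : realType) (q : R) : 0 <= q <= 1 ->
  ((1 - q ^+ n) ^+ (n * 2 ^ n) : R) @[n --> \oo] --> ((q < 1 / 2)%R%:R : R).
Proof.
move=> /andP[q0 q1].
have qn0 n : 0 <= q ^+ n by rewrite exprn_ge0.
have qn1 n : q ^+ n <= 1 by rewrite exprn_ile1.
have [qlt|qge] := ltP q (1 / 2).
  (* Bernoulli with exponent n 2^n bounds the value from below by 1 - n (2q)^n. *)
  apply: (squeeze_cvgr (f := fun n => 1 - n%:R * (2 * q) ^+ n) (h := fun=> 1)).
  - apply: nearW => n; apply/andP; split; last first.
      by rewrite exprn_ile1// ?subr_ge0// lerBlDr lerDl.
    have := @bernoulli_le R (- q ^+ n) (n * 2 ^ n); rewrite lerN2 => /(_ (qn1 n)).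
    apply: le_trans; rewrite mulrN natrM natrX exprMn.
    by rewrite mulrA.
  - rewrite -[X in _ --> X](subr0 1); apply: cvgB; first exact: cvg_cst.
    by apply: cvg_natM_geometric; apply/andP; split; lra.
  - exact: cvg_cst.
(* Since (1 - q^n)(1 + q^n) <= 1, the value is at most the inverse of (1 + q^n)^(n 2^n) >= 1 + n
   (2q)^n >= n + 1. The factor n in the exponent is what sends the boundary case q = 1/2 to 0. *)
apply: (squeeze_cvgr (f := fun=> 0) (h := fun n => n.+1%:R^-1)).
- apply: nearW => n; rewrite exprn_ge0 ?subr_ge0//=.
  set N := (n * 2 ^ n)%N.
  have h1 : n.+1%:R <= (1 + q ^+ n) ^+ N.
    have q1' : -1 <= q ^+ n by rewrite (le_trans _ (qn0 n))// oppr_le0.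
    apply: le_trans (bernoulli_le N q1').
    rewrite -natr1 addrC lerD2l natrM natrX -mulrA -exprMn ler_peMr//.
    by rewrite exprn_ege1//; lra.
  have h2 : (1 - q ^+ n) ^+ N * (1 + q ^+ n) ^+ N <= 1.
    rewrite -exprMn exprn_ile1//.
      by rewrite mulr_ge0 ?subr_ge0// addr_ge0.
    by rewrite -subr_sqr expr1n lerBlDr lerDl sqr_ge0.
  rewrite -[leRHS]mul1r ler_pdivlMr ?ltr0n//; apply: le_trans h2.
  by rewrite ler_wpM2l// exprn_ge0// subr_ge0.
- exact: cvg_cst.
- exact: cvg_harmonic.
Qed.

(** * Function classes containing the trigonometric polynomials *)

Section trigonometric_class.
Context (R : realType) (U I : Type) (X : I -> U -> R).

Definition lcomb (s : seq (R * I)) (u : U) : R := \sum_(p <- s) p.1 * X p.2 u.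

Lemma lcomb_cat s t u : lcomb (s ++ t) u = lcomb s u + lcomb t u.
Proof. by rewrite /lcomb big_cat. Qed.

Definition lopp (s : seq (R * I)) := [seq (- p.1, p.2) | p <- s].

Lemma lcomb_opp s u : lcomb (lopp s) u = - lcomb s u.
Proof.
by rewrite /lcomb big_map -sumrN; apply: eq_bigr => p _; rewrite mulNr.
Qed.

Variable K : (U -> R) -> Prop.
Hypothesis K_lin : forall (a : R) f g, K f -> K g -> K (fun u => a * f u + g u).
Hypothesis K_lim : forall (f_ : nat -> U -> R) f (M : R), (forall n, K (f_ n)) ->
  (forall n u, `|f_ n u| <= M) -> (forall u, f_ n u @[n --> \oo] --> f u) -> K f.
Hypothesis K_cos : forall s, K (fun u => cos (lcomb s u)).
Hypothesis K_sin : forall s, K (fun u => sin (lcomb s u)).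

Let tame (f : U -> R) := exists M : R, forall u, `|f u| <= M.

(** [K_cos] and [K_sin] say that the constant 1 has this property; applying a multiplier to it
    yields members of [K]. *)
Let stab (psi : U -> R) := tame psi /\
  forall s, K (fun u => psi u * cos (lcomb s u)) /\
            K (fun u => psi u * sin (lcomb s u)).

(* The multipliers of the class. Since they form an algebra, there is no need
   to work with products of test functions in [K] itself. *)
Let Q (q : U -> R) := tame q /\ forall psi, stab psi -> stab (fun u => psi u * q u).

Let tameM f g : tame f -> tame g -> tame (fun u => f u * g u).
Proof. by move=> [M fM] [N gN]; exists (M * N) => u; rewrite normrM ler_pM. Qed.

Let tameL a f g : tame f -> tame g -> tame (fun u => a * f u + g u).
Proof.
move=> [M fM] [N gN]; exists (`|a| * M + N) => u.
by rewrite (le_trans (ler_normD _ _))// lerD// normrM ler_wpM2l.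
Qed.

Let stabL a f g : stab f -> stab g -> stab (fun u => a * f u + g u).
Proof.
move=> [tf Kf] [tg Kg]; split; first exact: tameL.
move=> s; split.
- have := K_lin a (Kf s).1 (Kg s).1.
  by congr K; apply/funext => u; rewrite mulrDl mulrA.
- have := K_lin a (Kf s).2 (Kg s).2.
  by congr K; apply/funext => u; rewrite mulrDl mulrA.
Qed.

Let QL a f g : Q f -> Q g -> Q (fun u => a * f u + g u).
Proof.
move=> [tf Qf] [tg Qg]; split; first exact: tameL.
move=> psi sp; have := stabL a (Qf _ sp) (Qg _ sp).
by congr stab; apply/funext => u; rewrite mulrDr mulrCA.
Qed.

Let QM f g : Q f -> Q g -> Q (fun u => f u * g u).
Proof.
move=> [tf Qf] [tg Qg]; split; first exact: tameM.
move=> psi sp; have := Qg _ (Qf _ sp).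
by congr stab; apply/funext => u; rewrite mulrA.
Qed.

Let Qlim (f_ : nat -> U -> R) f (M : R) : (forall n, Q (f_ n)) ->
  (forall n u, `|f_ n u| <= M) -> (forall u, f_ n u @[n --> \oo] --> f u) -> Q f.
Proof.
move=> Qf fM fc.
have fM' u : `|f u| <= M.
  have h : `|f_ n u| @[n --> \oo] --> `|f u| by exact: cvg_norm.
  have h' : M @[_ --> \oo] --> M by exact: cvg_cst.
  by apply: (ler_cvg_to h h'); apply: nearW => n; exact: fM.
split; first by exists M.
move=> psi sp; have [[N pN] Kp] := sp; split; first by apply: tameM; [exists N|exists M].
move=> s; split.
- apply: (K_lim (f_ := fun n u => psi u * f_ n u * cos (lcomb s u)) (M := N * M)).
  + by move=> n; have [_ h] := (Qf n).2 _ sp; exact: (h s).1.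
  + move=> n u; rewrite -[leRHS]mulr1 normrM ler_pM ?cos_max//.
    by rewrite normrM ler_pM.
  + by move=> u; apply: cvgMr_tmp; exact: cvgMl_tmp.
- apply: (K_lim (f_ := fun n u => psi u * f_ n u * sin (lcomb s u)) (M := N * M)).
  + by move=> n; have [_ h] := (Qf n).2 _ sp; exact: (h s).2.
  + move=> n u; rewrite -[leRHS]mulr1 normrM ler_pM ?sin_max//.
    by rewrite normrM ler_pM.
  + by move=> u; apply: cvgMr_tmp; exact: cvgMl_tmp.
Qed.

Let half (f g h : U -> R) (a b : R) : K f -> K g ->
  (forall u, h u = a * f u + b * g u) -> K h.
Proof.
move=> Kf Kg hE; have K0 : K (fun=> 0).
  by have := K_sin [::]; congr K; apply/funext => u; rewrite /lcomb big_nil sin0.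
have := K_lin a Kf (K_lin b Kg K0).
by congr K; apply/funext => u; rewrite hE addr0.
Qed.

(** Product-to-sum formulas: the combinations [t ++ s] and [t ++ lopp s] are the sum and the
    difference of the two angles. *)
Let Qcos t : Q (fun u => cos (lcomb t u)).
Proof.
split; first by exists 1 => u; exact: cos_max.
move=> psi [tp Kp]; split.
  by apply: tameM => //; exists 1 => u; exact: cos_max.
move=> s; split.
- apply: (half (a := 1 / 2) (b := 1 / 2) (Kp (t ++ s)).1 (Kp (t ++ lopp s)).1) => u.
  by rewrite !lcomb_cat lcomb_opp !cosD cosN sinN; field.
- apply: (half (a := 1 / 2) (b := - (1 / 2)) (Kp (t ++ s)).2 (Kp (t ++ lopp s)).2) => u.
  by rewrite !lcomb_cat lcomb_opp !sinD cosN sinN; field.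
Qed.

Let Qsin t : Q (fun u => sin (lcomb t u)).
Proof.
split; first by exists 1 => u; exact: sin_max.
move=> psi [tp Kp]; split.
  by apply: tameM => //; exists 1 => u; exact: sin_max.
move=> s; split.
- apply: (half (a := 1 / 2) (b := 1 / 2) (Kp (t ++ s)).2 (Kp (t ++ lopp s)).2) => u.
  by rewrite !lcomb_cat lcomb_opp !sinD cosN sinN; field.
- apply: (half (a := - (1 / 2)) (b := 1 / 2) (Kp (t ++ s)).1 (Kp (t ++ lopp s)).1) => u.
  by rewrite !lcomb_cat lcomb_opp !cosD cosN sinN; field.
Qed.

Let Q1 : Q (fun=> 1).
Proof.
by have := Qcos [::]; congr Q; apply/funext => u; rewrite /lcomb big_nil cos0.
Qed.

Let Q0 : Q (fun=> 0).
Proof.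
by have := Qsin [::]; congr Q; apply/funext => u; rewrite /lcomb big_nil sin0.
Qed.

Let Qcst c : Q (fun=> c).
Proof. by have := QL c Q1 Q0; congr Q; apply/funext => u; rewrite mulr1 addr0. Qed.

Let Qexp f n : Q f -> Q (fun u => f u ^+ n).
Proof.
move=> Qf; elim: n => [|n IH]; first by under eq_fun do rewrite expr0.
by under eq_fun do rewrite exprS; exact: QM.
Qed.

Let Q1B f : Q f -> Q (fun u => 1 - f u).
Proof.
by move=> Qf; have := QL (- 1) Qf Q1; congr Q; apply/funext => u; rewrite mulN1r addrC.
Qed.

Let Q_lt_half q : Q q -> (forall u, 0 <= q u <= 1) ->
  Q (fun u => (q u < 1 / 2)%R%:R).
Proof.
move=> Qq q01.
apply: (Qlim (f_ := fun n u => (1 - q u ^+ n) ^+ (n * 2 ^ n)) (M := 1)).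
- by move=> n; apply: Qexp; apply: Q1B; exact: Qexp.
- move=> n u; have /andP[q0 q1] := q01 u.
  have h0 : 0 <= 1 - q u ^+ n by rewrite subr_ge0 exprn_ile1.
  rewrite ger0_norm ?exprn_ge0// exprn_ile1//.
  by rewrite lerBlDr lerDl exprn_ge0.
- by move=> u; exact: cvg_half_threshold.
Qed.

(** The sine brings the unbounded coordinate into the range of [Q_lt_half]. As soon as |X - c| / (n
    + 1) is below 2, hence below pi, the sine has the sign of X - c, so the approximating indicator
    is eventually the right one. *)
Let Q_lt t c : Q (fun u => (X t u < c)%R%:R).
Proof.
apply: (Qlim (f_ := fun n u => (((1 + sin ((X t u - c) / n.+1%:R)) / 2) < 1 / 2)%R%:R)
  (M := 1)).
- move=> n; apply: (Q_lt_half (q := fun u => (1 + sin ((X t u - c) / n.+1%:R)) / 2)).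
  + have h (u : U) : (1 + sin ((X t u - c) / n.+1%:R)) / 2 =
        (cos (c / n.+1%:R) / 2) * sin (lcomb [:: (n.+1%:R^-1, t)] u) +
        ((- sin (c / n.+1%:R) / 2) * cos (lcomb [:: (n.+1%:R^-1, t)] u) + 1 / 2).
      by rewrite /lcomb big_seq1 /= mulrBl sinB [_ * X t u]mulrC; field.
    by under eq_fun do rewrite h; apply: QL => //; exact: QL.
  + move=> u; have := sin_geN1 ((X t u - c) / n.+1%:R).
    by have := sin_le1 ((X t u - c) / n.+1%:R); move=> ? ?; apply/andP; split; lra.
- by move=> n u; case: (_ < _); rewrite ?normr1 ?normr0.
- move=> u; apply: cvg_near_cst; near=> n.
  pose z := X t u - c.
  have zn : `|z / n.+1%:R| < 2.
    rewrite normrM [X in _ * X]gtr0_norm ?invr_gt0// ltr_pdivrMr//.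
    rewrite (@lt_trans _ _ n%:R)//; first by near: n; exact: nbhs_infty_gtr.
    by rewrite mulr_natl mulr2n -natr1; have : 0 <= n%:R :> R by []; lra.
  have pi2 := pi_ge2 R.
  have eq1 : ((1 + sin (z / n.+1%:R)) / 2 < 1 / 2) = (sin (z / n.+1%:R) < 0).
    by apply/idP/idP => ?; lra.
  have eq2 : (X t u < c) = (z < 0) by rewrite subr_lt0.
  rewrite eq1 eq2; congr (nat_of_bool _)%:R.
  have ipos : 0 < n.+1%:R^-1 :> R by rewrite invr_gt0.
  move: zn; rewrite ltr_norml => /andP[zn1 zn2].
  have [z0|z0|z0] := ltgtP z 0.
  + have : 0 < sin (- (z / n.+1%:R)).
      apply: sin_gt0_pi; rewrite oppr_gt0 pmulr_llt0// z0/= ltrNl.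
      by rewrite (le_lt_trans _ zn1)// lerN2.
    by rewrite sinN oppr_gt0.
  + apply/negbTE; rewrite -leNgt ltW// sin_gt0_pi// mulr_gt0//=.
    exact: lt_le_trans zn2 pi2.
  + by rewrite z0 mul0r sin0 ltxx.
Unshelve. all: by end_near.
Qed.

Definition coord_system : set (set U) :=
  [set A | exists t (B : set R), measurable B /\ A = X t @^-1` B].

Let QsigmaC A : Q (\1_A) -> Q (\1_(~` A)).
Proof.
move=> QA; have := Q1B QA; congr Q; apply/funext => u.
by rewrite !indicE in_setC; case: (u \in A); rewrite ?subrr ?subr0.
Qed.

Let QsigmaI A B : Q (\1_A) -> Q (\1_B) -> Q (\1_(A `&` B)).
Proof.
by move=> QA QB; have := QM QA QB; congr Q; apply/funext => u; rewrite indicI.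
Qed.

Let Qsigma_bigcup (F : nat -> set U) : (forall n, Q (\1_(F n))) ->
  Q (\1_(\bigcup_n F n)).
Proof.
move=> QF.
have QU n : Q (\1_(\big[setU/set0]_(i < n) F i)).
  elim: n => [|n IH].
    by rewrite big_ord0; have := Q0; congr Q; apply/funext => u; rewrite indic0.
  rewrite big_ord_recr /= -[X in \1_X]setCK; apply: QsigmaC.
  by rewrite setCU; apply: QsigmaI; exact: QsigmaC.
apply: (Qlim (f_ := fun n => \1_(\big[setU/set0]_(i < n) F i)) (M := 1)) => //.
  by move=> n u; rewrite indicE; case: (_ \in _); rewrite ?normr1 ?normr0.
move=> u; have [[k _ Fku]|nFu] := pselect ((\bigcup_n F n) u).
  apply: cvg_near_cst; exists k.+1 => // n /= kn; rewrite !indicE !mem_set//.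
    by exists k.
  by rewrite -bigcup_mkord; exists k.
apply: cvg_near_cst; apply: nearW => n; rewrite !indicE !memNset//.
by rewrite -bigcup_mkord => -[k _ Fku]; apply: nFu; exists k.
Qed.

(** The sets whose indicators are multipliers form a sigma-algebra, and by [Q_lt] it contains the
    preimages of the half-lines that generate the Borel sets. *)
Lemma trigonometric_class (A : set U) : <<s coord_system >> A ->
  forall s, K (fun u => \1_A u * cos (lcomb s u)) /\
            K (fun u => \1_A u * sin (lcomb s u)).
Proof.
move=> sA.
have QA : Q (\1_A).
  move: A sA; apply: smallest_sub.
    split.
    - by have := Q0; congr Q; apply/funext => u; rewrite indic0.
    - by move=> A QA; rewrite setTD; exact: QsigmaC.
    - by move=> F QF; exact: Qsigma_bigcup.
  move=> _ [t [B [mB ->]]].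
  have mB' : (@RGenInftyO.G R).-sigma.-measurable B by rewrite -RGenInftyO.measurableE.
  have : <<s @RGenInftyO.G R >> B by exact: mB'.
  move: B {mB mB'}; apply: smallest_sub.
    split.
    - by have := Q0; congr Q; apply/funext => u; rewrite /= preimage_set0 indic0.
    - by move=> B QB /=; rewrite setTD preimage_setC; exact: QsigmaC.
    - by move=> F QF /=; rewrite preimage_bigcup; exact: Qsigma_bigcup.
  move=> _ [c ->] /=; have := Q_lt t c; congr Q; apply/funext => u.
  rewrite indicE; congr (nat_of_bool _)%:R; apply/idP/idP => [h|/set_mem].
    by apply/mem_set; rewrite /= in_itv.
  by rewrite /= in_itv.
move=> s; split.
- have := QM QA (Qcos s) => -[_ h].
  have s1 : stab (fun=> 1).
    split; first by exists 1 => u; rewrite normr1.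
    move=> s'; split.
    + by under eq_fun do rewrite mul1r.
    + by under eq_fun do rewrite mul1r.
  have [_ /(_ [::])[+ _]] := h _ s1.
  by congr K; apply/funext => u; rewrite /lcomb big_nil cos0 mulr1 mul1r.
- have := QM QA (Qsin s) => -[_ h].
  have s1 : stab (fun=> 1).
    split; first by exists 1 => u; rewrite normr1.
    move=> s'; split.
    + by under eq_fun do rewrite mul1r.
    + by under eq_fun do rewrite mul1r.
  have [_ /(_ [::])[+ _]] := h _ s1.
  by congr K; apply/funext => u; rewrite /lcomb big_nil cos0 mulr1 mul1r.
Qed.

End trigonometric_class.

(** * Variation along dyadic grids *)

Section dyadic_variation.
Context (R : realType).
Implicit Types (x y : R -> R).

(** The grid of mesh 2^-k on [-n, n]: index 0 is -n and index 2 n 2^k is n. *)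
Definition dyadic_point (n k i : nat) : R := i%:R / 2 ^+ k - n%:R.

Definition dyadic_var (n k : nat) (y : R -> R) : R :=
  \sum_(0 <= i < 2 * n * 2 ^ k)
    `|y (dyadic_point n k i.+1) - y (dyadic_point n k i)|.

(** Bounded variation read off from countably many coordinates. The bound is a natural number so
    that the set is built by countable operations. *)
Definition dyadic_BV : set (R -> R) :=
  [set y | forall n, exists M : nat, forall k, dyadic_var n k y <= M%:R].

Definition coord (t : R) (y : R -> R) : R := y t.

Lemma dyadic_BV_measurable : <<s coord_system coord >> dyadic_BV.
Proof.
pose G := coord_system coord.
suff : measurable (dyadic_BV : set (g_sigma_algebraType G)) by [].
have -> : dyadic_BV = \bigcap_n \bigcup_(M : nat) \bigcap_k
    [set y | dyadic_var n k y <= M%:R].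
  apply/seteqP; split => y.
    by move=> hy n _; have [M hM] := hy n; exists M => // k _; exact: hM.
  by move=> hy n; have [M _ hM] := hy n Logic.I; exists M => k; exact: hM.
apply: bigcapT_measurable => n; apply: bigcupT_measurable => M.
apply: bigcapT_measurable => k.
have mc t : measurable_fun setT (fun y : g_sigma_algebraType G => coord t y).
  move=> _ B mB; rewrite setTI; apply: sub_sigma_algebra; exists t, B; split => //.
have mV : measurable_fun setT (fun y : g_sigma_algebraType G => dyadic_var n k y).
  apply: measurable_sum => i; apply: measurableT_comp => //.
  apply: measurable_funB; exact: mc.
rewrite -[X in measurable X]setTI.
by apply: (measurable_fun_le (g := cst M%:R)).
Qed.

Lemma dyadic_point_addl n h k i :
  dyadic_point (n + h) k (i + 2 * h * 2 ^ k) = dyadic_point n k i + h%:R.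
Proof.
rewrite /dyadic_point !natrD !natrM natrX; field.
by rewrite expf_neq0.
Qed.

Lemma dyadic_point_addr n h k i :
  dyadic_point (n + h) k i + h%:R = dyadic_point n k i.
Proof. by rewrite /dyadic_point natrD; ring. Qed.

(** The constant cancels in differences. At the same level [k], the grid of [-n, n] is a block of
    consecutive points of the grid of [-(n+h), n+h] after translation: the initial block in one
    direction, the final block in the other. *)
Lemma dyadic_BV_shift x (h : nat) (c : R) :
  dyadic_BV (fun t => x (t + h%:R) - c) <-> dyadic_BV x.
Proof.
have canc n k i : x (dyadic_point n k i.+1 + h%:R) - c - (x (dyadic_point n k i + h%:R) - c) =
    x (dyadic_point n k i.+1 + h%:R) - x (dyadic_point n k i + h%:R) by ring.
split=> hx n.
- have [M hM] := hx (n + h)%N; exists M => k; apply: le_trans (hM k).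
  rewrite /dyadic_var [leRHS](eq_bigr (fun i =>
    `|x (dyadic_point n k i.+1) - x (dyadic_point n k i)|)); last first.
    by move=> i _; rewrite canc !dyadic_point_addr.
  have le : (2 * n * 2 ^ k <= 2 * (n + h) * 2 ^ k)%N.
    by rewrite leq_mul2r leq_mul2l leq_addr !orbT.
  by rewrite [leRHS](big_cat_nat (leq0n _) le)/= lerDl sumr_ge0.
- have [M hM] := hx (n + h)%N; exists M => k; apply: le_trans (hM k).
  rewrite /dyadic_var.
  have e1 : (2 * (n + h) * 2 ^ k = 2 * n * 2 ^ k + 2 * h * 2 ^ k)%N by ring.
  have le : (2 * h * 2 ^ k <= 2 * (n + h) * 2 ^ k)%N by rewrite e1 leq_addl.
  rewrite [leRHS](big_cat_nat (leq0n _) le)/= -[leLHS]add0r lerD ?sumr_ge0//.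
  rewrite -[X in _ <= \sum_(X <= _ < _) _]add0n big_addn e1 addnK.
  apply: ler_sum => i _; rewrite canc -!dyadic_point_addl addSn.
  exact: lexx.
Qed.

Lemma dyadic_BV_total_variation x :
  (forall a b, a < b -> (total_variation a b x < +oo)%E) -> dyadic_BV x.
Proof.
move=> hx n; have [->|n0] := eqVneq n 0%N.
  by exists 0%N => k; rewrite /dyadic_var muln0 mul0n big_nil.
have nn : - n%:R < n%:R :> R.
  by rewrite -subr_gt0 opprK addr_gt0// ltr0n lt0n.
have TVfin := hx _ _ nn.
have [M TVM] : exists M : nat, (total_variation (- n%:R) n%:R x <= M%:R%:E)%E.
  have TV0 := total_variation_ge0 x (ltW nn).
  exists (Num.trunc (fine (total_variation (- n%:R) n%:R x))).+1.
  rewrite -[leLHS]fineK; last by rewrite ge0_fin_numE.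
  by rewrite lee_fin ltW// truncnS_gt.
exists M => k; rewrite -lee_fin; apply: le_trans TVM.
pose N := (2 * n * 2 ^ k)%N.
pose s := [seq dyadic_point n k i | i <- iota 1 N].
have p0 : dyadic_point n k 0 = - n%:R by rewrite /dyadic_point mul0r sub0r.
have pN : dyadic_point n k N = n%:R.
  rewrite /dyadic_point /N !natrM natrX mulfK ?expf_neq0//; ring.
have nthE i : (i <= N)%N -> nth (n%:R) (- n%:R :: s) i = dyadic_point n k i.
  case: i => [|i] iN; first by rewrite -p0.
  by rewrite /= (nth_map 0%N) ?size_iota// nth_iota// add1n.
have szs : size s = N by rewrite size_map size_iota.
have part : itv_partition (- n%:R) n%:R s.
  split.
    apply/(pathP n%:R) => i; rewrite szs => iN.
    have -> : nth n%:R s i = nth n%:R (- n%:R :: s) i.+1 by [].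
    rewrite !nthE//; last exact: ltnW.
    by rewrite /dyadic_point ltrD2r ltr_pM2r ?invr_gt0 ?exprn_gt0// ltr_nat.
  by rewrite (last_nth n%:R) szs nthE// pN.
apply: ereal_sup_ubound; exists (variation (- n%:R) n%:R x s).
  exact: variations_variation.
congr (_%:E); rewrite /variation szs /dyadic_var big_nat [RHS]big_nat.
by apply: eq_bigr => i /andP[_ iN] /=; rewrite -[nth _ s i]/(nth n%:R (- n%:R :: s) i.+1) !nthE// ltnW.
Qed.

Lemma telescope_norm_le (g : nat -> R) (a b : nat) : (a <= b)%N ->
  `|g b - g a| <= \sum_(a <= i < b) `|g i.+1 - g i|.
Proof.
move=> ab; rewrite -(telescope_sumr _ ab); exact: ler_norm_sum.
Qed.

Lemma subsampled_variation_le (g : nat -> R) (J : nat -> nat) (r : nat) :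
  (forall i, (i < r)%N -> (J i <= J i.+1)%N) ->
  \sum_(0 <= i < r) `|g (J i.+1) - g (J i)| <=
  \sum_(J 0%N <= j < J r) `|g j.+1 - g j|.
Proof.
elim: r => [|r IH] Jnd; first by rewrite !big_geq.
have JrS : (J r <= J r.+1)%N by exact: Jnd.
have J0r : (J 0%N <= J r)%N.
  elim: (r) (fun i (h : (i < r)%N) => Jnd i (leqW h)) => // r' IH' h.
  apply: (leq_trans (IH' _)) (h r' (ltnSn _)).
  by move=> i ir; apply: h; exact: leqW.
rewrite big_nat_recr//= (big_cat_nat J0r JrS)/= lerD//.
  by apply: IH => i ir; apply: Jnd; exact: leqW.
exact: telescope_norm_le.
Qed.

(** Finitely many dyadic numbers have a common denominator 2^k; adding [n] makes the numerators
    natural numbers, which are the indices on the grid. *)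
Lemma dyadic_common_level (n r : nat) (q : nat -> R) :
  (forall i, (i <= r)%N -> dyadic (q i)) ->
  (forall i, (i <= r)%N -> - n%:R <= q i <= n%:R) ->
  exists k (J : nat -> nat), forall i, (i <= r)%N ->
    q i = dyadic_point n k (J i) /\ (J i <= 2 * n * 2 ^ k)%N.
Proof.
move=> dq qn.
have [k hk] : exists k : nat, forall i, (i <= r)%N -> exists z : int, q i = z%:~R / 2 ^+ k.
  elim: r dq {qn} => [|r IH] dq.
    by have [z [k qz]] := dq 0%N (leqnn _); exists k => i; rewrite leqn0 => /eqP ->; exists z.
  have [k hk] := IH (fun i h => dq i (leqW h)).
  have [z [l qz]] := dq r.+1 (leqnn _).
  exists (k + l)%N => i; rewrite leq_eqVlt => /predU1P[->|ir].
    exists (z * 2 ^+ k); rewrite qz rmorphM rmorphXn /= exprD.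
    by field; rewrite !expf_neq0.
  have [y qy] := hk i ir; exists (y * 2 ^+ l); rewrite qy rmorphM rmorphXn /= exprD.
  by field; rewrite !expf_neq0.
exists k.
have hJ i : exists j : nat, (i <= r)%N -> q i = dyadic_point n k j /\ (j <= 2 * n * 2 ^ k)%N.
  have [ir|_] := leqP i r; last by exists 0%N.
  have [z qz] := hk i ir; have /andP[q1 q2] := qn i ir.
  have p0 : 0 < 2 ^+ k :> R by rewrite exprn_gt0.
  pose w := z + (n * 2 ^ k)%:Z.
  have wE : w%:~R = (q i + n%:R) * 2 ^+ k.
    rewrite /w rmorphD /= qz mulrDl divfK ?gt_eqF//; congr (_ + _).
    by rewrite -[LHS]/((n * 2 ^ k)%:R) natrM natrX.
  have w0 : 0 <= w by rewrite -(ler0z R) wE mulr_ge0 ?(ltW p0)// -lerBlDr sub0r.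
  exists `|w|%N => _.
  have aw : `|w|%:R = w%:~R :> R by rewrite -[in RHS](gez0_abs w0).
  split.
    by rewrite /dyadic_point aw wE mulfK ?gt_eqF// addrK.
  rewrite -(ler_nat R) aw wE !natrM natrX ler_pM2r//.
  by rewrite mulr_natl mulr2n lerD2r.
by have [J hJ'] := choice hJ; exists J => i; exact: hJ'.
Qed.

(** Separability replaces the points of a partition by nearby dyadic ones with nearby values. These
    are points of one dyadic grid, and refining to all of the grid only increases the sum. *)
Lemma total_variation_dyadic_BV x :
  (forall t, exists tn : nat -> R, [/\ forall n, dyadic (tn n),
     tn n @[n --> \oo] --> t & x (tn n) @[n --> \oo] --> x t]) ->
  dyadic_BV x -> forall a b, a < b -> (total_variation a b x < +oo)%E.
Proof.
move=> sep xBV a b ab.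
(* Here [n] is strictly larger than |a| and |b|, so that the partition points, endpoints included,
   can be moved without leaving [-n, n]. *)
pose n := (Num.trunc (Num.max `|a| `|b|)).+1.
have maxn : Num.max `|a| `|b| < n%:R by rewrite truncnS_gt.
have an : - n%:R < a.
  have : `|a| < n%:R by rewrite (le_lt_trans _ maxn)// le_max lexx.
  by rewrite ltr_norml => /andP[].
have bn : b < n%:R.
  have : `|b| < n%:R by rewrite (le_lt_trans _ maxn)// le_max lexx orbT.
  by rewrite ltr_norml => /andP[].
have [M hM] := xBV n.
apply: (@le_lt_trans _ _ M%:R%:E); last exact: ltry.
apply: ge_ereal_sup => _ [_ [s abs <-] <-]; rewrite lee_fin.
pose p := nth b (a :: s); pose r := size s.
have [path_s last_s] := abs.
have p_lt i : (i < r)%N -> p i < p i.+1 by move/(pathP b): path_s; apply.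
have p_range i : (i <= r)%N -> a <= p i <= b.
  move=> ir; have nd u v : (u <= v)%N -> (v <= r)%N -> p u <= p v.
    move=> uv vr; rewrite -(subnKC uv); move: vr; rewrite -{1}(subnKC uv).
    elim: (v - u)%N => [|l IH]; first by rewrite addn0.
    rewrite addnS => lr; apply: le_trans (IH (ltnW lr)) _; exact/ltW/p_lt.
  have -> : a = p 0%N by [].
  have -> : b = p r by rewrite /p /r -last_nth; exact/esym/eqP.
  by rewrite !nd.
(* A strict excess over [M] survives a small perturbation of the partition points, and so does their
   strict order. *)
rewrite /variation -/p -/r leNgt; apply/negP => hlt.
have [tn htn] := choice (fun i => sep (p i)).
have cv : \sum_(0 <= i < r) `|x (tn i.+1 l) - x (tn i l)| @[l --> \oo] -->
    \sum_(0 <= i < r) `|x (p i.+1) - x (p i)|.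
  apply: cvg_big => [|i _]; first exact: add_continuous.
  by apply: cvg_norm; apply: cvgB; [case: (htn i.+1)|case: (htn i)].
have ev1 : \forall l \near \oo, M%:R < \sum_(0 <= i < r) `|x (tn i.+1 l) - x (tn i l)|.
  exact: (cvgr_gt _ cv).
have ev2 : \forall l \near \oo, forall i : 'I_r, tn i l < tn i.+1 l.
  apply: filter_forall => i.
  have c : tn i.+1 l - tn i l @[l --> \oo] --> p i.+1 - p i.
    by apply: cvgB; [case: (htn i.+1)|case: (htn i)].
  have pi : 0 < p i.+1 - p i by rewrite subr_gt0 p_lt.
  have h : \forall l \near \oo, 0 < tn i.+1 l - tn i l by exact: (cvgr_gt _ c).
  by apply: filterS h => l; rewrite subr_gt0.
have ev3 : \forall l \near \oo, forall i : 'I_r.+1, - n%:R <= tn i l <= n%:R.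
  apply: filter_forall => i.
  have [_ c _] := htn i.
  have /andP[pa pb] := p_range i (ltn_ord i).
  have h1 : \forall l \near \oo, - n%:R < tn i l.
    by apply: (cvgr_gt _ c); exact: lt_le_trans pa.
  have h2 : \forall l \near \oo, tn i l < n%:R.
    by apply: (cvgr_lt _ c); exact: le_lt_trans bn.
  by apply: filterS2 h1 h2 => l h1 h2; rewrite !ltW.
near \oo => l.
have l1 : M%:R < \sum_(0 <= i < r) `|x (tn i.+1 l) - x (tn i l)| by near: l.
have l2 : forall i : 'I_r, tn i l < tn i.+1 l by near: l.
have l3 : forall i : 'I_r.+1, - n%:R <= tn i l <= n%:R by near: l.
have [k [J hJ]] := @dyadic_common_level n r (fun i => tn i l)
  (fun i _ => let: And3 h _ _ := htn i in h l)
  (fun i (ir : (i <= r)%N) => l3 (Ordinal (ir : (i < r.+1)%N))).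
move: l1; apply/negP; rewrite -leNgt; apply: le_trans (hM k).
pose g j := x (dyadic_point n k j).
rewrite (eq_big_nat _ _ (F2 := fun i => `|g (J i.+1) - g (J i)|)); last first.
  by move=> i /andP[_ ir]; rewrite /g (hJ i.+1 ir).1 (hJ i (ltnW ir)).1.
have Jnd i : (i < r)%N -> (J i <= J i.+1)%N.
  move=> ir; have := l2 (Ordinal ir) => /=.
  rewrite (hJ i.+1 ir).1 (hJ i (ltnW ir)).1 /dyadic_point ltrD2r.
  by rewrite ltr_pM2r ?invr_gt0 ?exprn_gt0// ltr_nat => /ltnW.
apply: (le_trans (subsampled_variation_le g Jnd)).
have JrN := (hJ r (leqnn _)).2.
have J0r : (J 0%N <= J r)%N.
  elim: (r) (fun i (h : (i < r)%N) => Jnd i h) => // r' IH' h.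
  apply: (leq_trans (IH' _)) (h r' (ltnSn _)).
  by move=> i ir; apply: h; exact: leqW.
rewrite /dyadic_var [leRHS](big_cat_nat (leq0n _) (leq_trans J0r JrN))/=.
rewrite (big_cat_nat J0r JrN)/= addrCA lerDl addr_ge0// sumr_ge0.
Unshelve. all: by end_near.
Qed.

End dyadic_variation.

(** * The zero-one law *)

Section same_law.
Context (R : realType) (d d2 : measure_display) (T : measurableType d)
  (U : measurableType d2) (P : probability T R).

Lemma Ex_same_law (Z Z' : T -> U) (g : U -> R) :
  measurable_fun setT Z -> measurable_fun setT Z' -> bounded_meas g ->
  (forall B, measurable B -> P (Z @^-1` B) = P (Z' @^-1` B)) ->
  Ex P (fun w => g (Z w)) = Ex P (fun w => g (Z' w)).
Proof.
move=> mZ mZ' [mg [M gM]] law.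
(* Adding [M] makes the integrand nonnegative, as the change of variables requires; it is removed at
   the end. *)
have gM0 u : 0 <= g u + M by have := gM u; rewrite ler_norml => /andP[? ?]; lra.
have mgM : measurable_fun setT (EFin \o (fun u => g u + M)).
  by apply/measurable_EFinP; exact: measurable_funD.
have push (Z0 : T -> U) : measurable_fun setT Z0 ->
    (\int[P]_w (g (Z0 w) + M)%:E = \int[pushforward P Z0]_u (g u + M)%:E)%E.
  move=> mZ0; rewrite (ge0_integral_pushforward mZ0 P measurableT mgM)//.
  by move=> u _; rewrite lee_fin.
have bZ (Z0 : T -> U) : measurable_fun setT Z0 -> bounded_meas (fun w => g (Z0 w)).
  by move=> mZ0; split; [exact: measurableT_comp|exists M].
have : Ex P (fun w => g (Z w) + M) = Ex P (fun w => g (Z' w) + M).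
  rewrite /Ex /Rintegral (push _ mZ) (push _ mZ'); congr fine.
  by apply: eq_measure_integral => B mB _; exact: law.
rewrite (ExD P (bZ _ mZ) (bounded_meas_cst _ M)) (ExD P (bZ _ mZ') (bounded_meas_cst _ M)).
exact: addIr.
Qed.

End same_law.

(** * Invariant events of the increment paths *)

Section increments.
Context (R : realType) (d : measure_display) (T : measurableType d)
  (P : probability T R) (X : R -> {RV P >-> R}).

(** The reference point moves with the shift: under stationary increments the finite-dimensional
    laws of this path are the same for all [h]. *)
Definition increment_path (h : nat) (w : T) : R -> R :=
  fun t => X (t + h%:R) w - X h%:R w.

Local Notation path := increment_path.
Local Notation lc := (lcomb (@coord R)).

Lemma measurable_increment h t : measurable_fun setT (fun w => path h w t).
Proof. exact: measurable_funB. Qed.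

Lemma measurable_lcomb_path h s : measurable_fun setT (fun w => lc s (path h w)).
Proof.
apply: measurable_sum => p; apply: measurable_funM => //; exact: measurable_increment.
Qed.

Lemma measurable_path_preimage h A : <<s coord_system (@coord R) >> A ->
  measurable (path h @^-1` A).
Proof.
move: A; suff : <<s coord_system (@coord R) >> `<=`
    [set A | measurable (path h @^-1` A)] by [].
apply: smallest_sub.
  split.
  - by rewrite /= preimage_set0.
  - by move=> A mA /=; rewrite setTD preimage_setC; exact: measurableC.
  - by move=> F mF /=; rewrite preimage_bigcup; exact: bigcupT_measurable.
move=> _ [t [B [mB ->]]] /=.
by rewrite -[X in measurable X]setTI; exact: measurable_increment.
Qed.

Hypothesis X_stat : stationary_increments P X.

Let Ex_trig h (g : R -> R) s : bounded_meas g ->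
  Ex P (fun w => g (lc s (path h w))) = Ex P (fun w => g (lc s (path 0 w))).
Proof.
move=> bg; pose n := size s.
pose t : n.-tuple R := [tuple (tnth (in_tuple s) i).2 | i < n].
pose Z (k : nat) (w : T) : n.-tuple R := [tuple path k w (tnth t i) | i < n].
pose G (v : n.-tuple R) : R := g (\sum_(i < n) (tnth (in_tuple s) i).1 * tnth v i).
have mZ k : measurable_fun setT (Z k).
  apply/measurable_fun_tnthP => i.
  rewrite (_ : _ \o _ = fun w => path k w (tnth t i)); first exact: measurable_increment.
  by apply/funext => w /=; rewrite tnth_mktuple.
have bG : bounded_meas G.
  have [mg [M gM]] := bg; split; last by exists M => v; exact: gM.
  apply: (measurableT_comp mg); apply: measurable_sum => i.
  by apply: measurable_funM => //; exact: measurable_tnth.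
have GE k w : g (lc s (path k w)) = G (Z k w).
  rewrite /G /lcomb (big_tnth _ _ s); congr g; apply: eq_bigr => i _.
  by rewrite !tnth_mktuple.
under eq_fun do rewrite GE; under [in RHS]eq_fun do rewrite GE.
apply: (Ex_same_law (mZ h) (mZ 0%N) bG) => B mB.
have := X_stat t h%:R mB.
have -> : [set w | B [tuple X (tnth t i + h%:R) w - X h%:R w | i < n]] = Z h @^-1` B by [].
move=> ->; congr (P _); apply/funext => w /=; congr (B _).
by apply: eq_from_tnth => i; rewrite !tnth_mktuple /increment_path addr0.
Qed.

(** [K] collects the functionals with the same expectation on both paths. Equality of the
    finite-dimensional laws puts the trigonometric ones in it, and the class argument adds the
    indicator of [A]. *)
Lemma Ex_path_shift h (A : set (R -> R)) s : <<s coord_system (@coord R) >> A ->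
  Ex P (fun w => \1_A (path h w) * cos (lc s (path h w))) =
  Ex P (fun w => \1_A (path 0 w) * cos (lc s (path 0 w))) /\
  Ex P (fun w => \1_A (path h w) * sin (lc s (path h w))) =
  Ex P (fun w => \1_A (path 0 w) * sin (lc s (path 0 w))).
Proof.
move=> sA.
pose K (q : (R -> R) -> R) := [/\ bounded_meas (fun w => q (path h w)),
  bounded_meas (fun w => q (path 0 w)) &
  Ex P (fun w => q (path h w)) = Ex P (fun w => q (path 0 w))].
have K_lin a f g : K f -> K g -> K (fun u => a * f u + g u).
  move=> [bf bf' ef] [bg bg' eg]; split.
  - by apply: bounded_measD => //; exact: bounded_measZ.
  - by apply: bounded_measD => //; exact: bounded_measZ.
  - rewrite (ExD P (bounded_measZ a bf) bg) (ExD P (bounded_measZ a bf') bg').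
    by rewrite (ExZ P a bf) (ExZ P a bf') ef eg.
have K_lim (f_ : nat -> (R -> R) -> R) f (M : R) : (forall n, K (f_ n)) ->
    (forall n u, `|f_ n u| <= M) -> (forall u, f_ n u @[n --> \oo] --> f u) -> K f.
  move=> Kf fM fc.
  have fM' u : `|f u| <= M.
    have c : `|f_ n u| @[n --> \oo] --> `|f u| by exact: cvg_norm.
    have c' : M @[_ --> \oo] --> M by exact: cvg_cst.
    by apply: (ler_cvg_to c c'); apply: nearW => n; exact: fM.
  have mf k : (forall n, measurable_fun setT (fun w => f_ n (path k w))) ->
      measurable_fun setT (fun w => f (path k w)).
    move=> mf_; apply: (measurable_fun_cvg (h := fun n w => f_ n (path k w))) => //.
  have mh : measurable_fun setT (fun w => f (path h w)).
    by apply: mf => n; have [[]] := Kf n.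
  have m0 : measurable_fun setT (fun w => f (path 0 w)).
    by apply: mf => n; have [_ []] := Kf n.
  split; [by split => //; exists M|by split => //; exists M|].
  have c1 : Ex P (fun w => f_ n (path h w)) @[n --> \oo] --> Ex P (fun w => f (path h w)).
    apply: (Ex_cvg (g_ := fun n w => f_ n (path h w)) (M := M)) => //.
      by move=> n; have [[]] := Kf n.
    by apply: aeW => w.
  have c2 : Ex P (fun w => f_ n (path 0 w)) @[n --> \oo] --> Ex P (fun w => f (path 0 w)).
    apply: (Ex_cvg (g_ := fun n w => f_ n (path 0 w)) (M := M)) => //.
      by move=> n; have [_ []] := Kf n.
    by apply: aeW => w.
  have e12 n : Ex P (fun w => f_ n (path h w)) = Ex P (fun w => f_ n (path 0 w)).
    by have [] := Kf n.
  rewrite (eq_cvg _ _ e12) in c1; exact: cvg_unique c1 c2.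
have K_cos t : K (fun u => cos (lc t u)).
  split; [by apply: bounded_meas_cos; exact: measurable_lcomb_path..|].
  by apply: Ex_trig; exact: bounded_meas_cos.
have K_sin t : K (fun u => sin (lc t u)).
  split; [by apply: bounded_meas_sin; exact: measurable_lcomb_path..|].
  by apply: Ex_trig; exact: bounded_meas_sin.
have [[_ _ h1] [_ _ h2]] := trigonometric_class K_lin K_lim K_cos K_sin sA s.
by [].
Qed.

(* Mixing of the increments makes invariant events independent of themselves. *)
Lemma invariant_event_01 (A : set (R -> R)) : <<s coord_system (@coord R) >> A ->
  (forall h w, A (path h w) <-> A (path 0 w)) ->
  (forall s t, mixes P (fun h w => lc s (path h w)) (fun w => cos (lc t (path 0 w))) /\
    mixes P (fun h w => lc s (path h w)) (fun w => sin (lc t (path 0 w)))) ->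
  P (path 0 @^-1` A) = 0%E \/ P (path 0 @^-1` A) = 1%E.
Proof.
move=> sA invA mix.
pose Z (w : T) : R := \1_A (path 0 w).
have ZE : Z = \1_(path 0 @^-1` A) by apply/funext => w; rewrite /Z !indicE.
have mA : measurable (path 0 @^-1` A) by exact: measurable_path_preimage.
have bZ : bounded_meas Z by rewrite ZE; exact: bounded_meas_indic.
have limM (f_ : nat -> (R -> R) -> R) f (M : R) : (forall n u, `|f_ n u| <= M) ->
    (forall u, f_ n u @[n --> \oo] --> f u) ->
    (forall n, bounded_meas (fun w => f_ n (path 0 w))) ->
    [/\ forall u, `|f u| <= M, bounded_meas (fun w => f (path 0 w)) &
      Ex P (fun w => `|f_ n (path 0 w) - f (path 0 w)|) @[n --> \oo] --> (0 : R)].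
  move=> fM fc bf_.
  have fM' u : `|f u| <= M.
    have c : `|f_ n u| @[n --> \oo] --> `|f u| by exact: cvg_norm.
    have c' : M @[_ --> \oo] --> M by exact: cvg_cst.
    by apply: (ler_cvg_to c c'); apply: nearW => n; exact: fM.
  have mf : measurable_fun setT (fun w => f (path 0 w)).
    apply: (measurable_fun_cvg (h := fun n w => f_ n (path 0 w))) => //.
    by move=> n; have [] := bf_ n.
  split => //; first by split => //; exists M.
  apply: (cvg_L1_ae (zn := fun n w => f_ n (path 0 w)) (M := M)) => //.
    by move=> n; have [] := bf_ n.
  by apply: aeW.
have covL (g f f' : T -> R) a : bounded_meas g -> bounded_meas f -> bounded_meas f' ->
    cov P g (fun w => a * f w + f' w) = a * cov P g f + cov P g f'.
  move=> bg bf bf'; have baf := bounded_measZ a bf.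
  rewrite /cov (ExD P baf bf') (ExZ P a bf).
  have -> : (fun w => g w * (a * f w + f' w)) = fun w => a * (g w * f w) + g w * f' w.
    by apply/funext => w; ring.
  have bgf := bounded_measM bg bf; have bgf' := bounded_measM bg bf'.
  by rewrite (ExD P (bounded_measZ a bgf) bgf') (ExZ P a bgf); ring.
(* The class argument in the second variable, with the shifted combination fixed, replaces the
   trigonometric test functions by the indicator of the event. *)
have mixZ s : mixes P (fun h w => lc s (path h w)) Z.
  pose Y (h : nat) w := lc s (path h w).
  have mY h : measurable_fun setT (Y h) by exact: measurable_lcomb_path.
  pose K (q : (R -> R) -> R) := bounded_meas (fun w => q (path 0 w)) /\
    mixes P Y (fun w => q (path 0 w)).
  have K_lin a f g : K f -> K g -> K (fun u => a * f u + g u).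
    move=> [bf [mf1 mf2]] [bg [mg1 mg2]]; split.
      by apply: bounded_measD => //; exact: bounded_measZ.
    have z0 : (0 : R) = a * 0 + 0 by rewrite mulr0 addr0.
    split; rewrite [X in _ --> X]z0.
    - under eq_fun do rewrite (covL _ _ _ _ (bounded_meas_cos (mY _)) bf bg).
      by apply: cvgD => //; exact: cvgMl_tmp.
    - under eq_fun do rewrite (covL _ _ _ _ (bounded_meas_sin (mY _)) bf bg).
      by apply: cvgD => //; exact: cvgMl_tmp.
  have K_lim (f_ : nat -> (R -> R) -> R) f (M : R) : (forall n, K (f_ n)) ->
      (forall n u, `|f_ n u| <= M) -> (forall u, f_ n u @[n --> \oo] --> f u) -> K f.
    move=> Kf fM fc; have [_ bf L1] := limM f_ f M fM fc (fun n => (Kf n).1).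
    split => //; apply: (mixes_L1 (zn := fun n w => f_ n (path 0 w)) mY) => //.
      by move=> n; exact: (Kf n).1.
    by move=> n; exact: (Kf n).2.
  have K_cos t : K (fun u => cos (lc t u)).
    split; first by apply: bounded_meas_cos; exact: measurable_lcomb_path.
    exact: (mix s t).1.
  have K_sin t : K (fun u => sin (lc t u)).
    split; first by apply: bounded_meas_sin; exact: measurable_lcomb_path.
    exact: (mix s t).2.
  have [[_ h1] _] := trigonometric_class K_lin K_lim K_cos K_sin sA [::].
  move: h1; congr (mixes P Y _); apply/funext => w.
  by rewrite /lcomb big_nil cos0 mulr1.
have AE h w : \1_A (path h w) = Z w :> R.
  rewrite /Z !indicE; congr (nat_of_bool _)%:R.
  by apply/idP/idP => /set_mem h0; apply/mem_set; [exact: (invA h w).1|exact: (invA h w).2].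
(* By stationarity and invariance of the event this covariance has the same value for every shift,
   so that value equals the limit 0. *)
have indep s : cov P (fun w => cos (lc s (path 0 w))) Z = 0 /\
    cov P (fun w => sin (lc s (path 0 w))) Z = 0.
  have [cc cs] := mixZ s.
  have sT : <<s coord_system (@coord R) >> setT.
    apply: sub_sigma_algebra; exists 0, setT; split; first exact: measurableT.
    by rewrite preimage_setT.
  have e1 h : cov P (fun w => cos (lc s (path h w))) Z =
      cov P (fun w => cos (lc s (path 0 w))) Z.
    have := (Ex_path_shift h s sA).1; under eq_fun do rewrite AE mulrC.
    under [in RHS]eq_fun do rewrite AE mulrC.
    have := (Ex_path_shift h s sT).1; under eq_fun do rewrite indicT mul1r.
    by under [in RHS]eq_fun do rewrite indicT mul1r; rewrite /cov => -> ->.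
  have e2 h : cov P (fun w => sin (lc s (path h w))) Z =
      cov P (fun w => sin (lc s (path 0 w))) Z.
    have := (Ex_path_shift h s sA).2; under eq_fun do rewrite AE mulrC.
    under [in RHS]eq_fun do rewrite AE mulrC.
    have := (Ex_path_shift h s sT).2; under eq_fun do rewrite indicT mul1r.
    by under [in RHS]eq_fun do rewrite indicT mul1r; rewrite /cov => -> ->.
  rewrite (eq_cvg _ _ e1) in cc; rewrite (eq_cvg _ _ e2) in cs.
  have lim_cst0 (a : R) : a @[_ --> \oo] --> (0 : R) -> a = 0.
    move=> c; have c' : a @[_ --> \oo] --> a by exact: cvg_cst.
    exact: cvg_unique c' c.
  by split; exact: lim_cst0.
(* The class argument once more, now in the first variable: the event is uncorrelated with all
   trigonometric functions of the path, hence with itself. *)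
pose K (q : (R -> R) -> R) := bounded_meas (fun w => q (path 0 w)) /\
  cov P (fun w => q (path 0 w)) Z = 0.
have covC (g f : T -> R) : cov P g f = cov P f g.
  by rewrite /cov mulrC; congr (Ex P _ - _); apply/funext => w; rewrite mulrC.
have K_lin a f g : K f -> K g -> K (fun u => a * f u + g u).
  move=> [bf cf] [bg cg]; split.
    by apply: bounded_measD => //; exact: bounded_measZ.
  by rewrite covC (covL _ _ _ _ bZ bf bg) 2!(covC Z) cf cg mulr0 addr0.
have K_lim (f_ : nat -> (R -> R) -> R) f (M : R) : (forall n, K (f_ n)) ->
    (forall n u, `|f_ n u| <= M) -> (forall u, f_ n u @[n --> \oo] --> f u) -> K f.
  move=> Kf fM fc; have [_ bf L1] := limM f_ f M fM fc (fun n => (Kf n).1).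
  split => //; rewrite covC; apply/eqP; rewrite -normr_le0.
  have Z1 w : `|Z w| <= 1.
    by rewrite /Z indicE; case: (_ \in _); rewrite ?normr1 ?normr0.
  have c0 : 2 * Ex P (fun w => `|f_ n (path 0 w) - f (path 0 w)|) @[n --> \oo] --> (0 : R).
    by rewrite -[X in _ --> X](mulr0 2); exact: cvgMl_tmp.
  have cc : `|cov P Z (fun w => f (path 0 w))| @[_ --> \oo] -->
      `|cov P Z (fun w => f (path 0 w))| by exact: cvg_cst.
  apply: (ler_cvg_to cc c0); apply: nearW => n.
  have := norm_cov_diff P bZ Z1 (Kf n).1 bf.
  by rewrite (covC Z) (Kf n).2 sub0r normrN.
have K_cos t : K (fun u => cos (lc t u)).
  split; first by apply: bounded_meas_cos; exact: measurable_lcomb_path.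
  exact: (indep t).1.
have K_sin t : K (fun u => sin (lc t u)).
  split; first by apply: bounded_meas_sin; exact: measurable_lcomb_path.
  exact: (indep t).2.
have [[_ h1] _] := trigonometric_class K_lin K_lim K_cos K_sin sA [::].
(* An indicator equals its square, so vanishing variance reads p = p^2. *)
have : cov P Z Z = 0.
  move: h1; rewrite (_ : (fun w => _ * _) = Z)//; apply/funext => w.
  by rewrite /lcomb big_nil cos0 mulr1.
rewrite /cov (_ : (fun w => Z w * Z w) = Z); last first.
  by apply/funext => w; rewrite /Z indicE; case: (_ \in _); rewrite ?mulr1 ?mulr0.
rewrite ZE Ex_indic//; set p := fine _.
have -> : P (path 0 @^-1` A) = p%:E by rewrite /p fineK// fin_num_measure.
rewrite -{1}[p]mulr1 -mulrBr => /eqP; rewrite mulf_eq0 subr_eq0.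
by move=> /orP[/eqP ->|/eqP <-]; [left|right].
Qed.

End increments.

(** * Integral representation of the increments *)

Section simma.
Context (R : realType) (d d' : measure_display) (T : measurableType d)
  (P : probability T R) (V : measurableType d')
  (m : {sigma_finite_measure set V -> \bar R})
  (W : set (measurableTypeR R * V) -> {RV P >-> R})
  (f f0 : measurableTypeR R * V -> R) (X : R -> {RV P >-> R}).
Hypothesis X_int : forall t : R,
  is_stoch_integral m W (fun x => f (t - x.1, x.2) - f0 (- x.1, x.2)) (X t).
Local Notation E := (measurableTypeR R * V)%type.
Local Notation path := (increment_path X).
Local Notation lc := (lcomb (@coord R)).

(* The kernel of a linear combination of the increments [X t - X 0], in which
   [f0] cancels out. *)
Definition increment_kernel (s : seq (R * R)) (x : E) : R :=
  \sum_(p <- s) p.1 * (f (p.2 - x.1, x.2) - f (- x.1, x.2)).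

(** The kernels of X at times t + h and h share the term in [f0], which their difference loses; what
    is left depends on time only through x.1 - h, so shifting the increments translates the
    kernel. *)
Lemma increment_approx_integral s (h : nat) : exists e : nat -> elem m,
  approx_integral W (fun x => increment_kernel s (x.1 - h%:R, x.2))
    (fun w => lc s (path h w)) e.
Proof.
elim: s => [|[a t] s [e he]].
  exists (fun=> el_zero m); have := @approx_integral_zero _ _ _ _ _ _ m W.
  congr approx_integral; apply/funext => x.
  - by rewrite /increment_kernel big_nil.
  - by rewrite /lcomb big_nil.
have [e1 he1] := stoch_integral_approx (X_int (t + h%:R)).
have [e2 he2] := stoch_integral_approx (X_int h%:R).
have := approx_integral_add (approx_integral_scale a
  (approx_integral_add he1 (approx_integral_scale (- 1) he2))) he.
move=> h'; eexists; move: h'.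
congr approx_integral; apply/funext => x.
- rewrite /increment_kernel big_cons /=; congr (_ * _ + _).
  have -> : t - (x.1 - h%:R) = t + h%:R - x.1 by ring.
  have -> : - (x.1 - h%:R) = h%:R - x.1 by ring.
  by ring.
- rewrite /lcomb big_cons /= /coord /increment_path; congr (_ * _ + _).
  by ring.
Qed.

End simma.

Theorem theorem3p7 (R : realType) (d d' : measure_display)
    (T : measurableType d) (P : probability T R)
    (V : measurableType d') (m : {sigma_finite_measure set V -> \bar R})
    (W : set (measurableTypeR R * V) -> {RV P >-> R})
    (theta sigma2 : V -> R) (rho : R.-ker V ~> measurableTypeR R)
    (f f0 : measurableTypeR R * V -> R) (X : R -> {RV P >-> R})
    (mtheta : measurable_fun setT theta)
    (msigma2 : measurable_fun setT sigma2)
    (sigma2_ge0 : forall v, 0 <= sigma2 v)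
    (rho_levy : forall v, levy_measure (rho v))
    (W_id : id_random_measure m W)
    (W_char : has_characteristics m W theta sigma2 rho)
    (W_pure : m [set v | rho v setT = 0%E /\ sigma2 v = 0] = 0%E)
    (mf : measurable_fun setT f) (mf0 : measurable_fun setT f0)
    (X_int : forall t : R,
       is_stoch_integral m W (fun x => f (t - x.1, x.2) - f0 (- x.1, x.2)) (X t))
    (X_stat : stationary_increments P X)
    (X_cont : continuous_in_prob P X)
    (X_sep : separable_dyadic P X)
    (f_sep : separable_dyadic (lebesgue_measure \x m)%E
       (fun t x => f (t - x.1, x.2))) :
  let BV := [set w | forall a b : R, a < b ->
                (total_variation a b (fun t => X t w) < +oo)%E] in
  completed_prob P BV 0%E \/ completed_prob P BV 1%E.
Proof.
move=> BV.
have sA : <<s coord_system (@coord R) >> (@dyadic_BV R) by exact: dyadic_BV_measurable.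
have pathE h w : dyadic_BV (increment_path X h w) <-> dyadic_BV (fun t => X t w).
  exact: (dyadic_BV_shift (fun t => X t w)).
have invA h w : dyadic_BV (increment_path X h w) <-> dyadic_BV (increment_path X 0 w).
  by split=> [/pathE ?|/pathE ?]; apply/pathE.
have mix s t : mixes P (fun h w => lcomb (@coord R) s (increment_path X h w))
      (fun w => cos (lcomb (@coord R) t (increment_path X 0 w))) /\
    mixes P (fun h w => lcomb (@coord R) s (increment_path X h w))
      (fun w => sin (lcomb (@coord R) t (increment_path X 0 w))).
  have [e he] := choice (increment_approx_integral X_int s).
  have [g hg] := increment_approx_integral X_int t 0.
  exact: (mixes_approx_integral msigma2 sigma2_ge0 rho_levy W_id W_char he hg).
have zo := invariant_event_01 X_stat sA invA mix.
set A := increment_path X 0 @^-1` _ in zo.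
have mA : measurable A by exact: measurable_path_preimage.
have [N [mN N0 sepN]] := X_sep.
have AE w : A w <-> dyadic_BV (fun t => X t w) by exact: pathE.
have BVA : BV `<=` A by move=> w BVw; apply/AE; exact: dyadic_BV_total_variation.
(* [BV] refers to uncountably many times. It is caught between [A] without [N] and [A], where the
   null set [N] contains all points at which separability fails. *)
have ABV : A `\` N `<=` BV.
  move=> w [Aw nNw] a b ab; apply: total_variation_dyadic_BV ab; last exact/AE.
  by apply: contrapT => h; apply: nNw; exact: sepN.
have mAN : measurable (A `\` N) by exact: measurableD.
have PAN : P (A `\` N) = P A.
  rewrite measureD//; last exact: (le_lt_trans (probability_le1 P mA) (ltry 1)).
  rewrite (_ : (_ (A `&` N) = 0)%E) ?sube0//.
  apply: (subset_measure0 _ mN _ N0); first exact: measurableI.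
  exact: subIsetr.
(* [BV] is the measurable set [A] without [N] together with a subset of the null set [N]. *)
have comp : completed_algebra_gen P BV.
  exists (A `\` N) => //; exists (BV `&` N).
    by exists N; split => //; exact: subIsetr.
  apply/seteqP; split => w; first by move=> [/ABV|[]].
  move=> BVw; have [Nw|nNw] := pselect (N w); first by right.
  by left; split => //; exact: BVA.
have outer : ((P^*)%mu BV = P A)%E.
  apply/eqP; rewrite eq_le; apply/andP; split.
    by rewrite -(measurable_mu_extE P mA); exact: le_mu_ext.
  by rewrite -PAN -(measurable_mu_extE P mAN); exact: le_mu_ext.
by case: zo => zo; [left|right]; split => //; rewrite outer zo.
Qed.
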